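(* Let $1<r<2$ and let $r'=r/(r-1)$ be the dual exponent. There is a constant $C_r>0$ such that the following holds. For every $\delta>0$ there is a constant $C_{r,\delta}>0$ such that, for every integer $y\ge 1$, setting $N_{r,y}=e^{C_{r,\delta}y^{\delta}}$, for all integers $N>N_{r,y}$ and all finitely supported $f:\mathbb Z\to\mathbb C$, $$\max_{1\le b\le y,\ (b,y)=1}\ \lVert A_{N,y,b}f\rVert_{\ell^{r'}(\mathbb Z)}\le C_r\Big(\frac{y}{N}\Big)^{\frac1r-\frac1{r'}}\lVert f\rVert_{\ell^r(\mathbb Z)}.$$
   Context: $\Lambda$ denotes the von Mangoldt function and $\phi$ the Euler totient function. For integers $y\ge1$, $b$ with $(b,y)=1$, $N\ge y$, and $f:\mathbb Z\to\mathbb C$, the average along primes in the progression $b \bmod y$ is $$A_{N,y,b}f(x)=\frac{\phi(y)}{N}\sum_{\substack{1\le n<N\\ n\equiv b \bmod y}}\Lambda(n)f(x-n),\qquad x\in\mathbb Z.$$ *)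

(* Defs.v *)
From HB Require Import structures.
From mathcomp Require Import all_boot all_order all_algebra.
From mathcomp Require Import all_classical all_reals all_analysis.
From mathcomp Require Import complex.
Set Implicit Arguments. Unset Strict Implicit. Unset Printing Implicit Defensive.
Import Order.TTheory GRing.Theory Num.Theory.
Local Open Scope ring_scope.
Local Open Scope classical_set_scope.

(* von Mangoldt function: Lambda n = log p if n = p^k (p prime, k >= 1),
   and 0 otherwise.  n is a prime power (k >= 1) iff n has exactly one
   prime divisor. *)
Definition vonMangoldt (R : realType) (n : nat) : R :=
  match primes n with
  | [:: p] => ln (p%:R : R)
  | _ => 0
  end.

Definition Aavg (R : realType) (N y b : nat) (f : int -> R[i]) (x : int) : R[i] :=
  ((totient y)%:R / N%:R)%:C%C *
  \sum_(1 <= n < N | (n %% y == b %% y)%N) ((vonMangoldt R n)%:C%C * f (x - Posz n)%R).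

Definition lpnorm (R : realType) (p : R) (f : int -> R[i]) : R :=
  (fine (\esum_(x in [set: int]) ((ComplexField.Normc.normc (f x)) `^ p)%:E)) `^ p^-1.

Definition finitely_supported (R : realType) (f : int -> R[i]) : Prop :=
  finite_set [set x : int | f x != 0].

(* Main.v *)
Require Import Defs.
From HB Require Import structures.
From mathcomp Require Import all_boot all_order all_algebra.
From mathcomp Require Import all_classical all_reals all_analysis.
From mathcomp Require Import complex.
From mathcomp Require Import fintype finset ring lra zify.
Set Implicit Arguments. Unset Strict Implicit. Unset Printing Implicit Defensive.
Import Order.TTheory GRing.Theory Num.Theory.
Local Open Scope ring_scope.

(** Only an upper bound is needed, so no information on the distribution of
    primes in progressions enters.  Up to the few powers of small primes,
    [Lambda n <= log N * S n], where [S] is the square of Selberg's linear form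
    of level [z], a small power of [N], sieving by the primes not dividing [y].
    [S] has an explicit Ramanujan expansion [S = \sum_U w_U c_U], the squarefree
    moduli being products [q_U] over sets [U] of primes, and
    [|w_U| <= 8^|U| / (q_U G)] with [G >= phi(y)/y * log z].

    For sets X, Y of density product [x] in intervals of length [M ~ N / y], the
    moduli [q_U <= Q] are estimated by moments of a truncated divisor function,
    and the moduli [q_U > Q] on l^2, by almost orthogonality of the [c_U]; for
    [Q ~ x^-4] the bilinear form is at most [C M x^s] for every [s < 1].  If
    [x] is smaller than a power of [1 / log N], then [Lambda <= log N] suffices.
    Dyadic level sets interpolate these bounds to functions, splitting the
    integers into classes modulo [y] and blocks of length [M y] makes them
    global, and duality turns the bilinear bound into the norm estimate. *)

(** * Sums of periodic functions *)

Definition nat_periodic (T : Type) (F : nat -> T) (d : nat) : Prop :=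
  forall x, F (x + d)%N = F x.

Section Periodic.
Variables (T : Type) (F : nat -> T) (d : nat).
Hypothesis Fper : nat_periodic F d.

Lemma nat_periodic_mulD k x : F (k * d + x)%N = F x.
Proof.
elim: k x => [|k IH] x; first by rewrite mul0n.
by rewrite mulSn -addnA addnC Fper IH.
Qed.

Lemma nat_periodic_modn x : F (x %% d)%N = F x.
Proof. by rewrite [in RHS](divn_eq x d) nat_periodic_mulD. Qed.

Lemma nat_periodic_dvdn e : (d %| e)%N -> nat_periodic F e.
Proof. by move=> /dvdnP[k ->] x; rewrite addnC nat_periodic_mulD. Qed.

End Periodic.

Lemma dvdn_affine_periodic d b y : nat_periodic (fun x => d %| b + y * x)%N d.
Proof. by move=> x; rewrite mulnDr addnA dvdn_addl // dvdn_mull. Qed.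

Section PeriodicSums.

Lemma sum_ord_mul (V : nmodType) (F : nat -> V) a b :
  \sum_(x < a * b) F x = \sum_(i < a) \sum_(j < b) F (i * b + j)%N.
Proof.
rewrite -(big_mkord xpredT) big_nat_mul big_mkord; apply: eq_bigr => i _.
rewrite -{1}[(i * b)%N]add0n big_addn mulSn addnK big_mkord.
by apply: eq_bigr => j _; rewrite addnC.
Qed.

Lemma sum_periodic_mul (V : nmodType) (F : nat -> V) a d : nat_periodic F d ->
  \sum_(x < a * d) F x = (\sum_(x < d) F x) *+ a.
Proof.
move=> Fper; rewrite sum_ord_mul.
under eq_bigr do under eq_bigr do rewrite (nat_periodic_mulD Fper).
by rewrite sumr_const card_ord.
Qed.

Lemma sum_periodic_le (R : realFieldType) (F : nat -> R) d (T : nat) : (0 < d)%N ->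
  nat_periodic F d -> (forall x, 0 <= F x) ->
  \sum_(x < T) F x <= (T%:R / d%:R + 1) * \sum_(x < d) F x.
Proof.
move=> d0 Fper F0.
have leT : (T <= (T %/ d).+1 * d)%N by rewrite ltnW // ltn_ceil.
apply: (@le_trans _ _ (\sum_(x < (T %/ d).+1 * d) F x)).
  rewrite -!(big_mkord xpredT) [leRHS](@big_cat_nat _ _ _ T) //=.
  by rewrite lerDl sumr_ge0.
rewrite sum_periodic_mul // -[leLHS]mulr_natl ler_wpM2r ?sumr_ge0 // -natr1 lerD2r.
by rewrite ler_pdivlMr ?ltr0n // -natrM ler_nat leq_divM.
Qed.

Lemma sum_periodic_norm_le (R : realFieldType) (F : nat -> R) d (T : nat) (C : R) :
  (0 < d)%N -> nat_periodic F d -> (forall x, `|F x| <= C) ->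
  `|\sum_(x < T) F x| <= T%:R / d%:R * `|\sum_(x < d) F x| + d%:R * C.
Proof.
move=> d0 Fper FC.
have C0 : 0 <= C by apply: le_trans (FC 0%N).
rewrite -[in leLHS](big_mkord xpredT F) [in leLHS](divn_eq T d).
rewrite (@big_cat_nat _ _ _ (T %/ d * d)%N) ?leq_addr //= big_mkord.
rewrite sum_periodic_mul // -[_ *+ (T %/ d)]mulr_natl.
apply: le_trans (ler_normD _ _) _; apply: lerD.
  rewrite normrM ger0_norm ?ler0n // ler_wpM2r //.
  by rewrite ler_pdivlMr ?ltr0n // -natrM ler_nat leq_divM.
apply: le_trans (ler_norm_sum _ _ _) _.
apply: (@le_trans _ _ (\sum_(T %/ d * d <= i < T %/ d * d + T %% d) C)).
  by apply: ler_sum => i _.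
by rewrite sumr_const_nat addKn -[leLHS]mulr_natl ler_wpM2r // ler_nat ltnW // ltn_pmod.
Qed.

Lemma modn_affine_inj m n j : (0 < m)%N -> coprime m n ->
  {in gtn m &, injective (fun i => (i * n + j) %% m)%N}.
Proof.
move=> m0 cop i i'; rewrite !inE => im im' /eqP; rewrite eqn_modDr => /eqP e.
rewrite -(modn_small im) -(modn_small im').
wlog le_ii' : i i' e im im' / (i <= i')%N.
  move=> ordered; case/orP: (leq_total i i') => le_ii'; first exact: ordered.
  by symmetry; apply: ordered => //; exact: esym.
apply/eqP; rewrite eq_sym eqn_mod_dvd // -(@Gauss_dvdl _ _ n) // mulnBl.
by rewrite -eqn_mod_dvd ?leq_mul2r ?le_ii' ?orbT // e.
Qed.

Lemma sum_affine (V : nmodType) (F : nat -> V) m n j : (0 < m)%N -> coprime m n ->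
  nat_periodic F m -> \sum_(i < m) F (i * n + j)%N = \sum_(i < m) F i.
Proof.
move=> m0 cop Fper; pose h (i : 'I_m) : 'I_m := Ordinal (ltn_pmod (i * n + j) m0).
have h_inj : injective h.
  by move=> i i' /(congr1 val) /= /(modn_affine_inj m0 cop) /val_inj ->; rewrite ?inE.
rewrite [RHS](reindex_inj h_inj) /=; apply: eq_bigr => i _.
by rewrite nat_periodic_modn.
Qed.

Lemma sum_crt (S : pzSemiRingType) (F H : nat -> S) m n : (0 < m)%N -> coprime m n ->
  nat_periodic F m -> nat_periodic H n ->
  \sum_(x < m * n) F x * H x = (\sum_(x < m) F x) * (\sum_(x < n) H x).
Proof.
move=> m0 cop Fper Hper.
rewrite (sum_ord_mul (fun x => F x * H x)) exchange_big /= mulr_sumr.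
apply: eq_bigr => j _.
under eq_bigr do rewrite (nat_periodic_mulD Hper).
by rewrite -mulr_suml sum_affine.
Qed.

Lemma coprime_prod_primes (s : seq nat) p : prime p -> all prime s -> p \notin s ->
  coprime p (\prod_(r <- s) r).
Proof.
move=> pp sp ps; rewrite prime_coprime // Euclid_dvd_prod // big_has.
apply/hasPn => r rs; rewrite dvdn_prime2 ?(allP sp _ rs) //.
by apply: contraNneq ps => ->.
Qed.

Lemma dvdn_prod_primes (s : seq nat) n : uniq s -> all prime s ->
  (\prod_(p <- s) p %| n)%N = all (fun p => p %| n)%N s.
Proof.
elim: s => [|p s IH] /=; first by rewrite big_nil dvd1n.
move=> /andP[ps us] /andP[pp sp]; rewrite big_cons Gauss_dvd ?IH //.
exact: coprime_prod_primes.
Qed.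

Lemma sum_prod_crt (S : pzSemiRingType) (s : seq nat) (F : nat -> nat -> S) :
  uniq s -> all prime s -> {in s, forall p, nat_periodic (F p) p} ->
  \sum_(x < \prod_(p <- s) p) \prod_(p <- s) F p x
    = \prod_(p <- s) \sum_(x < p) F p x.
Proof.
elim: s => [|p s IH] /=; first by rewrite !big_nil big_ord1 big_nil.
move=> /andP[ps us] /andP[pp sp] Fper; rewrite !big_cons.
have Fper' : {in s, forall q, nat_periodic (F q) q}.
  by move=> q qs; apply: Fper; rewrite inE qs orbT.
under eq_bigr do rewrite big_cons.
rewrite (@sum_crt _ (F p) (fun x => \prod_(q <- s) F q x)) ?prime_gt0 ?IH //.
- exact: coprime_prod_primes.
- by apply: Fper; rewrite mem_head.
move=> x; apply: eq_big_seq => q qs.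
apply: (nat_periodic_dvdn (Fper' q qs)).
by rewrite (bigD1_seq q) //= dvdn_mulr.
Qed.

End PeriodicSums.

(** * The Selberg sieve over sets of primes *)

Section SetSums.
Variables (R : numDomainType) (T : finType).
Implicit Types A B C U : {set T}.

Lemma card_setD_fiber U C : (#|[set B | B :\: U == C]| <= 2 ^ #|U|)%N.
Proof.
rewrite -card_powerset -(@card_in_imset _ _ (fun B => B :&: U)).
  by apply: subset_leq_card; apply/subsetP => _ /imsetP[B _ ->]; rewrite inE subsetIr.
move=> B B'; rewrite !inE => /eqP BC /eqP B'C e.
by rewrite -(setID B U) -(setID B' U) BC B'C e.
Qed.

Lemma sum_setD_le (D : {set {set T}}) (h : {set T} -> R) U :
  (forall A, A \in D -> A :\: U \in D) -> (forall A, A \in D -> 0 <= h A) ->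
  \sum_(A in D) h (A :\: U) <= 2 ^+ #|U| * \sum_(A in D) h A.
Proof.
move=> DU h0; rewrite (partition_big (fun A => A :\: U) (mem D)) //= mulr_sumr.
apply: ler_sum => C CD.
rewrite (eq_bigr (fun=> h C)); last by move=> A /andP[_ /eqP->].
rewrite sumr_const -[leLHS]mulr_natl ler_wpM2r ?h0 //.
rewrite -natrX ler_nat (leq_trans _ (card_setD_fiber U C)) //.
by apply: subset_leq_card; apply/subsetP => A; rewrite !inE => /andP[].
Qed.

End SetSums.

Section Moduli.
Variables (z y : nat).
Local Notation I := 'I_z.+1.
Implicit Types (A B U : {set I}) (p : I) (Q : nat).

Definition sieve_primes : {set I} := [set p : I | prime p & ~~ (p %| y)%N].
Local Notation PP := sieve_primes.

Definition modulus A : nat := \prod_(p in A) (p : nat).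

Definition moduli Q : {set {set I}} :=
  [set A : {set I} | (A \subset PP) && (modulus A <= Q)%N].

Lemma sieve_coprime p : p \in PP -> coprime p y.
Proof. by rewrite inE => /andP[pp py]; rewrite prime_coprime. Qed.

Lemma in_sieve_prime A p : A \subset PP -> p \in A -> prime p.
Proof. by move=> /subsetP AP /AP; rewrite inE => /andP[]. Qed.

Lemma modulus0 : modulus set0 = 1%N. Proof. by rewrite /modulus big_set0. Qed.

Lemma modulus_gt0 A : A \subset PP -> (0 < modulus A)%N.
Proof. by move=> AP; apply: prodn_cond_gt0 => p /(in_sieve_prime AP)/prime_gt0. Qed.

Lemma dvdn_modulus A p : p \in A -> (p %| modulus A)%N.
Proof. by move=> pA; rewrite /modulus (bigD1 p) //= dvdn_mulr. Qed.

Lemma modulusUD A B : modulus (A :|: B) = (modulus A * modulus (B :\: A))%N.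
Proof. by rewrite /modulus (big_setID A) /= setUK setDUl setDv set0U. Qed.

Lemma modulusDK A B : A \subset B -> modulus B = (modulus A * modulus (B :\: A))%N.
Proof. by move=> /setUidPr AB; rewrite -modulusUD AB. Qed.

Lemma dvdn_modulus_subset A B : A \subset B -> (modulus A %| modulus B)%N.
Proof. by move=> /modulusDK ->; rewrite dvdn_mulr. Qed.

Lemma modulus_subset A B : B \subset PP -> A \subset B -> (modulus A <= modulus B)%N.
Proof. by move=> BP AB; rewrite dvdn_leq ?modulus_gt0 ?dvdn_modulus_subset. Qed.

Lemma modulusE A : modulus A = \prod_(p <- [seq val p | p <- enum A]) p.
Proof. by rewrite big_map big_enum. Qed.

Lemma enum_sieve_prime A : A \subset PP -> all prime [seq val p | p <- enum A].
Proof.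
move=> AP; apply/allP => _ /mapP[p + ->]; rewrite mem_enum; exact: in_sieve_prime AP.
Qed.

Lemma enum_val_uniq A : uniq [seq val p | p <- enum A].
Proof. by rewrite map_inj_uniq ?enum_uniq //; apply: val_inj. Qed.

Lemma modulus_dvdP A n : A \subset PP ->
  reflect (forall p, p \in A -> (p %| n)%N) (modulus A %| n)%N.
Proof.
move=> AP; rewrite modulusE dvdn_prod_primes ?enum_val_uniq ?enum_sieve_prime //.
apply: (iffP allP) => h p.
  by move=> pA; apply: h; apply: map_f; rewrite mem_enum.
by case/mapP => r + ->; rewrite mem_enum => /h.
Qed.

Lemma modulus_dvd_prime A p : A \subset PP -> p \in PP ->
  (p %| modulus A)%N = (p \in A).
Proof.
move=> AP pP; apply/idP/idP => [|/dvdn_modulus //].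
have pp : prime p := in_sieve_prime (subxx PP) pP.
rewrite /modulus Euclid_dvd_prod // big_has_cond => /hasP[r _ /andP[rA]].
by rewrite dvdn_prime2 ?(in_sieve_prime AP rA) // => /eqP/val_inj ->.
Qed.

Lemma modulus_inj : {in [pred A : {set I} | A \subset PP] &, injective modulus}.
Proof.
move=> A B AP BP e; apply/setP => p; have [pP|pP] := boolP (p \in PP).
  by rewrite -(modulus_dvd_prime AP pP) -(modulus_dvd_prime BP pP) e.
have notin (C : {set I}) : C \subset PP -> (p \in C) = false.
  by move=> CP; apply: contraNF pP; exact: (subsetP CP p).
by rewrite !notin.
Qed.

Lemma moduliP A Q : reflect (A \subset PP /\ (modulus A <= Q)%N) (A \in moduli Q).
Proof. by rewrite inE; exact: andP. Qed.

Lemma moduli_sub A Q : A \in moduli Q -> A \subset PP.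
Proof. by case/moduliP. Qed.

Lemma moduli_subset A B Q : B \in moduli Q -> A \subset B -> A \in moduli Q.
Proof.
move=> /moduliP[BP BQ] AB; apply/moduliP; split; first exact: subset_trans BP.
exact: leq_trans (modulus_subset BP AB) BQ.
Qed.

Lemma moduliD A B Q : A \in moduli Q -> A :\: B \in moduli Q.
Proof. by move=> AQ; apply: moduli_subset AQ (subsetDl _ _). Qed.

Lemma moduliU A B Q Q' : A \in moduli Q -> B \in moduli Q' -> A :|: B \in moduli (Q * Q').
Proof.
move=> /moduliP[AP AQ] /moduliP[BP BQ]; apply/moduliP; rewrite subUset AP BP; split => //.
by rewrite modulusUD leq_mul // (leq_trans _ BQ) // modulus_subset ?subsetDl.
Qed.

Lemma moduli0 Q : (0 < Q)%N -> set0 \in moduli Q.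
Proof. by move=> Q0; apply/moduliP; rewrite sub0set modulus0. Qed.

Lemma moduli_leq A Q Q' : (Q <= Q')%N -> A \in moduli Q -> A \in moduli Q'.
Proof. by move=> QQ /moduliP[AP AQ]; apply/moduliP; split; rewrite ?(leq_trans AQ). Qed.

Lemma sieve_prime_ge2 (R : numDomainType) A p : A \subset PP -> p \in A -> 2 <= p%:R :> R.
Proof. by move=> AP pA; rewrite ler_nat prime_gt1 // (in_sieve_prime AP). Qed.

End Moduli.

Section Sieve.
Variables (R : realFieldType) (z y : nat).
Local Notation I := 'I_z.+1.
Local Notation PP := (sieve_primes z y).
Local Notation D := (moduli z y z).
Implicit Types (A B U : {set I}) (n : nat) (p : I).

Definition modulus_phi A : R := \prod_(p in A) (p%:R - 1).

Definition sieve_mass : R := \sum_(A in D) (modulus_phi A)^-1.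
Local Notation G := sieve_mass.

Definition ramanujan_prime n p : R := p%:R * (p %| n)%N%:R - 1.

(* The Ramanujan sum c_q(n) for q = modulus A. *)
Definition ramanujan n A : R := \prod_(p in A) ramanujan_prime n p.

(* Selberg's linear form, written as a truncated Ramanujan expansion. *)
Definition selberg n : R :=
  G^-1 * \sum_(A in D) (-1) ^+ #|A| / modulus_phi A * ramanujan n A.

(* Factor at a prime of size t of the coefficient of [ramanujan n U] in
   [ramanujan n A * ramanujan n B]; a, b, u tell which of A, B, U contain the prime.
   It comes from [c ^+ 2 = (t - 2) * c + (t - 1)] for [c = ramanujan_prime n p]. *)
Definition ramanujan_mulcoef_prime (a b u : bool) (t : R) : R :=
  if u then (if a && b then t - 2 else (a || b)%:R)
  else (if a && b then t - 1 else (~~ (a || b))%:R).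

Definition ramanujan_mulcoef A B U : R :=
  \prod_(p : I) ramanujan_mulcoef_prime (p \in A) (p \in B) (p \in U) p%:R.

Definition selberg_coef U : R :=
  G^-1 ^+ 2 * \sum_(A in D) \sum_(B in D) (-1) ^+ #|A| / modulus_phi A *
    ((-1) ^+ #|B| / modulus_phi B) * ramanujan_mulcoef A B U.

Lemma ramanujan_mul n A B :
  ramanujan n A * ramanujan n B = \sum_U ramanujan_mulcoef A B U * ramanujan n U.
Proof.
rewrite /ramanujan (big_mkcond (mem A)) (big_mkcond (mem B)) -big_split /=.
pose coef u p := ramanujan_mulcoef_prime (p \in A) (p \in B) u p%:R.
rewrite (eq_bigr (fun p => coef true p * ramanujan_prime n p + coef false p)); last first.
  move=> p _; rewrite /coef /ramanujan_mulcoef_prime /ramanujan_prime.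
  case: (p \in A); case: (p \in B) => /=; try ring.
  by case: (_ %| _)%N => /=; ring.
rewrite bigA_distr; apply: eq_big => // U _.
rewrite /ramanujan_mulcoef [X in _ * X]big_mkcond -big_split /=; apply: eq_bigr => p _.
by rewrite /coef; case: (p \in U); rewrite ?mulr1.
Qed.

Lemma selberg_sqr n : selberg n ^+ 2 = \sum_U selberg_coef U * ramanujan n U.
Proof.
rewrite /selberg exprMn /selberg_coef.
under [RHS]eq_bigr do rewrite -mulrA mulr_suml.
rewrite -mulr_sumr; congr (_ * _).
rewrite expr2 mulr_suml exchange_big /=; apply: eq_bigr => A _.
under [RHS]eq_bigr do rewrite mulr_suml.
rewrite mulr_sumr exchange_big /=; apply: eq_bigr => B _.
rewrite mulrACA ramanujan_mul mulr_sumr; apply: eq_bigr => U _.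
by rewrite [LHS]mulrA.
Qed.

Lemma modulus_phi_gt0 A : A \subset PP -> 0 < modulus_phi A.
Proof. by move=> AP; apply: prodr_gt0 => p /(sieve_prime_ge2 R AP); lra. Qed.

Lemma modulus_phiV_ge0 A : A \subset PP -> 0 <= (modulus_phi A)^-1.
Proof. by move=> AP; rewrite invr_ge0 ltW ?modulus_phi_gt0. Qed.

Lemma modulus_le_phi A : A \subset PP -> (modulus A)%:R <= 2 ^+ #|A| * modulus_phi A.
Proof.
move=> AP; rewrite /modulus_phi /modulus natr_prod -prodr_const -big_split /=.
apply: ler_prod => p pA; rewrite ler0n /=; have := sieve_prime_ge2 R AP pA; lra.
Qed.

Lemma ramanujan_mulcoef_neq0 A B U : ramanujan_mulcoef A B U != 0 ->
  (U \subset A :|: B) && (A :\: U == B :\: U).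
Proof.
move=> /prodf_neq0 m0; apply/andP; split.
  apply/subsetP => p pU; move: (m0 p isT); rewrite /ramanujan_mulcoef_prime pU inE.
  by case: (p \in A) (p \in B) => [] []; rewrite ?eqxx.
apply/eqP/setP => p; move: (m0 p isT); rewrite /ramanujan_mulcoef_prime !inE.
by case: (p \in U) (p \in A) (p \in B) => [] [] [] //=; rewrite eqxx.
Qed.

Lemma selberg_coef_supp U : selberg_coef U != 0 -> U \in moduli z y (z ^ 2).
Proof.
apply: contraNT => UD; rewrite /selberg_coef big1 ?mulr0 // => A AD.
rewrite big1 // => B BD; apply/eqP; rewrite mulf_eq0; apply/orP; right.
apply: contraNT UD => /ramanujan_mulcoef_neq0/andP[UAB _].
by rewrite -mulnn; apply: moduli_subset UAB; exact: moduliU.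
Qed.

Lemma ramanujan_mulcoef_prime_bound (a b u : bool) (t : R) :
  ([|| a, b | u] -> 2 <= t) -> a && ~~ u = b && ~~ u ->
  0 <= ramanujan_mulcoef_prime a b u t *
     ((if a then (t - 1)^-1 else 1) * (if b then (t - 1)^-1 else 1))
   <= (if u then (t - 1)^-1 else 1) * (if a && ~~ u then (t - 1)^-1 else 1).
Proof.
have [_ /(_ isT) t2|] := boolP [|| a, b | u]; last first.
  by case: a b u => [] [] [] // _ _ _; rewrite /ramanujan_mulcoef_prime /= !mulr1 lexx ler01.
have i0 : 0 < (t - 1)^-1 by rewrite invr_gt0; lra.
have i1 : (t - 1) * (t - 1)^-1 = 1 by rewrite divff //; lra.
rewrite /ramanujan_mulcoef_prime.
case: a b u => [] [] [] //= _; rewrite ?mul0r ?mul1r ?mulr1 ?lexx ?ler01 ?(ltW i0) //.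
  apply/andP; split; first by rewrite !mulr_ge0 ?(ltW i0) //; lra.
  by rewrite mulrA ger_pMl //; nra.
by rewrite mulrA i1 mul1r ltW //= lexx.
Qed.

Lemma ramanujan_mulcoef_bound A B U : A \subset PP -> B \subset PP -> U \subset PP ->
  0 <= ramanujan_mulcoef A B U / (modulus_phi A * modulus_phi B)
    <= (A :\: U == B :\: U)%:R * ((modulus_phi U)^-1 * (modulus_phi (A :\: U))^-1).
Proof.
move=> AP BP UP; have ADP : A :\: U \subset PP := subset_trans (subsetDl A U) AP.
have [->|/ramanujan_mulcoef_neq0/andP[_ e]] := eqVneq (ramanujan_mulcoef A B U) 0.
  by rewrite mul0r lexx mulr_ge0 // mulr_ge0 ?modulus_phiV_ge0.
have phiE C : (modulus_phi C)^-1 = \prod_(p : I) (if p \in C then (p%:R - 1)^-1 else 1).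
  by rewrite /modulus_phi -prodfV big_mkcond.
rewrite e mul1r invfM !phiE -!big_split /=.
have local_bound p : 0 <= ramanujan_mulcoef_prime (p \in A) (p \in B) (p \in U) p%:R *
     ((if p \in A then (p%:R - 1)^-1 else 1) * (if p \in B then (p%:R - 1)^-1 else 1))
   <= (if p \in U then (p%:R - 1)^-1 else 1) * (if p \in A :\: U then (p%:R - 1)^-1 else 1 : R).
  have/eqP/setP/(_ p) := e; rewrite !inE ![~~ _ && _]andbC; apply: ramanujan_mulcoef_prime_bound.
  by case/or3P; [exact: sieve_prime_ge2 AP|exact: sieve_prime_ge2 BP|exact: sieve_prime_ge2 UP].
apply/andP; split; first by apply: prodr_ge0 => p _; case/andP: (local_bound p).
by apply: ler_prod => p _; apply: local_bound.
Qed.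

Hypothesis z0 : (0 < z)%N.

Lemma sieve_mass_gt0 : 0 < G.
Proof.
rewrite /G (bigD1 set0) /=; last exact: moduli0.
apply: ltr_wpDr; last by rewrite invr_gt0 modulus_phi_gt0 ?sub0set.
by apply: sumr_ge0 => A /andP[/moduli_sub AP _]; exact: modulus_phiV_ge0.
Qed.

Lemma sum_mulcoef_bound_le U : U \subset PP ->
  \sum_(A in D) \sum_(B in D)
     (A :\: U == B :\: U)%:R * ((modulus_phi U)^-1 * (modulus_phi (A :\: U))^-1)
   <= (modulus_phi U)^-1 * (2 ^+ #|U| * (2 ^+ #|U| * G)).
Proof.
move=> UP.
apply: (@le_trans _ _
    (\sum_(A in D) (modulus_phi U)^-1 * (2 ^+ #|U| * (modulus_phi (A :\: U))^-1))).
  apply: ler_sum => A AD; have ADP := moduli_sub (moduliD U AD).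
  rewrite -mulr_suml mulrCA ler_wpM2l ?modulus_phiV_ge0 // ler_wpM2r ?modulus_phiV_ge0 //.
  rewrite -natr_sum -natrX ler_nat; apply: leq_trans (card_setD_fiber U (A :\: U)).
  rewrite -big_mkcondr /= sum1_card; apply: subset_leq_card.
  by apply/subsetP => B; rewrite !inE => /andP[_ /eqP->].
rewrite -mulr_sumr ler_wpM2l ?modulus_phiV_ge0 // -mulr_sumr ler_wpM2l ?exprn_ge0 //.
apply: (sum_setD_le (h := fun A => (modulus_phi A)^-1)) => A AD; first exact: moduliD.
exact: modulus_phiV_ge0 (moduli_sub AD).
Qed.

Lemma selberg_coef_le_phi U : U \subset PP ->
  `|selberg_coef U| <= 4 ^+ #|U| / (modulus_phi U * G).
Proof.
move=> UP; have G0 := sieve_mass_gt0; have pU0 := modulus_phi_gt0 UP.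
have -> : 4 ^+ #|U| / (modulus_phi U * G) =
    G^-1 ^+ 2 * ((modulus_phi U)^-1 * (2 ^+ #|U| * (2 ^+ #|U| * G))).
  rewrite [4](_ : _ = 2 * 2); last by ring.
  by rewrite exprMn expr2; field; rewrite !gt_eqF.
rewrite /selberg_coef normrM ger0_norm ?exprn_ge0 ?invr_ge0 ?(ltW G0) //.
rewrite ler_wpM2l ?exprn_ge0 ?invr_ge0 ?(ltW G0) //.
apply: le_trans (sum_mulcoef_bound_le UP).
apply: le_trans (ler_norm_sum _ _ _) _; apply: ler_sum => A AD.
apply: le_trans (ler_norm_sum _ _ _) _; apply: ler_sum => B BD.
have /andP[m0 mb] := ramanujan_mulcoef_bound (moduli_sub AD) (moduli_sub BD) UP.
apply: le_trans mb; rewrite -(ger0_norm m0).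
rewrite [ramanujan_mulcoef A B U / _]mulrC invfM.
by rewrite !normrM !normrX !normrN1 !expr1n !mul1r.
Qed.

Lemma selberg_coef_le U : U \subset PP ->
  `|selberg_coef U| <= 8 ^+ #|U| / ((modulus U)%:R * G).
Proof.
move=> UP; apply: le_trans (selberg_coef_le_phi UP) _.
have G0 := sieve_mass_gt0; have pU0 := modulus_phi_gt0 UP.
have q0 : 0 < (modulus U)%:R :> R by rewrite ltr0n (modulus_gt0 UP).
rewrite ler_pdivrMr ?mulr_gt0 // mulrAC ler_pdivlMr ?mulr_gt0 //.
rewrite [8](_ : _ = 4 * 2); last by ring.
rewrite exprMn -!mulrA ler_wpM2l ?exprn_ge0 // !mulrA ler_pM2r //.
exact: modulus_le_phi.
Qed.

Lemma selberg_rough n : (forall p, p \in PP -> ~~ (p %| n)%N) -> selberg n = 1.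
Proof.
move=> nP; rewrite /selberg (eq_bigr (fun A => (modulus_phi A)^-1)).
  by rewrite mulVf // gt_eqF // sieve_mass_gt0.
move=> A /moduli_sub/subsetP AP.
rewrite /ramanujan (eq_bigr (fun=> -1)) ?prodr_const.
  by rewrite mulrAC -exprMn mulrNN mulr1 expr1n mul1r.
by move=> p /AP/nP/negPf pn; rewrite /ramanujan_prime pn mulr0 sub0r.
Qed.

End Sieve.

Lemma eq_selberg (R : realFieldType) (z y n n' : nat) :
  (forall p, p \in sieve_primes z y -> (p %| n)%N = (p %| n')%N) ->
  selberg R z y n = selberg R z y n'.
Proof.
move=> eq_dvd; congr (_ * _); apply: eq_bigr => A /moduli_sub/subsetP AP.
by congr (_ * _); apply: eq_bigr => p /AP/eq_dvd pn; rewrite /ramanujan_prime pn.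
Qed.

(** * The mass of the sieve *)

Section InjectiveSums.
Variable R : numDomainType.

Lemma ler_sum_inj (I J : finType) (P : pred I) (Q : pred J) (h : I -> J)
    (F : I -> R) (H : J -> R) :
  {in P &, injective h} -> (forall i, P i -> Q (h i)) ->
  (forall i, P i -> F i <= H (h i)) -> (forall j, Q j -> 0 <= H j) ->
  \sum_(i | P i) F i <= \sum_(j | Q j) H j.
Proof.
move=> h_inj PQ FH H0; apply: (@le_trans _ _ (\sum_(i | P i) H (h i))).
  exact: ler_sum.
rewrite -(big_imset H h_inj) /= big_mkcond [leRHS]big_mkcond.
apply: ler_sum => j _; case: ifPn => [/imsetP[i Pi ->]|_].
  by rewrite PQ.
by case: ifP => // /H0.
Qed.

Lemma ler_sum_subset (I : finType) (A B : {set I}) (F : I -> R) :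
  A \subset B -> (forall i, 0 <= F i) -> \sum_(i in A) F i <= \sum_(i in B) F i.
Proof. by move=> AB F0; apply: (ler_sum_inj (h := id)) => //; exact: (subsetP AB). Qed.

End InjectiveSums.

Section RealPowers.
Variable R : realType.

Lemma ln_le_powR (e x : R) : 0 < e -> 0 < x -> ln x <= e^-1 * x `^ e.
Proof.
move=> e0 x0; rewrite ler_pdivlMl // -ln_powR ltW // ln_sublinear //.
exact: powR_gt0.
Qed.

Lemma powR_ge1 (x e : R) : 1 <= x -> 0 <= e -> 1 <= x `^ e.
Proof. by move=> x1 e0; rewrite -[leLHS](powRr0 x) ler_powR. Qed.

Lemma ler_powR_base (x y e : R) : 0 <= e -> 0 <= x -> x <= y -> x `^ e <= y `^ e.
Proof. by move=> e0 x0 xy; apply: ge0_ler_powR; rewrite ?nnegrE ?(le_trans x0 xy). Qed.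

Lemma powRK (x e : R) : 0 <= x -> e != 0 -> (x `^ e) `^ e^-1 = x.
Proof. by move=> x0 e0; rewrite -powRrM divff // powRr1. Qed.

Lemma powR_exprn (x e : R) (n : nat) : 0 <= x -> (x ^+ n) `^ e = (x `^ e) ^+ n.
Proof.
move=> x0; elim: n => [|n IH]; first by rewrite !expr0 powR1.
by rewrite !exprS powRM ?exprn_ge0 // IH.
Qed.

Lemma powR_prod (T : Type) (s : seq T) (P : pred T) (F : T -> R) (e : R) :
  (forall i, P i -> 0 <= F i) ->
  (\prod_(i <- s | P i) F i) `^ e = \prod_(i <- s | P i) F i `^ e.
Proof.
move=> F0; elim: s => [|i s IH]; first by rewrite !big_nil powR1.
rewrite !big_cons; case: ifP => // Pi.
by rewrite powRM ?IH ?F0 ?prodr_ge0 // => j; apply: F0.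
Qed.

End RealPowers.

Section Harmonic.
Variable R : realType.

Lemma ln_le_harmonic z : ln z.+1%:R <= series harmonic z :> R.
Proof.
elim: z => [|z IH]; first by rewrite ln1 /series /= big_nil.
rewrite /series /= big_nat_recr //=.
have -> : z.+2%:R = z.+1%:R * (1 + z.+1%:R^-1) :> R.
  by rewrite mulrDr mulr1 divff ?pnatr_eq0 // -natr1.
rewrite lnM ?posrE ?ltr0n ?addr_gt0 ?invr_gt0 ?ltr0n //.
by rewrite lerD // le_ln1Dx // (lt_trans (@ltrN10 R)) // invr_gt0.
Qed.

Lemma harmonic_le_ln z : series harmonic z.+1 <= 1 + ln z.+1%:R :> R.
Proof.
elim: z => [|z IH]; first by rewrite /series /= big_nat1 invr1 ln1 addr0.
rewrite /series /= big_nat_recr //=.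
have e : z.+1%:R = z.+2%:R * (1 - z.+2%:R^-1) :> R.
  by rewrite mulrBr mulr1 divff ?pnatr_eq0 // -[z.+2%:R]natr1 addrK.
have i1 : (z.+2%:R)^-1 < 1 :> R by rewrite invf_lt1 ?ltr0n // ltr1n.
have ln_step : ln (z.+1%:R : R) <= ln z.+2%:R - z.+2%:R^-1.
  rewrite e lnM ?posrE ?ltr0n ?subr_gt0 // lerD2l.
  by rewrite -[X in ln X]/(1 + - _) le_ln1Dx // ltrN2.
by apply: le_trans (lerD IH (lexx _)) _; rewrite -addrA lerD2l -lerBrDr.
Qed.

Lemma harmonic_le_powR (e : R) : 0 < e -> exists2 C : R, 0 < C &
  forall z, (0 < z)%N -> series harmonic z <= C * z%:R `^ e.
Proof.
move=> e0; exists (1 + e^-1); first by rewrite addr_gt0 // invr_gt0.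
case=> // z _; apply: le_trans (harmonic_le_ln z) _.
by rewrite mulrDl mul1r lerD ?ln_le_powR // powR_ge1 ?ler1n ?ltW.
Qed.

End Harmonic.

Section SmoothHarmonicSums.
Variable R : realFieldType.
Implicit Types (s : seq nat) (z d : nat).

Lemma sum_multiples_inv_le d z (P Q : pred nat) :
  (forall n : 'I_z, P n -> (d %| n)%N && Q (n %/ d)%N) ->
  \sum_(n < z | P n) (n%:R : R)^-1 <= d%:R^-1 * \sum_(n < z | Q n) n%:R^-1.
Proof.
move=> PQ; rewrite mulr_sumr.
have lt_div (n : 'I_z) : (n %/ d < z)%N := leq_ltn_trans (leq_div _ _) (ltn_ord n).
apply: (ler_sum_inj (h := fun n => Ordinal (lt_div n))).
- move=> n n' /PQ/andP[dn _] /PQ/andP[dn' _] /(congr1 val) /= e.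
  by apply/val_inj; rewrite /= -(divnK dn) e divnK.
- by move=> n /PQ/andP[].
- by move=> n /PQ/andP[dn _]; rewrite /= -invfM -natrM mulnC divnK.
by move=> n _; rewrite mulr_ge0 ?invr_ge0.
Qed.

Definition smooth_over s n : bool := (0 < n)%N && all (mem s) (primes n).

Definition smooth_harmonic s z : R := \sum_(n < z.+1 | smooth_over s n) n%:R^-1.

Lemma smooth_over_nil n : smooth_over [::] n = (n == 1%N).
Proof.
apply/andP/eqP => [[n0 sn]|-> //]; apply/eqP; rewrite eqn_leq n0 andbT leqNgt.
apply/negP => n1; move/allP: sn => /(_ (pdiv n)).
by rewrite mem_primes pdiv_prime // pdiv_dvd n0 => /(_ isT).
Qed.

Lemma smooth_harmonic_nil z : smooth_harmonic [::] z <= 1.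
Proof.
have -> : 1 = \sum_(j : unit) 1 :> R by rewrite sumr_const card_unit.
apply: (ler_sum_inj (h := fun=> tt)) => //.
  move=> n n'; rewrite !unfold_in !smooth_over_nil => /eqP n1 /eqP n1' _.
  by apply/val_inj; rewrite /= n1 n1'.
by move=> n; rewrite smooth_over_nil => /eqP ->; rewrite invr1.
Qed.

Lemma smooth_over_cons_ndvd p s n :
  smooth_over (p :: s) n -> ~~ (p %| n)%N -> smooth_over s n.
Proof.
move=> /andP[n0 /allP sn] pn; rewrite /smooth_over n0 /=; apply/allP => r rn.
have := sn r rn; rewrite inE => /orP[/eqP rp|//]; case/negP: pn.
by move: rn; rewrite mem_primes rp => /and3P[].
Qed.

Lemma smooth_over_divn d s n : (d %| n)%N -> smooth_over s n -> smooth_over s (n %/ d).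
Proof.
move=> dn /andP[n0 /allP sn]; rewrite /smooth_over divn_gt0 ?(dvdn_gt0 n0 dn) //.
rewrite dvdn_leq //=; apply/allP => r; rewrite mem_primes => /and3P[rp _ rn].
by apply: sn; rewrite mem_primes rp n0 -(divnK dn) dvdn_mulr.
Qed.

Lemma smooth_harmonic_cons p s z :
  smooth_harmonic (p :: s) z <= smooth_harmonic s z + smooth_harmonic (p :: s) z / p%:R.
Proof.
rewrite {1}/smooth_harmonic (bigID (fun n : 'I__ => p %| n)%N) /= addrC lerD //.
  rewrite /smooth_harmonic big_mkcond [leRHS]big_mkcond; apply: ler_sum => n _.
  case: ifP => [/andP[sn pn]|_]; first by rewrite (smooth_over_cons_ndvd sn pn).
  by case: ifP => // _; rewrite invr_ge0.
rewrite mulrC; apply: (sum_multiples_inv_le (P := fun n => smooth_over (p :: s) n && (p %| n)%N)).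
by move=> n /andP[sn pn]; rewrite pn smooth_over_divn.
Qed.

Lemma smooth_harmonic_le s z : all prime s ->
  smooth_harmonic s z <= \prod_(p <- s) (p%:R / (p%:R - 1)).
Proof.
elim: s => [_|p s IH /= /andP[pp sp]]; first by rewrite big_nil smooth_harmonic_nil.
have p1 : 1 < p%:R :> R by rewrite ltr1n prime_gt1.
rewrite big_cons; move: (IH sp) (smooth_harmonic_cons p s z).
move: (smooth_harmonic (p :: s) z) (\prod_(_ <- s) _) => S P leP leS.
rewrite -subr_ge0 [leRHS](_ : _ = p%:R / (p%:R - 1) * (P - S + S / p%:R)).
  by rewrite mulr_ge0 ?divr_ge0 ?subr_ge0 ?(ltW p1) //; lra.
by field; apply/andP; split; lra.
Qed.

Lemma prod_primes_totient y : (0 < y)%N ->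
  \prod_(p <- primes y) (p%:R / (p%:R - 1)) = y%:R / (totient y)%:R :> R.
Proof.
move=> y0; rewrite totientE // {2}(prod_prime_decomp y0) prime_decompE big_map.
rewrite !natr_prod -prodf_div; apply: eq_big_seq => p.
rewrite mem_primes => /and3P[pp _ py].
have l0 : (0 < logn p y)%N by rewrite logn_gt0 mem_primes pp y0.
have p1 : 1 < p%:R :> R by rewrite ltr1n prime_gt1.
rewrite /= -{1}(prednK l0) expnS !natrM -[p.-1]subn1 natrB ?prime_gt0 //.
rewrite natrX invfM mulrACA divff ?mulr1 // expf_neq0 //; lra.
Qed.

End SmoothHarmonicSums.

Section SieveMass.
Variables (R : realType) (z y : nat).
Local Notation I := 'I_z.+1.
Implicit Types A B U : {set I}.

Lemma sum_moduli_le Q (H : nat -> R) : (forall n, 0 <= H n) ->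
  \sum_(A in moduli z y Q) H (modulus A) <= \sum_(1 <= n < Q.+1) H n.
Proof.
move=> H0; rewrite big_geq_mkord.
apply: (ler_sum_inj (h := fun A => inord (modulus A) : 'I_Q.+1)).
- move=> A B /moduliP[AP AQ] /moduliP[BP BQ] /(congr1 val).
  by rewrite /= !inordK //; exact: (modulus_inj AP BP).
- by move=> A /moduliP[AP AQ]; rewrite inordK // (modulus_gt0 AP).
- by move=> A /moduliP[AP AQ]; rewrite inordK.
by move=> n _.
Qed.

Lemma sum_moduliV_le Q :
  \sum_(A in moduli z y Q) ((modulus A)%:R : R)^-1 <= series harmonic Q.
Proof.
apply: le_trans (@sum_moduli_le Q (fun n => n%:R^-1) _) _ => [n|]; first by rewrite invr_ge0.
by rewrite /series /= big_add1.
Qed.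

Definition dvd_part U (n : nat) : {set I} := [set p in U | (p %| n)%N].
Local Notation sieve_part := (dvd_part (sieve_primes z y)).

Lemma dvd_part_sub U n : dvd_part U n \subset U.
Proof. by apply/subsetP => p; rewrite inE => /andP[]. Qed.

Lemma modulus_dvd_part U n : U \subset sieve_primes z y -> (modulus (dvd_part U n) %| n)%N.
Proof.
move=> UP; apply/(modulus_dvdP n (subset_trans (dvd_part_sub U n) UP)) => p.
by rewrite inE => /andP[].
Qed.

Lemma sieve_part_moduli n : (0 < n <= z)%N -> sieve_part n \in moduli z y z.
Proof.
move=> /andP[n0 nz]; apply/moduliP; split; first exact: dvd_part_sub.
by apply: leq_trans nz; rewrite dvdn_leq // modulus_dvd_part.
Qed.

Lemma smooth_over_sieve_part n : (0 < y)%N -> (0 < n <= z)%N ->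
  smooth_over ([seq val p | p <- enum (sieve_part n)] ++ primes y) n.
Proof.
move=> y0 /andP[n0 nz]; rewrite /smooth_over n0; apply/allP => r.
rewrite mem_primes => /and3P[rp _ rn].
rewrite /= mem_cat mem_primes rp y0 /=; case: (boolP (r %| y)%N) => [_|ry].
  by rewrite orbT.
rewrite orbF; apply/mapP.
have rz : (r < z.+1)%N by rewrite ltnS (leq_trans (dvdn_leq n0 rn)).
by exists (Ordinal rz); rewrite // mem_enum !inE /= rp ry rn.
Qed.

(* Every n <= z is a product of its sieving primes, taken once, and of a number
   composed of these primes and of the primes dividing y. *)
Lemma ln_le_sieve_mass : (0 < y)%N ->
  ln z.+1%:R <= y%:R / (totient y)%:R * sieve_mass R z y.
Proof.
move=> y0; apply: le_trans (ln_le_harmonic R z) _.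
have -> : series harmonic z = \sum_(n < z.+1 | (0 < n)%N) n%:R^-1 :> R.
  by rewrite /series /= -(big_add1 _ _ 0 z.+1 xpredT (fun n => n%:R^-1)) big_geq_mkord.
rewrite (partition_big (fun n : I => sieve_part n) (mem (moduli z y z))) /=; last first.
  by move=> n n0; rewrite sieve_part_moduli // n0 -ltnS ltn_ord.
rewrite mulr_sumr; apply: ler_sum => A /moduli_sub AP.
pose s := [seq val p | p <- enum A] ++ primes y.
have sp : all prime s.
  by rewrite all_cat (enum_sieve_prime AP) /=; apply/allP => p; rewrite mem_primes => /and3P[].
apply: (@le_trans _ _ ((modulus A)%:R^-1 * smooth_harmonic R s z)).
  apply: (@sum_multiples_inv_le _ _ _ (fun n => (0 < n)%N && (sieve_part n == A))).
  move=> n /andP[n0 /eqP nA].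
  have n0z : (0 < n <= z)%N by rewrite n0 -ltnS ltn_ord.
  by rewrite /s -nA smooth_over_divn ?smooth_over_sieve_part ?modulus_dvd_part.
apply: le_trans (ler_wpM2l _ (smooth_harmonic_le R z sp)) _; first by rewrite invr_ge0.
rewrite /s big_cat /= prod_primes_totient // big_map big_enum /= mulrA mulrC ler_wpM2l //.
rewrite /modulus_phi /modulus natr_prod -!prodfV -big_split /=.
rewrite (eq_bigr (fun p : I => (p%:R - 1)^-1)) // => p pA.
by have := sieve_prime_ge2 R AP pA => p2; field; apply/andP; split; lra.
Qed.

End SieveMass.

(** * Moduli at most Q *)

Section PrimeSetBounds.
Variable R : realType.

(* Only the boundedly many primes p with p ^ e < c can contribute a factor
   c > p ^ e. *)
Lemma exprn_card_le_modulus (c e : R) : 1 <= c -> 0 < e -> exists2 C : R, 0 < C &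
  forall z y (A : {set 'I_z.+1}), A \subset sieve_primes z y ->
    c ^+ #|A| <= C * (modulus A)%:R `^ e.
Proof.
move=> c1 e0; have c0 : 0 < c by apply: lt_le_trans c1.
pose p0 := (Num.truncn (c `^ e^-1)).+1.
have large_prime p : (p0 <= p)%N -> c <= p%:R `^ e.
  move=> pp; have cp : c `^ e^-1 <= p%:R.
    by apply: le_trans (ltW (truncnS_gt _)) _; rewrite ler_nat.
  rewrite -[leLHS](@powRK _ _ e^-1) ?invr_eq0 ?(ltW c0) ?gt_eqF // invrK.
  by rewrite ler_powR_base ?powR_ge0 ?(ltW e0).
exists (c ^+ p0) => [|z y A AP]; first by rewrite exprn_gt0.
rewrite /modulus natr_prod powR_prod // -prodr_const.
apply: (@le_trans _ _ (\prod_(p in A) ((if (p < p0)%N then c else 1) * p%:R `^ e))).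
  apply: ler_prod => p pA; rewrite ltW //=.
  have p1 : 1 <= p%:R `^ e.
    by rewrite powR_ge1 ?(ltW e0) // ler1n prime_gt0 // (in_sieve_prime AP pA).
  case: ifPn => [_|]; first by rewrite ler_peMr // ltW.
  by rewrite -leqNgt mul1r => /large_prime.
rewrite big_split /= ler_wpM2r //; first by apply: prodr_ge0 => p _; exact: powR_ge0.
rewrite -big_mkcondr /= prodr_const; apply: ler_weXn2l => //.
rewrite -[leqRHS]card_ord; pose h (p : 'I_z.+1) : 'I_p0 := inord p.
rewrite -(@card_in_imset _ _ h) ?max_card //.
move=> p q /andP[_ pp] /andP[_ qp] /(congr1 val) /=.
by rewrite !inordK // => /val_inj.
Qed.

End PrimeSetBounds.

Section Multiples.
Variables (R : realFieldType) (z y : nat).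
Local Notation PP := (sieve_primes z y).
Local Notation I := 'I_z.+1.
Implicit Types A B U : {set I}.

Lemma sum_prod_modulus (S : comPzSemiRingType) A (F : nat -> nat -> S) : A \subset PP ->
  {in A, forall p : I, nat_periodic (F p) p} ->
  \sum_(x < modulus A) \prod_(p in A) F p x = \prod_(p in A) \sum_(x < p) F p x.
Proof.
move=> AP Fper.
have prodE (H : nat -> S) : \prod_(p in A) H p = \prod_(p <- [seq val p | p <- enum A]) H p.
  by rewrite [RHS]big_map big_enum.
rewrite -(big_mkord xpredT (fun x => \prod_(p in A) F p x)) modulusE big_mkord.
rewrite (eq_bigr _ (fun (x : 'I__) _ => prodE (F^~ x))).
rewrite sum_prod_crt ?enum_val_uniq ?(enum_sieve_prime AP) // ?big_map ?big_enum //.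
by move=> _ /mapP[p + ->]; rewrite mem_enum; exact: Fper.
Qed.

Lemma sum_dvdn_affine (p : I) b : p \in PP -> \sum_(t < p) (p %| b + y * t)%N%:R = 1 :> R.
Proof.
move=> pP; have p0 : (0 < p)%N by move: pP; rewrite inE => /andP[/prime_gt0].
under eq_bigr do rewrite addnC mulnC.
rewrite (@sum_affine _ (fun x => (p %| x)%N%:R)) ?(sieve_coprime pP) //; last first.
  by move=> x; rewrite dvdn_addl.
rewrite (bigD1 (Ordinal p0)) //= dvdn0 big1 ?addr0 // => i i0.
rewrite gtnNdvd // lt0n; apply: contraNneq i0 => i0.
by apply/eqP/val_inj.
Qed.

Lemma dvdn_modulusE A n : A \subset PP ->
  (modulus A %| n)%N%:R = \prod_(p in A) (p %| n)%N%:R :> R.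
Proof.
move=> AP; have [dAn|ndAn] := boolP (modulus A %| n)%N.
  by rewrite big1 // => p pA; rewrite (dvdn_trans (dvdn_modulus pA) dAn).
apply/esym/eqP; apply: contraNT ndAn => /prodf_neq0 nz.
by apply/(modulus_dvdP n AP) => p /nz; rewrite pnatr_eq0 eqb0 negbK.
Qed.

Lemma dvdn_modulusU A B n : A \subset PP -> B \subset PP ->
  (modulus (A :|: B) %| n)%N = (modulus A %| n)%N && (modulus B %| n)%N.
Proof.
move=> AP BP; have ABP : A :|: B \subset PP by rewrite subUset AP.
apply/(modulus_dvdP n ABP)/andP => [dn|[/(modulus_dvdP n AP) dA /(modulus_dvdP n BP) dB] p].
  by split; [apply/(modulus_dvdP n AP)|apply/(modulus_dvdP n BP)] => p pA;
    apply: dn; rewrite inE pA ?orbT.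
by rewrite inE => /orP[/dA|/dB].
Qed.

Lemma count_multiples_progression_le A b (T : nat) : A \subset PP ->
  \sum_(t < T) (modulus A %| b + y * t)%N%:R <= T%:R / (modulus A)%:R + 1 :> R.
Proof.
move=> AP; have q0 := modulus_gt0 AP.
have full : \sum_(t < modulus A) (modulus A %| b + y * t)%N%:R = 1 :> R.
  under eq_bigr do rewrite dvdn_modulusE //.
  rewrite (@sum_prod_modulus _ _ (fun p t => (p %| b + y * t)%N%:R)) //.
    by rewrite big1 // => p pA; rewrite sum_dvdn_affine // (subsetP AP).
  by move=> p _ x; rewrite (dvdn_affine_periodic p b y x).
have := @sum_periodic_le R (fun t => (modulus A %| b + y * t)%N%:R) _ T q0.
rewrite /= full mulr1; apply=> // x.
by rewrite (dvdn_affine_periodic (modulus A) b y x).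
Qed.

Lemma norm_ramanujan_le n U : U \subset PP ->
  `|ramanujan R n U| <= (modulus (dvd_part U n))%:R.
Proof.
move=> UP; rewrite /ramanujan normr_prod /modulus natr_prod big_mkcond [leRHS]big_mkcond /=.
apply: ler_prod => p _; rewrite inE /ramanujan_prime.
case: ifP => /= pU; last by rewrite ler01 lexx.
have := sieve_prime_ge2 R UP pU; case: (p %| n)%N => /= p2; rewrite normr_ge0 /=.
  by rewrite mulr1 ger0_norm; lra.
by rewrite mulr0 sub0r normrN1.
Qed.

Definition truncated_tau (Q n : nat) : R :=
  \sum_(A in moduli z y Q) (modulus A %| n)%N%:R.

Lemma truncated_tau_ge0 Q n : 0 <= truncated_tau Q n.
Proof. by apply: sumr_ge0. Qed.

End Multiples.

Section TruncatedTauMoments.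
Variable R : realType.

Section WeightedMoment.
Variables (z y : nat).
Implicit Types A B : {set 'I_z.+1}.

Lemma sum_modulusDV_le (Q : nat) B :
  \sum_(A in moduli z y Q) (modulus (A :\: B))%:R^-1 <= 2 ^+ #|B| * series harmonic Q :> R.
Proof.
apply: le_trans (sum_setD_le (h := fun A => ((modulus A)%:R : R)^-1) _ _) _.
- by move=> A; exact: moduliD.
- by move=> A _; rewrite invr_ge0.
by rewrite ler_wpM2l ?exprn_ge0 ?sum_moduliV_le.
Qed.

Lemma weighted_tau_moment_le (k Q T b : nat) (K : R) : (0 < Q)%N -> (Q ^ k <= T)%N ->
  (forall A, A \in moduli z y (Q ^ k) -> 2 ^+ #|A| <= K) ->
  forall j B, (j <= k)%N -> B \in moduli z y (Q ^ (k - j)) ->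
  \sum_(t < T) (modulus B %| b + y * t)%N%:R * truncated_tau R z y Q (b + y * t) ^+ j
    <= 2 * T%:R / (modulus B)%:R * (K * series harmonic Q) ^+ j.
Proof.
move=> Q0 QT card_le; elim=> [|j IH] B jk BQ; have BP := moduli_sub BQ.
  under eq_bigr do rewrite expr0 mulr1.
  rewrite expr0 mulr1; apply: le_trans (count_multiples_progression_le R b T BP) _.
  have q0 : 0 < (modulus B)%:R :> R by rewrite ltr0n (modulus_gt0 BP).
  have : 1 <= T%:R / (modulus B)%:R :> R.
    rewrite ler_pdivlMr // mul1r ler_nat; move: BQ; rewrite subn0 => /moduliP[_ qB].
    exact: leq_trans qB QT.
  by rewrite -mulrA; lra.
have harmonic0 : 0 <= series harmonic Q :> R by apply: sumr_ge0 => n _; exact: harmonic_ge0.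
have K0 : 0 <= K.
  by apply: le_trans (card_le _ (moduli0 _ _ (_ : 0 < Q ^ k)%N)); rewrite ?expn_gt0 ?Q0.
have BQk : B \in moduli z y (Q ^ k) by apply: moduli_leq BQ; rewrite leq_pexp2l // leq_subr.
under eq_bigr do rewrite exprS {1}/truncated_tau mulr_suml mulr_sumr.
rewrite exchange_big /=.
apply: (@le_trans _ _ (\sum_(A in moduli z y Q)
    2 * T%:R / (modulus B)%:R * (K * series harmonic Q) ^+ j * (modulus (A :\: B))%:R^-1)).
  apply: ler_sum => A AQ; have AP := moduli_sub AQ.
  under eq_bigr do rewrite mulrA -natrM mulnb -(dvdn_modulusU _ BP AP).
  apply: le_trans (IH _ (ltnW jk) _) _.
    by rewrite -(subnSK jk) expnSr moduliU.
  by rewrite modulusUD natrM invfM mulrA mulrAC.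
rewrite -mulr_sumr exprSr [leRHS]mulrA ler_wpM2l //.
  by rewrite mulr_ge0 ?exprn_ge0 ?mulr_ge0 ?invr_ge0.
by apply: le_trans (sum_modulusDV_le Q B) _; rewrite ler_wpM2r ?card_le.
Qed.

End WeightedMoment.

Lemma truncated_tau_moment_le (k : nat) (e : R) : 0 < e -> exists2 C : R, 0 < C &
  forall z y b Q T : nat, (0 < Q)%N -> (Q ^ k <= T)%N ->
  \sum_(t < T) truncated_tau R z y Q (b + y * t) ^+ k <= C * T%:R * Q%:R `^ e.
Proof.
move=> e0; pose d := e / k.+1%:R ^+ 2.
have d0 : 0 < d by rewrite divr_gt0 // exprn_gt0 ?ltr0n.
have [C2 C20 card_le] := @exprn_card_le_modulus R 2 d (ler1n _ 2) d0.
have [Ch Ch0 harmonic_le] := @harmonic_le_powR R d d0.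
exists (2 * (C2 * Ch) ^+ k); first by rewrite mulr_gt0 // exprn_gt0 // mulr_gt0.
move=> z y b Q T Q0 QT.
have Q1 : 1 <= Q%:R :> R by rewrite ler1n.
have Qn0 : (Q%:R : R) != 0 by rewrite pnatr_eq0 -lt0n.
pose K := C2 * (Q%:R ^+ k) `^ d.
have card_leK (A : {set 'I_z.+1}) : A \in moduli z y (Q ^ k) -> 2 ^+ #|A| <= K.
  move=> /moduliP[AP Ak]; apply: le_trans (card_le _ _ _ AP) _.
  by rewrite ler_wpM2l ?(ltW C20) // ler_powR_base ?(ltW d0) // -natrX ler_nat.
have := weighted_tau_moment_le b Q0 QT card_leK (leqnn k) (moduli0 z y (_ : 0 < Q ^ (k - k))%N).
rewrite subnn modulus0 => /(_ isT).
under eq_bigr do rewrite dvd1n mul1r.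
move=> /le_trans -> //; rewrite invr1 mulr1 [2 * _ * T%:R]mulrAC -[leRHS]mulrA.
have harmonic0 : 0 <= series harmonic Q :> R by apply: sumr_ge0 => n _; exact: harmonic_ge0.
rewrite ler_wpM2l ?mulr_ge0 //.
have KH_le : K * series harmonic Q <= C2 * Ch * Q%:R `^ (k.+1%:R * d).
  apply: le_trans (ler_wpM2l _ (harmonic_le Q Q0)) _.
    by rewrite mulr_ge0 ?powR_ge0 ?(ltW C20).
  by rewrite /K -powR_mulrn // -powRrM -natr1 mulrDl mul1r powRD ?Qn0 ?implybT // mulrACA.
apply: (@le_trans _ _ ((C2 * Ch * (Q%:R `^ (k.+1%:R * d))) ^+ k)).
  by rewrite lerXn2r ?nnegrE ?mulr_ge0 ?powR_ge0 ?(ltW C20) ?(ltW Ch0).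
rewrite exprMn ler_wpM2l ?exprn_ge0 ?mulr_ge0 ?(ltW C20) ?(ltW Ch0) //.
rewrite -powR_mulrn ?powR_ge0 // -powRrM ler_powR // /d.
rewrite [leLHS](_ : _ = e * (k%:R / k.+1%:R)); last by field; rewrite ?nat1r ?natr1 pnatr_eq0.
by rewrite ger_pMr // ler_pdivrMr ?ltr0n // mul1r ler_nat.
Qed.

End TruncatedTauMoments.

Section SmallModuli.
Variable R : realType.

Lemma sum_codvd_partV_le z y Q n :
  \sum_(U in moduli z y Q) (modulus (U :\: dvd_part U n))%:R^-1
    <= series harmonic Q * truncated_tau R z y Q n.
Proof.
apply: (@le_trans _ _ ((\sum_(B in moduli z y Q) (modulus B)%:R^-1) * truncated_tau R z y Q n)).
  rewrite /truncated_tau big_distrlr /= pair_big_dep /=.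
  apply: (ler_sum_inj (h := fun U => (U :\: dvd_part U n, dvd_part U n))).
  - move=> U V _ _ [eD eI]; rewrite -(setID U (dvd_part U n)) -(setID V (dvd_part V n)) eD.
    by have /setIidPr -> := dvd_part_sub U n; have /setIidPr -> := dvd_part_sub V n; rewrite eI.
  - by move=> U UQ /=; rewrite moduliD // (moduli_subset UQ) ?dvd_part_sub.
  - by move=> U /moduli_sub UP /=; rewrite (modulus_dvd_part n UP) mulr1.
  by move=> [A B] _; rewrite mulr_ge0 ?invr_ge0.
by rewrite ler_wpM2r ?truncated_tau_ge0 ?sum_moduliV_le.
Qed.

Lemma small_moduli_le (e : R) : 0 < e -> exists2 C : R, 0 < C &
  forall z y n Q : nat, (0 < z)%N -> (0 < Q)%N ->
  \sum_(U in moduli z y Q) `|selberg_coef R y U| * `|ramanujan R n U|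
    <= C / sieve_mass R z y * Q%:R `^ e * truncated_tau R z y Q n.
Proof.
move=> e0; have e20 : 0 < e / 2 by rewrite divr_gt0.
have [C8 C80 card_le] := @exprn_card_le_modulus R 8 (e / 2) (ler1n _ 8) e20.
have [Ch Ch0 harmonic_le] := @harmonic_le_powR R (e / 2) e20.
exists (C8 * Ch) => [|z y n Q z0 Q0]; first by rewrite mulr_gt0.
set G := sieve_mass R z y; have G0 : 0 < G by apply: sieve_mass_gt0.
have c0 : 0 <= C8 / G * Q%:R `^ (e / 2) by rewrite mulr_ge0 ?divr_ge0 ?powR_ge0 ?ltW.
apply: (@le_trans _ _ (\sum_(U in moduli z y Q)
    C8 / G * Q%:R `^ (e / 2) * (modulus (U :\: dvd_part U n))%:R^-1)).
  apply: ler_sum => U /moduliP[UP UQ].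
  have coef_le : `|selberg_coef R y U| <= C8 / G * Q%:R `^ (e / 2) * (modulus U)%:R^-1.
    apply: le_trans (selberg_coef_le R z0 UP) _.
    rewrite invfM [_^-1 * G^-1]mulrC mulrA ler_wpM2r ?invr_ge0 //.
    rewrite mulrAC ler_wpM2r ?invr_ge0 ?(ltW G0) //.
    apply: le_trans (card_le _ _ _ UP) _; rewrite ler_wpM2l ?(ltW C80) //.
    by rewrite ler_powR_base ?(ltW e20) // ler_nat.
  apply: le_trans (ler_pM _ _ coef_le (norm_ramanujan_le R n UP)) _ => //.
  rewrite -[leLHS]mulrA ler_wpM2l // (modulusDK (dvd_part_sub U n)) natrM invfM mulrAC.
  rewrite mulVf ?mul1r // pnatr_eq0 -lt0n (modulus_gt0 (subset_trans (dvd_part_sub U n) UP)) //.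
rewrite -mulr_sumr.
have -> : C8 * Ch / G * Q%:R `^ e * truncated_tau R z y Q n =
    C8 / G * Q%:R `^ (e / 2) * (Ch * Q%:R `^ (e / 2) * truncated_tau R z y Q n).
  rewrite {1}(splitr e) powRD; last by rewrite pnatr_eq0 -lt0n Q0 implybT.
  by ring.
rewrite ler_wpM2l //; apply: le_trans (sum_codvd_partV_le z y Q n) _.
by rewrite ler_wpM2r ?truncated_tau_ge0 ?harmonic_le.
Qed.

End SmallModuli.

(** * Moduli larger than Q *)

Section BilinearForms.
Variable R : realFieldType.

Lemma sqr_sum_le (T : finType) (A : {set T}) (F : T -> R) :
  (\sum_(i in A) F i) ^+ 2 <= #|A|%:R * \sum_(i in A) F i ^+ 2.
Proof.
rewrite expr2 mulr_suml.
apply: (@le_trans _ _ (\sum_(i in A) \sum_(j in A) (F i ^+ 2 + F j ^+ 2) / 2)).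
  apply: ler_sum => i _; rewrite mulr_sumr; apply: ler_sum => j _.
  by have := sqr_ge0 (F i - F j); rewrite sqrrB; lra.
under eq_bigr do rewrite -mulr_suml big_split /= sumr_const.
rewrite -mulr_suml big_split /= sumr_const sumrMnl -mulr_natl; lra.
Qed.

(* The rows of e^T e bound the operator norm of e on l^2. *)
Lemma sqr_bilinear_sum_le (I J : finType) (e : I -> J -> R) (B : R)
    (X : {set I}) (Y : {set J}) :
  (forall a, \sum_a' `|\sum_u e u a * e u a'| <= B) ->
  (\sum_(u in X) \sum_(a in Y) e u a) ^+ 2 <= #|X|%:R * #|Y|%:R * B.
Proof.
move=> row_le; apply: le_trans (sqr_sum_le _ _) _; rewrite -mulrA ler_wpM2l //.
apply: (@le_trans _ _ (\sum_u (\sum_(a in Y) e u a) ^+ 2)).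
  by rewrite big_mkcond; apply: ler_sum => u _; case: ifP => // _; exact: sqr_ge0.
rewrite (eq_bigr (fun u => \sum_(a in Y) \sum_(a' in Y) e u a * e u a')); last first.
  by move=> u _; rewrite expr2 mulr_suml; apply: eq_bigr => a _; rewrite mulr_sumr.
rewrite exchange_big mulr_natl -sumr_const; apply: ler_sum => a _.
rewrite exchange_big; apply: le_trans (row_le a).
rewrite big_mkcond; apply: ler_sum => a' _.
by case: ifP => // _; apply: ler_norm.
Qed.

End BilinearForms.

Section Correlations.
Variables (R : realFieldType) (z y : nat).
Local Notation PP := (sieve_primes z y).
Local Notation I := 'I_z.+1.
Implicit Types (U V D : {set I}) (p : I) (a b u : nat).

(* The Ramanujan sum c_q(a - a') for q = modulus U. *)
Definition ramanujan_diff a a' U : R :=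
  \prod_(p in U) (p%:R * (a == a' %[mod p])%N%:R - 1).

Lemma dvdn_affine_pair p n a a' : p \in PP ->
  (p %| n + y * a)%N -> (p %| n + y * a')%N = (a == a' %[mod p])%N.
Proof.
move=> pP pa; have cop := sieve_coprime pP.
wlog le_aa' : a a' pa / (a <= a')%N => [ordered|].
  case/orP: (leq_total a a') => le_aa'; first exact: ordered.
  apply/idP/idP => [pa'|e]; first by rewrite eq_sym -(ordered _ _ pa' le_aa').
  by move: pa; rewrite -(subnKC le_aa') mulnDr addnA dvdn_addl // dvdn_mull // -eqn_mod_dvd.
rewrite -(subnKC le_aa') mulnDr addnA dvdn_addr // Gauss_dvdr //.
by rewrite eq_sym eqn_mod_dvd ?leq_addr // addKn.
Qed.

Lemma sum_ramanujan_prime p b a : p \in PP ->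
  \sum_(u < p) ramanujan_prime R (b + y * (u + a)) p = 0.
Proof.
move=> pP; rewrite /ramanujan_prime big_split /= -mulr_sumr.
rewrite (eq_bigr (fun u : 'I_p => (p %| (b + y * a) + y * u)%N%:R)); last first.
  by move=> u _; have -> : (b + y * (u + a) = b + y * a + y * u)%N by lia.
by rewrite (sum_dvdn_affine R) // mulr1 sumr_const card_ord mulNrn subrr.
Qed.

Lemma sum_ramanujan_prime_mul p b a a' : p \in PP ->
  \sum_(u < p) ramanujan_prime R (b + y * (u + a)) p * ramanujan_prime R (b + y * (u + a')) p
    = p%:R * (p%:R * (a == a' %[mod p])%N%:R - 1).
Proof.
move=> pP; pose dvd c u : R := (p %| b + y * c + y * u)%N%:R.
have progressionE u c : (b + y * (u + c) = b + y * c + y * u)%N by lia.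
have sum_dvd c : \sum_(u < p) dvd c u = 1 by rewrite (sum_dvdn_affine R).
have dvd_mul u : dvd a u * dvd a' u = (a == a' %[mod p])%N%:R * dvd a u.
  rewrite /dvd; case: (boolP (p %| b + y * a + y * u)%N) => [pa|_]; last by rewrite mul0r mulr0.
  by rewrite mul1r mulr1 -(dvdn_affine_pair (n := b + y * u) a' pP) addnAC.
rewrite (eq_bigr (fun u : 'I_p => p%:R ^+ 2 * ((a == a' %[mod p])%N%:R * dvd a u)
   - p%:R * dvd a u - p%:R * dvd a' u + 1)).
  by rewrite !big_split /= !sumrN -!mulr_sumr !sum_dvd sumr_const card_ord; ring.
move=> u _; rewrite /ramanujan_prime !progressionE -/(dvd a u) -/(dvd a' u) -dvd_mul; ring.
Qed.

Lemma sum_ramanujan_mul U V b a a' : U \subset PP -> V \subset PP ->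
  \sum_(u < modulus (U :|: V)) ramanujan R (b + y * (u + a)) U * ramanujan R (b + y * (u + a')) V
    = (U == V)%:R * ((modulus (U :|: V))%:R * ramanujan_diff a a' U).
Proof.
move=> UP VP; have UVP : U :|: V \subset PP by rewrite subUset UP VP.
pose c (q u s : nat) : R := q%:R * (q %| b + y * (u + s))%N%:R - 1.
pose F (p u : nat) : R :=
  (if inord p \in U then c p u a else 1) * (if inord p \in V then c p u a' else 1).
have c_periodic q s : nat_periodic (fun u => c q u s) q.
  move=> u; congr (_ * _%:R - _).
  by rewrite addnAC (dvdn_affine_periodic q b y (u + s)).
rewrite (eq_bigr (fun u : 'I__ => \prod_(p in U :|: V) F p u)); last first.
  move=> u _; rewrite /ramanujan (big_mkcond (mem U)) (big_mkcond (mem V)) -big_split.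
  rewrite [RHS]big_mkcond /=; apply: eq_bigr => p _; rewrite inE /F inord_val.
  by case: (p \in U); case: (p \in V); rewrite ?mulr1.
rewrite (sum_prod_modulus UVP); last by move=> p _ u; rewrite /F !(c_periodic _ _ u).
have [e|ne] := eqVneq U V.
  rewrite -e setUid mul1r /modulus natr_prod -big_split /=; apply: eq_bigr => p pU.
  rewrite -(@sum_ramanujan_prime_mul p b) ?(subsetP UP) //.
  by apply: eq_bigr => u _; rewrite /F inord_val -e pU.
rewrite mul0r; have [p pUV] : exists p, (p \in U) != (p \in V).
  by apply/existsP; apply: contraNT ne => /existsPn UV; apply/eqP/setP => p; apply/eqP/negPn.
have pin : p \in U :|: V by rewrite inE; move: pUV; case: (p \in U); case: (p \in V).
have pP := subsetP UVP _ pin.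
rewrite (bigD1 p) //= [X in X * _](_ : _ = 0) ?mul0r //.
move: pUV; rewrite /F inord_val; case: (p \in U); case: (p \in V) => // _.
  by under eq_bigr do rewrite mulr1; exact: sum_ramanujan_prime.
by under eq_bigr do rewrite mul1r; exact: sum_ramanujan_prime.
Qed.

Lemma ramanujan_periodic U d b a : (modulus U %| d)%N ->
  nat_periodic (fun u => ramanujan R (b + y * (u + a)) U) d.
Proof.
move=> Ud u; apply: eq_bigr => p pU; rewrite /ramanujan_prime; congr (_ * _%:R - _).
rewrite addnAC (nat_periodic_dvdn (dvdn_affine_periodic p b y)) //.
exact: dvdn_trans (dvdn_modulus pU) Ud.
Qed.

Lemma norm_ramanujan_le_modulus U n : U \subset PP -> `|ramanujan R n U| <= (modulus U)%:R.
Proof.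
move=> UP; apply: le_trans (norm_ramanujan_le R n UP) _.
by rewrite ler_nat (modulus_subset UP) ?dvd_part_sub.
Qed.

Lemma sum_ramanujan_mul_le U V b a a' (Q M : nat) : U \in moduli z y Q -> V \in moduli z y Q ->
  `|\sum_(u < M) ramanujan R (b + y * (u + a)) U * ramanujan R (b + y * (u + a')) V|
    <= (U == V)%:R * (M%:R * `|ramanujan_diff a a' U|) + Q%:R ^+ 4.
Proof.
move=> UQ VQ; have /moduliP[UVP UVQ] := moduliU UQ VQ; have q0 := modulus_gt0 UVP.
have /moduliP[UP Ule] := UQ; have /moduliP[VP Vle] := VQ.
pose f u := ramanujan R (b + y * (u + a)) U * ramanujan R (b + y * (u + a')) V.
have f_periodic : nat_periodic f (modulus (U :|: V)).
  by move=> u; rewrite /f !ramanujan_periodic // dvdn_modulus_subset ?subsetUl ?subsetUr.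
have f_le u : `|f u| <= Q%:R ^+ 2.
  rewrite normrM expr2 ler_pM //.
    by apply: le_trans (norm_ramanujan_le_modulus _ UP) _; rewrite ler_nat.
  by apply: le_trans (norm_ramanujan_le_modulus _ VP) _; rewrite ler_nat.
apply: le_trans (@sum_periodic_norm_le _ f _ M _ q0 f_periodic f_le) _.
rewrite sum_ramanujan_mul // lerD //.
  rewrite !normrM ger0_norm // mulrCA ler_wpM2l // [`|_%:R|]ger0_norm // mulrA.
  by rewrite divfK // pnatr_eq0 -lt0n.
rewrite [X in _ <= _ ^+ X](_ : _ = 2 + 2)%N // exprD ler_wpM2r ?exprn_ge0 //.
by rewrite -natrX ler_nat -mulnn.
Qed.

Lemma sum_ramanujan_diff_le U a (T : nat) : U \in moduli z y T ->
  \sum_(a' < T) `|ramanujan_diff a a' U| <= 2 * T%:R * 2 ^+ #|U|.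
Proof.
move=> /moduliP[UP UT]; have q0 := modulus_gt0 UP.
have q0' : 0 < (modulus U)%:R :> R by rewrite ltr0n.
pose c (p a' : nat) : R := p%:R * (a == a' %[mod p])%N%:R + 1.
have c_periodic p : nat_periodic (c p) p by move=> a'; rewrite /c modnDr.
apply: (@le_trans _ _ (\sum_(a' < T) \prod_(p in U) c p a')).
  apply: ler_sum => a' _; rewrite /ramanujan_diff normr_prod; apply: ler_prod => p _.
  rewrite normr_ge0 /=; apply: le_trans (ler_normB _ _) _.
  by rewrite normr1 ger0_norm // mulr_ge0.
apply: le_trans (@sum_periodic_le _ (fun a' => \prod_(p in U) c p a') _ _ q0 _ _) _.
- move=> a'; apply: eq_bigr => p pU.
  by rewrite (nat_periodic_dvdn (c_periodic p)) // dvdn_modulus.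
- by move=> a'; apply: prodr_ge0 => p _; rewrite addr_ge0 ?mulr_ge0.
rewrite (sum_prod_modulus UP) // (eq_bigr (fun p : I => 2 * p%:R)); last first.
  move=> p pU; have p0 := prime_gt0 (in_sieve_prime UP pU).
  rewrite big_split /= sumr_const card_ord -mulr_sumr.
  rewrite (bigD1 (Ordinal (ltn_pmod a p0))) //= modn_mod eqxx big1; last first.
    move=> i ia; rewrite (_ : (a == i %[mod p])%N = false) //.
    by apply: contraNF ia => /eqP ai; apply/eqP/val_inj; rewrite /= ai modn_small.
  by rewrite addr0 mulr1 [RHS]mulr_natl mulr2n.
rewrite big_split /= prodr_const -natr_prod -/(modulus U).
rewrite [leLHS](_ : _ = 2 ^+ #|U| * (T%:R + (modulus U)%:R)); last by field; rewrite gt_eqF.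
rewrite [leRHS]mulrC ler_wpM2l ?exprn_ge0 //.
have : (modulus U)%:R <= T%:R :> R by rewrite ler_nat.
lra.
Qed.

Variables (w : {set I} -> R) (D : {set {set I}}) (Q : nat).
Hypothesis DQ : D \subset moduli z y Q.

Definition ramanujan_expansion (n : nat) : R := \sum_(U in D) w U * ramanujan R n U.
Local Notation E := ramanujan_expansion.

Lemma ramanujan_expansion_corr_le (M b a a' : nat) :
  `|\sum_(u < M) E (b + y * (u + a)) * E (b + y * (u + a'))|
   <= M%:R * (\sum_(U in D) w U ^+ 2 * `|ramanujan_diff a a' U|)
      + (\sum_(U in D) `|w U|) ^+ 2 * Q%:R ^+ 4.
Proof.
have -> : \sum_(u < M) E (b + y * (u + a)) * E (b + y * (u + a')) =
    \sum_(U in D) \sum_(V in D) w U * w V *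
      \sum_(u < M) ramanujan R (b + y * (u + a)) U * ramanujan R (b + y * (u + a')) V.
  under eq_bigr do rewrite /E mulr_suml.
  rewrite exchange_big /=; apply: eq_bigr => U _.
  under eq_bigr do rewrite mulr_sumr.
  rewrite exchange_big /=; apply: eq_bigr => V _.
  by rewrite mulr_sumr; apply: eq_bigr => u _; rewrite mulrACA.
rewrite expr2 !mulr_suml mulr_sumr -big_split /=.
apply: le_trans (ler_norm_sum _ _ _) _; apply: ler_sum => U UD.
apply: le_trans (ler_norm_sum _ _ _) _.
apply: (@le_trans _ _ (\sum_(V in D)
    ((U == V)%:R * (M%:R * (w U ^+ 2 * `|ramanujan_diff a a' U|)) + `|w U| * `|w V| * Q%:R ^+ 4))).
  apply: ler_sum => V VD; rewrite normrM.
  have UQ := subsetP DQ U UD; have VQ := subsetP DQ V VD.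
  apply: le_trans (ler_wpM2l _ (sum_ramanujan_mul_le b a a' M UQ VQ)) _ => //.
  rewrite mulrDr normrM lerD // mulrCA.
  case: eqVneq => [<-|_]; rewrite ?mul0r // !mul1r.
  by rewrite -normrM -expr2 [`|w U ^+ 2|]ger0_norm ?sqr_ge0 // mulrCA.
rewrite big_split /= lerD //.
  rewrite -mulr_suml (bigD1 U) //= eqxx big1 ?addr0 ?mul1r // => V /andP[_].
  by rewrite eq_sym => /negPf ->.
by rewrite -mulr_suml -mulr_sumr.
Qed.

Lemma sqr_ramanujan_expansion_sum_le (M T b : nat) (X : {set 'I_M}) (Y : {set 'I_T}) :
  (Q <= T)%N ->
  (\sum_(u in X) \sum_(a in Y) E (b + y * (u + a))) ^+ 2 <= #|X|%:R * #|Y|%:R *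
    (T%:R * (2 * M%:R * (\sum_(U in D) w U ^+ 2 * 2 ^+ #|U|)
             + (\sum_(U in D) `|w U|) ^+ 2 * Q%:R ^+ 4)).
Proof.
move=> QT; apply: sqr_bilinear_sum_le => a.
apply: (@le_trans _ _ (\sum_(a' < T)
    (M%:R * (\sum_(U in D) w U ^+ 2 * `|ramanujan_diff a a' U|)
     + (\sum_(U in D) `|w U|) ^+ 2 * Q%:R ^+ 4))).
  by apply: ler_sum => a' _; exact: ramanujan_expansion_corr_le.
rewrite big_split /= sumr_const card_ord -[_ *+ T]mulr_natl mulrDr lerD //.
rewrite -mulr_sumr exchange_big /= mulrA [T%:R * _]mulrA [_ * M%:R]mulrC -!mulrA ler_wpM2l //.
rewrite mulrA mulr_sumr; apply: ler_sum => U /(subsetP DQ)/(moduli_leq QT) UT.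
by rewrite -mulr_sumr mulrCA ler_wpM2l ?sqr_ge0 // [T%:R * 2]mulrC sum_ramanujan_diff_le.
Qed.

End Correlations.

Section LargeModuli.
Variable R : realType.

Lemma sum_powR_le (a : R) z : 0 < a -> \sum_(1 <= n < z.+1) n%:R `^ (- (1 + a)) <= 1 + a^-1.
Proof.
move=> a0; have ai0 : 0 < a^-1 by rewrite invr_gt0.
suff telescoped m : \sum_(1 <= n < m.+2) n%:R `^ (- (1 + a)) <= 1 + a^-1 - a^-1 * m.+1%:R `^ (- a).
  case: z => [|z]; first by rewrite big_geq // addr_ge0 // ltW.
  by apply: le_trans (telescoped z) _; rewrite gerBl mulr_ge0 ?powR_ge0 // ltW.
elim: m => [|m IH]; first by rewrite big_nat1 !powR1; lra.
rewrite big_nat_recr //=; apply: le_trans (lerD IH (lexx _)) _.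
set s := m.+1%:R : R; set t := m.+2%:R : R.
have t0 : 0 < t by rewrite ltr0n.
have st : s = t * (1 - t^-1) by rewrite mulrBr mulr1 divff ?gt_eqF // /t -natr1 addrK.
have i1 : t^-1 < 1 by rewrite invf_lt1 // ltr1n.
have bernoulli : 1 + a * t^-1 <= (1 - t^-1) `^ (- a).
  have p0 : 0 < 1 - t^-1 by rewrite subr_gt0.
  rewrite powRN -[X in _ <= X^-1](lnK (powR_gt0 a p0)) ln_powR -expRN -mulrN.
  apply: le_trans (expR_ge1Dx _); rewrite lerD2l ler_wpM2l ?(ltW a0) // lerNr.
  by rewrite -[X in ln X]/(1 + - _) le_ln1Dx // ltrN2.
have -> : t `^ (- (1 + a)) = t^-1 * t `^ (- a).
  by rewrite opprD powRD ?(gt_eqF t0) ?implybT // powR_inv1 // ltW.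
have -> : s `^ (- a) = (1 - t^-1) `^ (- a) * t `^ (- a).
  by rewrite st mulrC powRM ?(ltW t0) // subr_ge0 ltW.
have step_le : a^-1 * t `^ (- a) + t^-1 * t `^ (- a) <= a^-1 * ((1 - t^-1) `^ (- a) * t `^ (- a)).
  rewrite [leLHS](_ : _ = a^-1 * ((1 + a * t^-1) * t `^ (- a))); last first.
    by field; rewrite !gt_eqF.
  by rewrite ler_wpM2l ?(ltW ai0) // ler_wpM2r ?powR_ge0.
by rewrite -addrA lerD2l lerNr opprD opprK lerBrDr.
Qed.

Definition large_moduli z y (Q Q' : nat) : {set {set 'I_z.+1}} :=
  [set U in moduli z y Q' | (Q < modulus U)%N].

Lemma large_moduli_sub z y Q Q' : large_moduli z y Q Q' \subset moduli z y Q'.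
Proof. by apply/subsetP => U; rewrite inE => /andP[]. Qed.

Lemma sum_large_moduli_coef_sqr_le : exists2 C : R, 0 < C &
  forall z y Q Q' : nat, (0 < z)%N -> (0 < Q)%N ->
  \sum_(U in large_moduli z y Q Q') selberg_coef R y U ^+ 2 * 2 ^+ #|U|
    <= C * Q%:R `^ (- 4^-1) / sieve_mass R z y ^+ 2.
Proof.
have q40 : 0 < 4^-1 :> R by rewrite invr_gt0.
have [C C0 card_le] := @exprn_card_le_modulus R 128 4^-1 (ler1n _ _) q40.
exists (3 * C) => [|z y Q Q' z0 Q0]; first by rewrite mulr_gt0.
set G := sieve_mass R z y; have G0 : 0 < G by apply: sieve_mass_gt0.
pose c := C * Q%:R `^ (- 4^-1) / G ^+ 2.
have c0 : 0 <= c by rewrite divr_ge0 ?mulr_ge0 ?powR_ge0 ?exprn_ge0 // ltW.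
have term_le U : U \in large_moduli z y Q Q' ->
    selberg_coef R y U ^+ 2 * 2 ^+ #|U| <= c * (modulus U)%:R `^ (- (1 + 2^-1)).
  rewrite inE => /andP[/moduli_sub UP QU].
  have q0 : 0 < (modulus U)%:R :> R by rewrite ltr0n (modulus_gt0 UP).
  have coef_sqr_le : selberg_coef R y U ^+ 2 <= (8 ^+ #|U| / ((modulus U)%:R * G)) ^+ 2.
    rewrite -real_normK ?num_real // lerXn2r ?nnegrE ?normr_ge0 ?selberg_coef_le //.
    by rewrite divr_ge0 ?exprn_ge0 ?mulr_ge0 ?(ltW G0).
  apply: le_trans (ler_wpM2r _ coef_sqr_le) _; first by rewrite exprn_ge0.
  move: (modulus U)%:R q0 (card_le z y U UP) (ler_nat R Q (modulus U)) => q q0 qU.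
  rewrite (ltnW QU) => Qq.
  rewrite [leLHS](_ : _ = 128 ^+ #|U| * (q ^+ 2 * G ^+ 2)^-1); last first.
    rewrite [128](_ : _ = 8 * 8 * 2); last by ring.
    rewrite [(8 * 8 * 2) ^+ _]exprMn [(8 * 8) ^+ _]exprMn.
    by move: (8 ^+ #|U|) (2 ^+ #|U|) => e8 e2; field; rewrite !gt_eqF.
  rewrite invfM mulrA /c [leRHS]mulrAC ler_wpM2r ?invr_ge0 ?exprn_ge0 ?(ltW G0) //.
  have -> : (q ^+ 2)^-1 = q `^ (- 2) by rewrite powR_invn // ltW.
  apply: le_trans (ler_wpM2r (powR_ge0 _ _) qU) _.
  rewrite -!mulrA ler_wpM2l ?(ltW C0) // -powRD ?(gt_eqF q0) ?implybT //.
  rewrite [4^-1 - 2](_ : _ = - 4^-1 - (1 + 2^-1)); last by field.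
  rewrite powRD ?(gt_eqF q0) ?implybT // ler_wpM2r ?powR_ge0 // !powRN.
  by rewrite lef_pV2 ?posrE ?powR_gt0 ?ltr0n // ler_powR_base // ltW.
apply: le_trans (ler_sum _ term_le) _; rewrite -mulr_sumr.
have -> : 3 * C * Q%:R `^ (- 4^-1) / G ^+ 2 = c * (1 + 2^-1^-1) by rewrite invrK /c; ring.
rewrite ler_wpM2l // (le_trans _ (sum_powR_le Q' _)) ?invr_gt0 //.
apply: le_trans (@sum_moduli_le R z y Q' (fun n => n%:R `^ (- (1 + 2^-1))) _) => [|n].
  apply: ler_sum_subset (large_moduli_sub _ _ _ _) _ => U; exact: powR_ge0.
exact: powR_ge0.
Qed.

Lemma sum_norm_selberg_coef_le : exists2 C : R, 0 < C &
  forall z y Q : nat, (0 < z)%N ->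
  \sum_(U in moduli z y Q) `|selberg_coef R y U| <= C * Q%:R / sieve_mass R z y.
Proof.
have [C C0 card_le] := @exprn_card_le_modulus R 8 1 (ler1n _ _) ltr01.
exists C => // z y Q z0; set G := sieve_mass R z y; have G0 : 0 < G by apply: sieve_mass_gt0.
have c0 : 0 <= C / G by rewrite divr_ge0 ?ltW.
apply: (@le_trans _ _ (\sum_(U in moduli z y Q) C / G)).
  apply: ler_sum => U /moduli_sub UP; apply: le_trans (selberg_coef_le R z0 UP) _.
  rewrite invfM mulrA ler_wpM2r ?invr_ge0 ?(ltW G0) // ler_pdivrMr ?ltr0n ?(modulus_gt0 UP) //.
  by have := card_le _ _ _ UP; rewrite powRr1.
apply: le_trans (@sum_moduli_le R z y Q (fun=> C / G) _) _ => //.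
by rewrite sumr_const_nat subn1 -[leLHS]mulr_natr mulrAC.
Qed.

Lemma large_moduli_le : exists2 C : R, 0 < C &
  forall (z y b Q M T : nat) (X : {set 'I_M}) (Y : {set 'I_T}),
  (0 < Q <= z)%N -> (z ^ 13 <= M)%N -> (z ^ 2 <= T)%N ->
  (\sum_(u in X) \sum_(a in Y)
     ramanujan_expansion (@selberg_coef R z y) (large_moduli z y Q (z ^ 2)) (b + y * (u + a))) ^+ 2
   <= C * #|X|%:R * #|Y|%:R * M%:R * T%:R * Q%:R `^ (- 4^-1) / sieve_mass R z y ^+ 2.
Proof.
have [C2 C20 sum_sqr_le] := sum_large_moduli_coef_sqr_le.
have [C1 C10 sum_norm_le] := sum_norm_selberg_coef_le.
exists (2 * C2 + C1 ^+ 2); first by rewrite addr_gt0 ?mulr_gt0 ?exprn_gt0.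
move=> z y b Q M T X Y /andP[Q0 Qz] zM zT.
have z0 : (0 < z)%N by apply: leq_trans Qz.
set G := sieve_mass R z y; have G0 : 0 < G by apply: sieve_mass_gt0.
have DQ := large_moduli_sub z y Q (z ^ 2).
apply: le_trans (sqr_ramanujan_expansion_sum_le _ DQ b X Y zT) _.
set qe : R := Q%:R `^ (- 4^-1); have qe0 : 0 <= qe by exact: powR_ge0.
have norm_le : \sum_(U in large_moduli z y Q (z ^ 2)) `|selberg_coef R y U| <= C1 * (z ^ 2)%:R / G.
  by apply: le_trans (sum_norm_le z y _ z0); apply: ler_sum_subset.
have z12 : z%:R ^+ 12 <= M%:R * qe.
  rewrite /qe powRN ler_pdivlMr ?powR_gt0 ?ltr0n //.
  apply: (@le_trans _ _ (z%:R ^+ 12 * z%:R)); last by rewrite -exprSr -natrX ler_nat.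
  rewrite ler_wpM2l ?exprn_ge0 // (@le_trans _ _ Q%:R) ?ler_nat //.
  by rewrite ler1_powR ?ler1n //; lra.
rewrite [leRHS](_ : _ = #|X|%:R * #|Y|%:R *
  (T%:R * (2 * M%:R * (C2 * qe / G ^+ 2) + (C1 / G) ^+ 2 * (M%:R * qe)))); last first.
  by field; rewrite gt_eqF.
rewrite ler_wpM2l ?mulr_ge0 // ler_wpM2l // lerD //.
  by rewrite ler_wpM2l ?mulr_ge0 // sum_sqr_le.
apply: (@le_trans _ _ ((C1 * (z ^ 2)%:R / G) ^+ 2 * (z ^ 2)%:R ^+ 4)).
  rewrite ler_wpM2r ?exprn_ge0 // lerXn2r ?nnegrE ?sumr_ge0 //.
  by rewrite divr_ge0 ?mulr_ge0 ?(ltW C10) ?(ltW G0).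
rewrite natrX [leLHS](_ : _ = (C1 / G) ^+ 2 * z%:R ^+ 12); last by ring.
by rewrite ler_wpM2l ?sqr_ge0.
Qed.

End LargeModuli.

(** * Interpolation of restricted bounds *)

Section FiniteNorms.
Variable R : realType.
Implicit Types (T : finType) (r : R).

Definition fin_lpnorm T r (f : T -> R) : R := (\sum_u f u `^ r) `^ r^-1.

Lemma fin_lpnorm_ge0 T r (f : T -> R) : 0 <= fin_lpnorm r f.
Proof. exact: powR_ge0. Qed.

Lemma fin_lpnorm_eq0 T r (f : T -> R) : r != 0 -> fin_lpnorm r f = 0 -> forall u, f u = 0.
Proof.
move=> r0 /powR_eq0_eq0/psumr_eq0P fr0 u; apply: (@powR_eq0_eq0 _ _ r).
by apply: fr0 => // v _; exact: powR_ge0.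
Qed.

Lemma sum_powR_normalized T r (f : T -> R) : 0 < r -> (forall u, 0 <= f u) ->
  fin_lpnorm r f != 0 -> \sum_u (f u / fin_lpnorm r f) `^ r = 1.
Proof.
move=> r0 f0 nf; have S0 : 0 <= \sum_u f u `^ r by apply: sumr_ge0 => u _; exact: powR_ge0.
have nfE : fin_lpnorm r f `^ r = \sum_u f u `^ r.
  by rewrite -powRrM mulVf ?powRr1 // gt_eqF.
under eq_bigr do rewrite powRM ?invr_ge0 ?fin_lpnorm_ge0 //.
rewrite -mulr_suml -nfE -powRM ?invr_ge0 ?fin_lpnorm_ge0 //.
by rewrite divff // powR1.
Qed.

(* Testing on [h `^ (r' - 1)]. *)
Lemma fin_lpnorm_duality T r (r' D : R) (h : T -> R) :
  1 < r -> r^-1 + r'^-1 = 1 -> 0 <= D -> (forall u, 0 <= h u) ->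
  (forall g : T -> R, (forall u, 0 <= g u) -> \sum_u h u * g u <= D * fin_lpnorm r g) ->
  fin_lpnorm r' h <= D.
Proof.
move=> r1 conj D0 h0 test_le; have r0 : 0 < r by lra.
have rV1 : r^-1 < 1 by rewrite invf_lt1.
have r'0 : 0 < r' by rewrite -invr_gt0; lra.
have rr'E : r * r' = r' + r.
  have -> : r' + r = r * r' * (r^-1 + r'^-1) by field; rewrite !gt_eqF.
  by rewrite conj mulr1.
set S := \sum_u h u `^ r'.
have S0 : 0 <= S by apply: sumr_ge0 => u _; exact: powR_ge0.
have [Sz|Sn0] := eqVneq S 0; first by rewrite /fin_lpnorm -/S Sz powR0 // invr_eq0 gt_eqF.
have SE : S = S `^ r'^-1 * S `^ r^-1 by rewrite -powRD ?Sn0 ?implybT // addrC conj powRr1.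
have g_norm : \sum_u (h u `^ (r' - 1)) `^ r = S.
  by apply: eq_bigr => u _; rewrite -powRrM mulrBl mul1r mulrC rr'E addrK.
have h_mul_g : \sum_u h u * h u `^ (r' - 1) = S.
  by apply: eq_bigr => u _; rewrite mulr_powRB1.
have := test_le (fun u => h u `^ (r' - 1)) (fun u => powR_ge0 _ _).
by rewrite /fin_lpnorm g_norm h_mul_g {1}SE -/S ler_pM2r // powR_gt0 // lt_def Sn0.
Qed.

End FiniteNorms.

Section PowerMeans.
Variable R : realType.

Lemma powR_mul_le_mean (p q s : R) : 0 <= p <= 1 -> 0 <= q <= 1 -> 2^-1 <= s ->
  (p * q) `^ s <= (p + q) / 2.
Proof.
move=> /andP[p0 p1] /andP[q0 q1] s2.
have [->|pq] := eqVneq (p * q) 0; first by rewrite powR0 ?gt_eqF //; lra.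
have pq0 : 0 < p * q by rewrite lt_def pq mulr_ge0.
apply: (@le_trans _ _ (Num.sqrt (p * q))).
  by rewrite -powR12_sqrt ?(ltW pq0) //; apply: ger_powR; rewrite ?pq0 ?mulr_ile1.
rewrite -[leRHS]ger0_norm ?divr_ge0 ?addr_ge0 // -sqrtr_sqr ler_wsqrtr //.
exact: (leif_AGM2 p q).1.
Qed.

Lemma powR_mul_le_sum (a b s : R) : 0 <= a <= 4 -> 0 <= b <= 4 -> 2^-1 <= s <= 1 ->
  (a * b) `^ s <= 2 * (a + b).
Proof.
move=> /andP[a0 a4] /andP[b0 b4] /andP[s2 s1].
have -> : a * b = 16 * (a / 4 * (b / 4)) by field.
rewrite powRM ?mulr_ge0 ?divr_ge0 //.
have pow16 : 16 `^ s <= 16 :> R by rewrite ler1_powR ?ler1n.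
have mean : (a / 4 * (b / 4)) `^ s <= (a / 4 + b / 4) / 2.
  by apply: powR_mul_le_mean => //; apply/andP; split; lra.
apply: le_trans (ler_pM (powR_ge0 _ _) (powR_ge0 _ _) pow16 mean) _; lra.
Qed.

Lemma sum_powR_mul_le (T : finType) (f g : T -> R) (s : R) :
  2^-1 <= s -> (forall j, 0 <= f j) -> (forall j, 0 <= g j) ->
  \sum_j f j `^ s * g j `^ s <= (\sum_j f j) `^ s * (\sum_j g j) `^ s.
Proof.
move=> s2 f0 g0; have sn0 : s != 0 by rewrite gt_eqF //; lra.
set A := \sum_j f j; set B := \sum_j g j.
have A0 : 0 <= A by apply: sumr_ge0.
have B0 : 0 <= B by apply: sumr_ge0.
have [Az|An0] := eqVneq A 0.
  by rewrite Az powR0 // mul0r big1 // => j _; rewrite (psumr_eq0P _ Az) // powR0 // mul0r.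
have [Bz|Bn0] := eqVneq B 0.
  by rewrite Bz powR0 // mulr0 big1 // => j _; rewrite (psumr_eq0P _ Bz) // powR0 // mulr0.
have normalized (h : T -> R) j : (forall i, 0 <= h i) -> \sum_i h i != 0 ->
    0 <= h j / \sum_i h i <= 1.
  move=> h0 hn; have S0 : 0 < \sum_i h i by rewrite lt_def hn sumr_ge0.
  by rewrite divr_ge0 ?(ltW S0) // ler_pdivrMr // mul1r (bigD1 j) //= lerDl sumr_ge0.
apply: (@le_trans _ _ (\sum_j A `^ s * B `^ s * ((f j / A + g j / B) / 2))).
  apply: ler_sum => j _.
  have -> : f j `^ s * g j `^ s = A `^ s * B `^ s * (f j / A * (g j / B)) `^ s.
    by rewrite powRM ?divr_ge0 // mulrACA -!powRM ?divr_ge0 // ![_ * (_ / _)]mulrC !divfK.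
  by rewrite ler_wpM2l ?mulr_ge0 ?powR_ge0 // powR_mul_le_mean ?normalized.
rewrite -mulr_sumr -[leRHS]mulr1 ler_wpM2l ?mulr_ge0 ?powR_ge0 //.
by rewrite -mulr_suml big_split /= -!mulr_suml -/A -/B !divff //; lra.
Qed.

End PowerMeans.

Section GeometricPeaks.
Variable R : realFieldType.
Implicit Types x theta : R.

(* Comparable with [min x x^-1]; it telescopes along a geometric progression
   because x / (1 + x) is bounded. *)
Definition peak x : R := 4 * x / (1 + x) ^+ 2.

Lemma le_mul_peak (A t x : R) : 0 < x -> 0 <= A -> t <= A * x -> t <= A / x -> t <= A * peak x.
Proof.
move=> x0 A0 tx tV; have x1 : 0 < (1 + x) ^+ 2 by rewrite exprn_gt0 //; lra.
have [xl|xg] := leP x 1.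
  apply: le_trans tx _; rewrite ler_wpM2l // ler_pdivlMr //.
  by rewrite mulrC ler_wpM2r ?(ltW x0) // expr2; nra.
by apply: le_trans tV _; rewrite ler_wpM2l // ler_pdivlMr // ler_pdivrMl //; nra.
Qed.

Definition peak_sum_bound theta : R := 4 * theta / (theta - 1).

Lemma peak_sum_bound_gt0 theta : 1 < theta -> 0 < peak_sum_bound theta.
Proof.
move=> theta1; have theta0 : 0 < theta by apply: lt_trans theta1.
by rewrite divr_gt0 ?mulr_gt0 ?subr_gt0.
Qed.

Lemma sum_geometric_peak_le x theta (K : nat) : 0 < x -> 1 < theta ->
  \sum_(j < K) peak (x * theta ^+ j) <= peak_sum_bound theta.
Proof.
move=> x0 theta1; have theta0 : 0 < theta by apply: lt_trans theta1.
have D0 := peak_sum_bound_gt0 theta1.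
pose Phi t : R := t / (1 + t).
have peak_le t : 0 < t -> peak t <= peak_sum_bound theta * (Phi (t * theta) - Phi t).
  move=> t0; have t1 : 0 < 1 + t by lra.
  have t2 : 0 < 1 + t * theta by rewrite addr_gt0 // mulr_gt0.
  have theta10 : 0 < theta - 1 by rewrite subr_gt0.
  rewrite [leRHS](_ : _ = 4 * t * (theta / ((1 + t) * (1 + t * theta)))); last first.
    by rewrite /Phi /peak_sum_bound; field; rewrite !gt_eqF.
  rewrite ler_wpM2l ?mulr_ge0 ?(ltW t0) // ler_pdivlMr ?mulr_gt0 // mulrC.
  rewrite ler_pdivrMr ?exprn_gt0 // -subr_ge0.
  rewrite [leRHS](_ : _ = (1 + t) * (theta - 1)); last by ring.
  by rewrite mulr_ge0 ?(ltW t1) ?(ltW theta10).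
have telescoped : \sum_(j < K) peak (x * theta ^+ j)
    <= peak_sum_bound theta * (Phi (x * theta ^+ K) - Phi x).
  elim: K => [|K IH]; first by rewrite big_ord0 expr0 mulr1 subrr mulr0.
  have xK : 0 < x * theta ^+ K by rewrite mulr_gt0 // exprn_gt0.
  rewrite big_ord_recr /=; apply: le_trans (lerD IH (peak_le _ xK)) _.
  by rewrite -mulrDr exprSr mulrA ler_wpM2l ?(ltW D0) //; lra.
have xK : 0 < x * theta ^+ K by rewrite mulr_gt0 // exprn_gt0.
apply: le_trans telescoped _; rewrite -[leRHS]mulr1 ler_wpM2l ?(ltW D0) //.
have : Phi (x * theta ^+ K) <= 1 by rewrite /Phi ler_pdivrMr; lra.
have : 0 <= Phi x by rewrite /Phi divr_ge0; lra.
lra.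
Qed.

Lemma sum_convolution_le (K L : nat) (a b c : nat -> R) (S D : R) :
  (forall i, 0 <= a i) -> (forall j, 0 <= b j) -> 0 <= D ->
  \sum_(i < K) a i <= S -> \sum_(j < L) b j <= S ->
  (forall i n, \sum_(j < n) c (i + j)%N <= D) ->
  \sum_(i < K) \sum_(j < L) (a i + b j) * c (i + j)%N <= 2 * S * D.
Proof.
move=> a0 b0 D0 aS bS cD.
have side_le n n' (d : nat -> R) : (forall i, 0 <= d i) -> \sum_(i < n) d i <= S ->
    \sum_(i < n) d i * \sum_(j < n') c (i + j)%N <= S * D.
  move=> d0 dS; apply: le_trans (ler_wpM2r D0 dS); rewrite mulr_suml.
  by apply: ler_sum => i _; rewrite ler_wpM2l.
rewrite (eq_bigr (fun i : 'I_K => a i * \sum_(j < L) c (i + j)%N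
   + \sum_(j < L) b j * c (j + i)%N)); last first.
  move=> i _; rewrite mulr_sumr -big_split; apply: eq_bigr => j _.
  by rewrite mulrDl [(j + i)%N]addnC.
rewrite big_split exchange_big /= -mulrA mulr_natl mulr2n lerD ?side_le //.
by under eq_bigr do rewrite -mulr_sumr; exact: side_le.
Qed.

End GeometricPeaks.

Section LevelSets.
Variables (R : realType) (T : finType) (f : T -> R).
Implicit Types (r x : R) (i j K : nat).

Definition level_set i : {set T} := [set u | 2^-1 ^+ i.+1 < f u <= 2^-1 ^+ i].

Definition level_mass r i : R := (2^-1 ^+ i) `^ r * #|level_set i|%:R.

Lemma level_mass_ge0 r i : 0 <= level_mass r i.
Proof. by rewrite mulr_ge0 ?powR_ge0. Qed.

Lemma level_set_inj u i j : u \in level_set i -> u \in level_set j -> i = j.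
Proof.
have le_level k l : u \in level_set k -> u \in level_set l -> (l <= k)%N.
  rewrite !inE leqNgt => /andP[fk _] /andP[_ fl]; apply/negP => kl.
  have half0 : 0 <= 2^-1 :> R by [].
  have half1 : 2^-1 <= 1 :> R by rewrite invf_le1 // ler1n.
  by have := lt_le_trans fk (le_trans fl (ler_wiXn2l half0 half1 kl)); rewrite ltxx.
by move=> ui uj; apply/eqP; rewrite eqn_leq !le_level.
Qed.

Lemma dyadic_level x : 0 < x <= 1 ->
  exists2 i, (i <= Num.truncn x^-1)%N & 2^-1 ^+ i.+1 < x <= 2^-1 ^+ i.
Proof.
move=> /andP[x0 x1].
have trunc_level : 2^-1 ^+ (Num.truncn x^-1).+1 < x.
  rewrite exprVn invf_plt ?posrE ?exprn_gt0 //.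
  by apply: lt_trans (truncnS_gt _) _; rewrite -natrX ltr_nat ltn_expl.
have ex_level : exists i, 2^-1 ^+ i.+1 < x by exists (Num.truncn x^-1).
case: (ex_minnP ex_level) => i xi imin; exists i; first exact: imin.
rewrite xi; case: i xi imin => [|i] xi imin; first by rewrite expr0.
by rewrite leNgt; apply/negP => /imin; rewrite ltnn.
Qed.

Lemma sum_mul_le_levels : (forall u, 0 <= f u <= 1) -> exists K,
  forall phi : T -> R, (forall u, 0 <= phi u) ->
  \sum_u f u * phi u <= \sum_(i < K) 2^-1 ^+ i * \sum_(u in level_set i) phi u.
Proof.
move=> f01; pose K := (\max_u Num.truncn (f u)^-1).+1.
exists K => phi phi0.
under [leRHS]eq_bigr do rewrite mulr_sumr big_mkcond.
rewrite exchange_big; apply: ler_sum => u _; have /andP[fu0 fu1] := f01 u.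
have level_ge0 (i : 'I_K) : 0 <= (if u \in level_set i then 2^-1 ^+ i * phi u else 0).
  by case: ifP => // _; rewrite mulr_ge0 ?exprn_ge0 ?invr_ge0.
have [fz|fn] := eqVneq (f u) 0; first by rewrite fz mul0r sumr_ge0.
have [|i iK ui] := @dyadic_level (f u); first by rewrite lt_def fn fu0.
have {}iK : (i < K)%N.
  by rewrite ltnS (leq_trans iK) // (@leq_bigmax T (fun v => Num.truncn (f v)^-1) u).
rewrite (bigD1 (Ordinal iK)) //= inE ui ler_wpDr ?sumr_ge0 // ler_wpM2r //.
by case/andP: ui.
Qed.

Lemma sum_level_mass_le r K : 0 < r <= 2 ->
  \sum_(i < K) level_mass r i <= 4 * \sum_u f u `^ r.
Proof.
move=> /andP[r0 r2].
apply: (@le_trans _ _ (\sum_(i < K) \sum_(u in level_set i) 4 * f u `^ r)).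
  apply: ler_sum => i _; rewrite /level_mass mulr_natr -sumr_const.
  apply: ler_sum => u; rewrite inE => /andP[fu _].
  have -> : 2^-1 ^+ i = 2 * 2^-1 ^+ i.+1 :> R by rewrite exprS mulVKf.
  rewrite powRM ?exprn_ge0 ?invr_ge0 // ler_pM ?powR_ge0 //.
    by apply: le_trans (_ : 2 `^ 2 <= _); rewrite ?ler_powR ?ler1n // powR_mulrn // -natrX.
  by rewrite ler_powR_base ?(ltW r0) ?exprn_ge0 ?invr_ge0 // ltW.
rewrite pair_big_dep mulr_sumr /=; apply: (ler_sum_inj (h := snd)) => //.
- move=> [i u] [j v] /= ui vj uv; move: vj; rewrite -uv => uj.
  by congr (_, _); exact/val_inj/(level_set_inj ui uj).
- by move=> u _; rewrite mulr_ge0 ?powR_ge0.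
Qed.

Lemma level_mass_le r i : 0 < r <= 2 -> level_mass r i <= 4 * \sum_u f u `^ r.
Proof.
move=> r02; apply: le_trans (sum_level_mass_le i.+1 r02).
by rewrite (bigD1 ord_max) //= lerDl sumr_ge0 // => j _; exact: level_mass_ge0.
Qed.

End LevelSets.

Section RestrictedInterpolation.
Variable R : realType.

Definition restricted_bound (I J : finType) (k : I -> J -> R) (A m s : R) : Prop :=
  forall (X : {set I}) (Y : {set J}),
    \sum_(u in X) \sum_(a in Y) k u a <= A * (#|X|%:R * #|Y|%:R / m) `^ s.

Lemma restricted_bound_le (I J : finType) (k : I -> J -> R) (A A' m s : R) :
  A <= A' -> restricted_bound k A m s -> restricted_bound k A' m s.
Proof. by move=> AA kA X Y; apply: le_trans (kA X Y) _; rewrite ler_wpM2r ?powR_ge0. Qed.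

Definition interp_const (r eta : R) : R := 16 * peak_sum_bound (2 `^ (r * eta)).

Lemma interp_base_gt1 (r eta : R) : 0 < r -> 0 < eta -> 1 < 2 `^ (r * eta) :> R.
Proof.
move=> r0 eta0; have : 1 `^ (r * eta) < 2 `^ (r * eta) :> R.
  by apply: gt0_ltr_powR; rewrite ?mulr_gt0 ?nnegrE ?ltr1n.
by rewrite powR1.
Qed.

Lemma interp_const_gt0 (r eta : R) : 0 < r -> 0 < eta -> 0 < interp_const r eta.
Proof. by move=> r0 eta0; rewrite mulr_gt0 // peak_sum_bound_gt0 // interp_base_gt1. Qed.

Lemma scaled_powR_density (w m x r s : R) : 0 < w -> 0 < m -> 0 <= x -> r != 0 ->
  w * (x / m) `^ s = m `^ (- r^-1) * (w `^ r * x) `^ s * (m * w `^ r) `^ (r^-1 - s).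
Proof.
move=> w0 m0 x0 r0; have wr0 : 0 < w `^ r by rewrite powR_gt0.
have wE : (w `^ r) `^ s * (w `^ r) `^ (r^-1 - s) = w.
  by rewrite -powRD ?(gt_eqF wr0) ?implybT // subrKC powRK // ltW.
have mE : m `^ (- r^-1) * m `^ (r^-1 - s) = m^-1 `^ s.
  rewrite -powRD ?(gt_eqF m0) ?implybT // addKr -[m^-1]powR_inv1 ?(ltW m0) // -powRrM.
  by rewrite mulN1r.
rewrite !powRM ?invr_ge0 ?(ltW m0) ?(ltW wr0) // -mE -{1}wE; ring.
Qed.

Variables (r eta m A : R) (I J : finType) (k : I -> J -> R).
Hypotheses (r0 : 0 < r) (eta0 : 0 < eta).
Hypotheses (rBeta : 2^-1 <= r^-1 - eta) (rDeta : r^-1 + eta <= 1).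
Hypotheses (m0 : 0 < m) (A0 : 0 <= A) (k0 : forall u a, 0 <= k u a).
Hypotheses (kB : restricted_bound k A m (r^-1 - eta)) (kD : restricted_bound k A m (r^-1 + eta)).

Local Notation theta := (2 `^ (r * eta)).

Lemma exponent_le2 : 0 < r <= 2.
Proof.
have rV : 2^-1 <= r^-1 by move: rBeta eta0; lra.
by rewrite r0 /= -[leLHS]invrK invf_ple ?posrE ?invr_gt0.
Qed.

Lemma level_pair_sum_le (f : I -> R) (g : J -> R) i j :
  \sum_u f u `^ r <= 1 -> \sum_a g a `^ r <= 1 ->
  2^-1 ^+ i * 2^-1 ^+ j * (\sum_(u in level_set f i) \sum_(a in level_set g j) k u a)
    <= A * m `^ (- r^-1) * (2 * (level_mass f r i + level_mass g r j))
       * peak ((m `^ eta)^-1 * theta ^+ (i + j)).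
Proof.
move=> f1 g1; set a := level_mass f r i; set b := level_mass g r j.
have mass_le (T : finType) (h : T -> R) n : \sum_u h u `^ r <= 1 -> 0 <= level_mass h r n <= 4.
  move=> h1; rewrite level_mass_ge0 (le_trans (level_mass_le h n exponent_le2)) //.
  by rewrite -[leRHS]mulr1 ler_wpM2l.
have /andP[a0 a4] : 0 <= a <= 4 := mass_le _ f i f1.
have /andP[b0 b4] : 0 <= b <= 4 := mass_le _ g j g1.
set w : R := 2^-1 ^+ (i + j); have w0 : 0 < w by rewrite exprn_gt0 ?invr_gt0.
have mw0 : 0 < m * w `^ r by rewrite mulr_gt0 ?powR_gt0.
have abE : w `^ r * (#|level_set f i|%:R * #|level_set g j|%:R) = a * b.
  by rewrite /w exprD powRM ?exprn_ge0 ?invr_ge0 // mulrACA.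
clearbody a b.
have peakE : (m `^ eta)^-1 * theta ^+ (i + j) = ((m * w `^ r) `^ eta)^-1.
  rewrite powRM ?(ltW m0) ?powR_ge0 // invfM; congr (_ * _).
  rewrite -powRrM /w powR_exprn ?invr_ge0 // -exprVn -powRN -[2^-1]powR_inv1 // -powRrM.
  by rewrite mulrNN mul1r.
have scaled_le s : 2^-1 <= s <= 1 -> restricted_bound k A m s ->
    w * (\sum_(u in level_set f i) \sum_(a in level_set g j) k u a)
    <= A * m `^ (- r^-1) * (2 * (a + b)) * (m * w `^ r) `^ (r^-1 - s).
  move=> s01 ks; apply: le_trans (ler_wpM2l (ltW w0) (ks _ _)) _.
  have rn0 : r != 0 by rewrite gt_eqF.
  rewrite mulrCA (scaled_powR_density s w0 m0 _ rn0) ?mulr_ge0 // abE.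
  rewrite -!mulrA ler_wpM2l // ler_wpM2l ?powR_ge0 // !mulrA ler_wpM2r ?powR_ge0 //.
  by apply: powR_mul_le_sum; rewrite ?a0 ?a4 ?b0 ?b4.
rewrite -exprD peakE; apply: le_mul_peak.
- by rewrite invr_gt0 powR_gt0.
- by rewrite !mulr_ge0 ?powR_ge0 ?addr_ge0.
- rewrite -powRN; have -> : - eta = r^-1 - (r^-1 + eta) by rewrite opprD addNKr.
  by apply: scaled_le => //; apply/andP; split; move: rBeta rDeta eta0; lra.
rewrite invrK; have -> : eta = r^-1 - (r^-1 - eta) by rewrite subKr.
by apply: scaled_le => //; apply/andP; split; move: rBeta rDeta eta0; lra.
Qed.

Lemma interpolation_unit (f : I -> R) (g : J -> R) :
  (forall u, 0 <= f u) -> (forall a, 0 <= g a) ->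
  \sum_u f u `^ r <= 1 -> \sum_a g a `^ r <= 1 ->
  \sum_u \sum_a k u a * f u * g a <= interp_const r eta * A * m `^ (- r^-1).
Proof.
move=> f0 g0 f1 g1.
have pointwise_le1 (T : finType) (h : T -> R) : (forall u, 0 <= h u) -> \sum_u h u `^ r <= 1 ->
    forall u, 0 <= h u <= 1.
  move=> h0 h1 u; rewrite h0 /=; have hr1 : h u `^ r <= 1.
    by apply: le_trans h1; rewrite (bigD1 u) //= lerDl sumr_ge0 // => v _; exact: powR_ge0.
  have rV0 : 0 <= r^-1 by rewrite invr_ge0 ltW.
  by have := ler_powR_base rV0 (powR_ge0 _ _) hr1; rewrite powR1 powRK ?gt_eqF.
have [K f_le] := sum_mul_le_levels (pointwise_le1 _ f f0 f1).
have [L g_le] := sum_mul_le_levels (pointwise_le1 _ g g0 g1).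
set T0 := A * m `^ (- r^-1); have T00 : 0 <= T0 by rewrite mulr_ge0 ?powR_ge0.
apply: (@le_trans _ _ (\sum_(i < K) \sum_(j < L) 2^-1 ^+ i * 2^-1 ^+ j *
    (\sum_(u in level_set f i) \sum_(a in level_set g j) k u a))).
  rewrite (eq_bigr (fun u => f u * \sum_a g a * k u a)); last first.
    by move=> u _; rewrite mulr_sumr; apply: eq_bigr => a _; ring.
  apply: le_trans (f_le _ _) _; first by move=> u; apply: sumr_ge0 => a _; rewrite mulr_ge0.
  apply: ler_sum => i _; under [leRHS]eq_bigr do rewrite -mulrA; rewrite -[leRHS]mulr_sumr.
  rewrite ler_wpM2l ?exprn_ge0 ?invr_ge0 //.
  apply: (@le_trans _ _ (\sum_(u in level_set f i)
      \sum_(j < L) 2^-1 ^+ j * \sum_(a in level_set g j) k u a)).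
    by apply: ler_sum => u _; exact: g_le.
  by rewrite exchange_big; under eq_bigr do rewrite -mulr_sumr.
pose rho : R := (m `^ eta)^-1; have rho0 : 0 < rho by rewrite invr_gt0 powR_gt0.
have theta1 : 1 < theta := interp_base_gt1 r0 eta0.
pose D := peak_sum_bound theta; have D0 : 0 <= D by rewrite ltW // peak_sum_bound_gt0.
apply: (@le_trans _ _ (\sum_(i < K) \sum_(j < L) T0 * 2 *
    ((level_mass f r i + level_mass g r j) * peak (rho * theta ^+ (i + j))))).
  apply: ler_sum => i _; apply: ler_sum => j _.
  by apply: le_trans (level_pair_sum_le i j f1 g1) _; rewrite !mulrA.
under eq_bigr do rewrite -mulr_sumr.
rewrite -mulr_sumr [leRHS](_ : _ = T0 * 2 * (2 * 4 * D)); last first.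
  by rewrite /interp_const /T0 /D; ring.
have mass_sum_le (T : finType) (h : T -> R) n : \sum_u h u `^ r <= 1 ->
    \sum_(i < n) level_mass h r i <= 4.
  by move=> h1; apply: le_trans (sum_level_mass_le h n exponent_le2) _; lra.
rewrite ler_wpM2l ?(mulr_ge0 T00) //.
apply: (sum_convolution_le (c := fun n => peak (rho * theta ^+ n))
  (level_mass_ge0 f r) (level_mass_ge0 g r)) => //; try exact: mass_sum_le.
move=> i n; under eq_bigr do rewrite exprD mulrA.
by apply: sum_geometric_peak_le; rewrite ?mulr_gt0 ?exprn_gt0.
Qed.

Lemma interpolation (f : I -> R) (g : J -> R) :
  (forall u, 0 <= f u) -> (forall a, 0 <= g a) ->
  \sum_u \sum_a k u a * f u * g a
    <= interp_const r eta * A * m `^ (- r^-1) * (fin_lpnorm r f * fin_lpnorm r g).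
Proof.
move=> f0 g0; have rn0 : r != 0 by rewrite gt_eqF.
have [nf0|nf] := eqVneq (fin_lpnorm r f) 0.
  rewrite nf0 mul0r mulr0 big1 // => u _; rewrite big1 // => a _.
  by rewrite (fin_lpnorm_eq0 rn0 nf0) mulr0 mul0r.
have [ng0|ng] := eqVneq (fin_lpnorm r g) 0.
  rewrite ng0 !mulr0 big1 // => u _; rewrite big1 // => a _.
  by rewrite (fin_lpnorm_eq0 rn0 ng0) mulr0.
have unit_le := interpolation_unit
  (fun u => divr_ge0 (f0 u) (fin_lpnorm_ge0 r f)) (fun a => divr_ge0 (g0 a) (fin_lpnorm_ge0 r g)).
rewrite -ler_pdivrMr ?mulr_gt0 ?lt_def ?nf ?ng ?fin_lpnorm_ge0 //.
rewrite [leLHS](_ : _ = \sum_u \sum_a k u a * (f u / fin_lpnorm r f) * (g a / fin_lpnorm r g)).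
  by apply: unit_le; rewrite sum_powR_normalized.
rewrite mulr_suml; apply: eq_bigr => u _; rewrite mulr_suml; apply: eq_bigr => a _.
by field; rewrite nf ng.
Qed.

End RestrictedInterpolation.

(** * The Selberg form on sets *)

Section HankelSums.
Variable R : rcfType.

Lemma le_threshold_expr (c lam : R) (k : nat) : (0 < k)%N -> 0 <= c -> 0 < lam ->
  c <= lam + (lam ^+ k.-1)^-1 * c ^+ k.
Proof.
case: k => // k _ c0 lam0 /=; have [cl|lc] := leP c lam.
  by rewrite ler_wpDr // mulr_ge0 ?exprn_ge0 // invr_ge0 exprn_ge0 // ltW.
apply: ler_wpDl; first exact: ltW.
by rewrite ler_pdivlMl ?exprn_gt0 // exprSr ler_wpM2r // lerXn2r ?nnegrE // ltW.
Qed.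

Lemma sum_hankel_le (M T S : nat) (X : {set 'I_M}) (Y : {set 'I_T}) (c : nat -> R) :
  (forall t, 0 <= c t) -> (M + T <= S)%N ->
  \sum_(u in X) \sum_(a in Y) c (u + a)%N
    <= Num.sqrt (#|X|%:R * #|Y|%:R) * \sum_(t < S) c t.
Proof.
move=> c0 MT; set W := \sum_(t < S) c t; have W0 : 0 <= W by apply: sumr_ge0.
have window_le (K : nat) (Z : {set 'I_K}) (v : nat) : (v + K <= S)%N ->
    \sum_(a in Z) c (v + a)%N <= W.
  move=> vK; have shift_lt (a : 'I_K) : (v + a < S)%N.
    by apply: leq_trans vK; rewrite ltn_add2l.
  apply: (ler_sum_inj (h := fun a : 'I_K => Ordinal (shift_lt a))) => //.
  by move=> a a' _ _ /(congr1 val) /= /addnI /val_inj.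
set L := \sum_(u in X) _.
have L0 : 0 <= L by apply: sumr_ge0 => u _; apply: sumr_ge0.
have LX : L <= #|X|%:R * W.
  rewrite mulr_natl -sumr_const; apply: ler_sum => u _; apply: window_le.
  by apply: leq_trans MT; rewrite leq_add2r ltnW.
have LY : L <= #|Y|%:R * W.
  rewrite /L exchange_big /= mulr_natl -sumr_const; apply: ler_sum => a _.
  under eq_bigr do rewrite addnC.
  by apply: window_le; apply: leq_trans MT; rewrite addnC leq_add2l ltnW.
rewrite -(@ler_pXn2r _ 2) ?nnegrE ?mulr_ge0 ?sqrtr_ge0 //.
by rewrite exprMn sqr_sqrtr ?mulr_ge0 // !expr2 mulrACA ler_pM.
Qed.

Lemma sum_hankel_moment_le (M T S k : nat) (X : {set 'I_M}) (Y : {set 'I_T})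
    (c : nat -> R) (lam : R) :
  (forall t, 0 <= c t) -> (M + T <= S)%N -> (0 < k)%N -> 0 < lam ->
  \sum_(u in X) \sum_(a in Y) c (u + a)%N <= lam * (#|X|%:R * #|Y|%:R)
    + (lam ^+ k.-1)^-1 * (Num.sqrt (#|X|%:R * #|Y|%:R) * \sum_(t < S) c t ^+ k).
Proof.
move=> c0 MT k0 lam0.
apply: (@le_trans _ _ (\sum_(u in X) \sum_(a in Y)
    (lam + (lam ^+ k.-1)^-1 * c (u + a)%N ^+ k))).
  by apply: ler_sum => u _; apply: ler_sum => a _; apply: le_threshold_expr.
under eq_bigr do rewrite big_split /= sumr_const -mulr_sumr.
rewrite big_split /= sumr_const -mulr_sumr lerD //.
  by rewrite -mulrnA -[leLHS]mulr_natr mulnC natrM.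
rewrite ler_wpM2l ?invr_ge0 ?exprn_ge0 ?(ltW lam0) //.
by apply: (@sum_hankel_le M T S X Y (fun t => c t ^+ k)) => // t; rewrite exprn_ge0.
Qed.

End HankelSums.

Section SelbergForm.
Variable R : realType.

Definition density (M T : nat) (X : {set 'I_M}) (Y : {set 'I_T}) : R :=
  #|X|%:R * #|Y|%:R / M%:R ^+ 2.

Lemma card_mul_density M T (X : {set 'I_M}) (Y : {set 'I_T}) : (0 < M)%N ->
  #|X|%:R * #|Y|%:R = M%:R ^+ 2 * density X Y.
Proof. by move=> M0; rewrite /density mulrCA divff ?mulr1 // expf_neq0 // pnatr_eq0 -lt0n. Qed.

Lemma density_ge0 M T (X : {set 'I_M}) (Y : {set 'I_T}) : 0 <= density X Y.
Proof. by rewrite divr_ge0 ?mulr_ge0 ?exprn_ge0. Qed.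

Lemma density_le2 M (X : {set 'I_M}) (Y : {set 'I_(2 * M)}) : (0 < M)%N -> density X Y <= 2.
Proof.
move=> M0; rewrite /density ler_pdivrMr ?exprn_gt0 ?ltr0n // -natrX -!natrM ler_nat.
have := max_card (mem X); have := max_card (mem Y); rewrite !card_ord => YM XM.
by rewrite -mulnn mulnCA leq_mul.
Qed.

Lemma density_rev_ord M T (X : {set 'I_M}) (Y : {set 'I_T}) :
  density [set rev_ord u | u in X] Y = density X Y.
Proof. by rewrite /density card_imset //; exact: rev_ord_inj. Qed.

Lemma powR_le_double (x s t : R) : 0 <= x <= 2 -> 0 < s -> s <= t -> t <= 1 ->
  x `^ t <= 2 * x `^ s.
Proof.
move=> /andP[x0 x2] s0 st t1.
have [->|xn0] := eqVneq x 0; first by rewrite !powR0 ?mulr0 // gt_eqF //; lra.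
have xp : 0 < x / 2 by rewrite divr_gt0 // lt_def xn0.
have x1 : x / 2 <= 1 by lra.
have -> : x = 2 * (x / 2) by field.
move: (x / 2) xp x1 => w xp x1; rewrite !powRM ?(ltW xp) // mulrA ler_pM ?powR_ge0 //.
  apply: (@le_trans _ _ 2); first by rewrite ler1_powR ?ler1n.
  by rewrite ler_peMr // powR_ge1 // ?ler1n // ltW.
by apply: ger_powR => //; rewrite xp.
Qed.

Lemma truncated_tau_bilinear_le (k : nat) (e : R) : (0 < k)%N -> 0 < e ->
  exists2 C : R, 0 < C &
  forall (z y b Q M : nat) (X : {set 'I_M}) (Y : {set 'I_(2 * M)}),
  0 < density X Y -> (0 < Q)%N -> (Q ^ k <= M)%N ->
  \sum_(u in X) \sum_(a in Y) truncated_tau R z y Q (b + y * (u + a))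
    <= C * M%:R ^+ 2 * density X Y `^ (1 - (2 * k%:R)^-1) * Q%:R `^ e.
Proof.
move=> k0 e0; have [C C0 moment_le] := @truncated_tau_moment_le R k e e0.
exists (1 + 3 * C) => [|z y b Q M X Y]; first by rewrite addr_gt0 // mulr_gt0.
set x := density X Y => x0 Q0 QM.
have M0 : (0 < M)%N by apply: leq_trans QM; rewrite expn_gt0 Q0.
have xD t t' : x `^ t * x `^ t' = x `^ (t + t') by rewrite powRD // (gt_eqF x0) implybT.
pose lam := x `^ (- (2 * k%:R)^-1); have lam0 : 0 < lam by rewrite powR_gt0.
have M3 : (M + 2 * M <= 3 * M)%N by rewrite -{1}[M]mul1n -mulnDl.
have tau0 t : 0 <= truncated_tau R z y Q (b + y * t) by exact: truncated_tau_ge0.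
apply: le_trans (sum_hankel_moment_le X Y tau0 M3 k0 lam0) _.
have xE : x = x `^ 1 by rewrite powRr1 // ltW.
rewrite card_mul_density // -/x sqrtrM ?exprn_ge0 // sqrtr_sqr ger0_norm //.
rewrite -powR12_sqrt ?(ltW x0) //.
have Qe1 : 1 <= Q%:R `^ e by rewrite powR_ge1 ?ler1n // ltW.
have lam_mul : lam * (M%:R ^+ 2 * x) = M%:R ^+ 2 * x `^ (1 - (2 * k%:R)^-1).
  by rewrite {1}xE mulrCA xD [- _ + 1]addrC.
have lamV_mul : (lam ^+ k.-1)^-1 * x `^ 2^-1 = x `^ (1 - (2 * k%:R)^-1).
  rewrite /lam -powR_mulrn ?powR_ge0 // -powRrM -powRN xD; congr (_ `^ _).
  have -> : k%:R = k.-1%:R + 1 :> R by rewrite natr1 prednK.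
  by field; rewrite natr1 pnatr_eq0.
have Q3 : (Q ^ k <= 3 * M)%N by rewrite (leq_trans QM) // leq_pmull.
apply: (@le_trans _ _ (lam * (M%:R ^+ 2 * x)
    + (lam ^+ k.-1)^-1 * (M%:R * x `^ 2^-1 * (C * (3 * M)%:R * Q%:R `^ e)))).
  rewrite lerD2l ler_wpM2l ?invr_ge0 ?exprn_ge0 ?(ltW lam0) //.
  by rewrite ler_wpM2l ?mulr_ge0 ?powR_ge0 // moment_le.
rewrite natrM lam_mul [_ + _](_ : _ = M%:R ^+ 2 * x `^ (1 - (2 * k%:R)^-1)
    * (1 + 3 * C * Q%:R `^ e)); last by rewrite -lamV_mul; ring.
rewrite [leRHS](_ : _ = M%:R ^+ 2 * x `^ (1 - (2 * k%:R)^-1) * ((1 + 3 * C) * Q%:R `^ e)).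
  by rewrite ler_wpM2l ?mulr_ge0 ?powR_ge0 ?exprn_ge0 // [leRHS]mulrDl mul1r lerD2r.
by ring.
Qed.

Local Notation selberg_part z y D := (ramanujan_expansion (@selberg_coef R z y) D).

Lemma small_moduli_bilinear_le (s : R) : 0 < s -> s < 1 ->
  exists (k : nat) (C : R), [/\ (0 < k)%N, 0 < C &
  forall (z y b Q M : nat) (X : {set 'I_M}) (Y : {set 'I_(2 * M)}), (0 < z)%N ->
  0 < density X Y <= 2 -> (0 < Q)%N -> (Q ^ k <= M)%N -> Q%:R <= 17 * (density X Y ^+ 4)^-1 ->
  \sum_(u in X) \sum_(a in Y) selberg_part z y (moduli z y Q) (b + y * (u + a))
    <= C / sieve_mass R z y * M%:R ^+ 2 * density X Y `^ s].
Proof.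
move=> s0 s1; pose e : R := (1 - s) / 16; have e0 : 0 < e by rewrite divr_gt0 ?subr_gt0.
pose k := (Num.truncn (1 - s)^-1).+1.
have kV : (2 * k%:R)^-1 <= (1 - s) / 2.
  rewrite invfM [leRHS]mulrC ler_wpM2l // invf_ple ?posrE ?subr_gt0 ?ltr0n //.
  by rewrite ltW // truncnS_gt.
have [C1 C10 small_le] := @small_moduli_le R e e0.
have [C2 C20 tau_le] := truncated_tau_bilinear_le (ltn0Sn _ : (0 < k)%N) e0.
exists k, (C1 * C2 * 34); split; rewrite ?mulr_gt0 // => z y b Q M X Y z0.
move/andP; set x := density X Y => -[x0 x2] Q0 QM Qx.
set G := sieve_mass R z y; have G0 : 0 < G by apply: sieve_mass_gt0.
have C1G0 : 0 <= C1 / G * Q%:R `^ e by rewrite mulr_ge0 ?powR_ge0 ?divr_ge0 ?ltW.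
apply: (@le_trans _ _ (C1 / G * Q%:R `^ e *
    \sum_(u in X) \sum_(a in Y) truncated_tau R z y Q (b + y * (u + a)))).
  rewrite mulr_sumr; apply: ler_sum => u _; rewrite mulr_sumr; apply: ler_sum => a _.
  apply: le_trans (small_le z y _ Q z0 Q0); apply: ler_sum => U _.
  by rewrite -normrM ler_norm.
apply: le_trans (ler_wpM2l C1G0 (tau_le z y b Q M X Y x0 Q0 QM)) _; rewrite -/x.
have Qe2 : Q%:R `^ e * Q%:R `^ e <= 17 * x `^ (- (8 * e)).
  rewrite -powRD; last by rewrite pnatr_eq0 -lt0n Q0 implybT.
  apply: (@le_trans _ _ ((17 * (x ^+ 4)^-1) `^ (e + e))).
    by rewrite ler_powR_base // addr_ge0 // ltW.
  rewrite powRM ?invr_ge0 ?exprn_ge0 ?(ltW x0) // ler_pM ?powR_ge0 //.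
    by rewrite ler1_powR ?ler1n // /e; lra.
  rewrite -powR_invn ?(ltW x0) // -powRrM.
  by rewrite (_ : - 4%:R * (e + e) = - (8 * e)) //; ring.
have x_le : x `^ (1 - (2 * k%:R)^-1) * x `^ (- (8 * e)) <= 2 * x `^ s.
  rewrite -powRD ?(gt_eqF x0) ?implybT // powR_le_double ?(ltW x0) ?x2 // /e; first by lra.
  have : 0 <= (2 * k%:R)^-1 :> R by rewrite invr_ge0 mulr_ge0.
  lra.
rewrite [leLHS](_ : _ = C1 / G * C2 * M%:R ^+ 2 * (x `^ (1 - (2 * k%:R)^-1)
    * (Q%:R `^ e * Q%:R `^ e))); last by ring.
rewrite [leRHS](_ : _ = C1 / G * C2 * M%:R ^+ 2 * (17 * (2 * x `^ s))); last by ring.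
rewrite ler_wpM2l ?mulr_ge0 ?exprn_ge0 ?invr_ge0 ?(ltW C10) ?(ltW C20) ?(ltW G0) //.
apply: le_trans (ler_wpM2l (powR_ge0 _ _) Qe2) _.
by rewrite mulrCA ler_wpM2l.
Qed.

Lemma large_moduli_bilinear_le : exists2 C : R, 0 < C &
  forall (s : R) (z y b Q M : nat) (X : {set 'I_M}) (Y : {set 'I_(2 * M)}), 0 < s -> s < 1 ->
  0 < density X Y <= 2 -> (0 < Q <= z)%N -> (z ^ 13 <= M)%N -> (density X Y ^+ 4)^-1 <= Q%:R ->
  \sum_(u in X) \sum_(a in Y) selberg_part z y (large_moduli z y Q (z ^ 2)) (b + y * (u + a))
    <= C / sieve_mass R z y * M%:R ^+ 2 * density X Y `^ s.
Proof.
have [C C0 large_le] := @large_moduli_le R.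
exists (Num.sqrt (2 * C) * 2); first by rewrite mulr_gt0 ?sqrtr_gt0 ?mulr_gt0.
move=> s z y b Q M X Y s0 s1 /andP[]; set x := density X Y => x0 x2 /andP[Q0 Qz] zM xQ.
have z0 : (0 < z)%N by apply: leq_trans Qz.
have M0 : (0 < M)%N by apply: leq_trans zM; rewrite expn_gt0 z0.
set G := sieve_mass R z y; have G0 : 0 < G by apply: sieve_mass_gt0.
have Q4 : Q%:R `^ (- 4^-1) <= x.
  rewrite powRN invf_ple ?posrE ?powR_gt0 ?ltr0n //.
  have -> : x^-1 = ((x ^+ 4)^-1) `^ 4^-1.
    by rewrite -exprVn -powR_mulrn ?invr_ge0 ?(ltW x0) // powRK ?invr_ge0 // ltW.
  by rewrite ler_powR_base ?invr_ge0 ?exprn_ge0 ?(ltW x0).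
have z2 : (z ^ 2 <= 2 * M)%N.
  by apply: leq_trans (leq_pmull _ _) => //; apply: leq_trans zM; rewrite leq_pexp2l.
have Q0z : (0 < Q <= z)%N by rewrite Q0.
have := large_le z y b Q M (2 * M)%N X Y Q0z zM z2; set L := \sum_(u in X) _.
rewrite -[C * _ * _]mulrA card_mul_density // -/x -/G => L2.
clearbody x.
have c0 : 0 <= Num.sqrt (2 * C) / G * M%:R ^+ 2.
  by rewrite mulr_ge0 ?divr_ge0 ?sqrtr_ge0 ?exprn_ge0 ?(ltW G0).
apply: (@le_trans _ _ (Num.sqrt (2 * C) / G * M%:R ^+ 2 * x)); last first.
  rewrite [leRHS](_ : _ = Num.sqrt (2 * C) / G * M%:R ^+ 2 * (2 * x `^ s)); last by ring.
  by rewrite ler_wpM2l // -{1}[x]powRr1 ?(ltW x0) // powR_le_double ?(ltW x0) // ltW.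
apply: le_trans (ler_norm _) _.
rewrite -(@ler_pXn2r _ 2) ?nnegrE ?normr_ge0 ?(mulr_ge0 c0) ?(ltW x0) //.
rewrite real_normK ?num_real //; apply: le_trans L2 _.
have -> : (Num.sqrt (2 * C) / G * M%:R ^+ 2 * x) ^+ 2 =
   2 * C * (M%:R ^+ 2) ^+ 2 * (x * x) / G ^+ 2.
  by rewrite !exprMn sqr_sqrtr ?mulr_ge0 ?(ltW C0) // exprVn; ring.
rewrite natrM [leLHS](_ : _ = 2 * C * (M%:R ^+ 2) ^+ 2 * (x * Q%:R `^ (- 4^-1)) / G ^+ 2).
  rewrite ler_wpM2r ?invr_ge0 ?exprn_ge0 ?(ltW G0) //.
  by rewrite ler_wpM2l ?mulr_ge0 ?exprn_ge0 ?(ltW C0) // ler_wpM2l ?(ltW x0).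
by ring.
Qed.

Lemma selberg_sqr_split z y Q n : (Q <= z ^ 2)%N ->
  selberg R z y n ^+ 2 = selberg_part z y (moduli z y Q) n
    + selberg_part z y (large_moduli z y Q (z ^ 2)) n.
Proof.
move=> Qz; rewrite selberg_sqr (bigID (fun U => U \in moduli z y Q)) /=; congr (_ + _).
rewrite /ramanujan_expansion big_mkcond [RHS]big_mkcond; apply: eq_bigr => U _.
have [->|/selberg_coef_supp Uz] := eqVneq (selberg_coef R y U) 0.
  by rewrite mul0r !if_same.
by move: Uz; rewrite !inE => /andP[-> ->]; rewrite -ltnNge.
Qed.

Lemma selberg_sqr_bilinear_le (s : R) : 0 < s -> s < 1 ->
  exists (k : nat) (C : R), [/\ (0 < k)%N, 0 < C &
  forall (z y b Q M : nat) (X : {set 'I_M}) (Y : {set 'I_(2 * M)}),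
  0 < density X Y <= 2 -> (0 < Q)%N -> (Q ^ k <= z)%N -> (z ^ 13 <= M)%N ->
  (density X Y ^+ 4)^-1 <= Q%:R <= 17 * (density X Y ^+ 4)^-1 ->
  \sum_(u in X) \sum_(a in Y) selberg R z y (b + y * (u + a)) ^+ 2
    <= C / sieve_mass R z y * M%:R ^+ 2 * density X Y `^ s].
Proof.
move=> s0 s1; have [k [C1 [k0 C10 small_le]]] := small_moduli_bilinear_le s0 s1.
have [C2 C20 large_le] := large_moduli_bilinear_le.
exists k, (C1 + C2); split; rewrite ?addr_gt0 // => z y b Q M X Y x02 Q0 Qkz zM /andP[xQ Qx].
have Qz : (Q <= z)%N by apply: leq_trans Qkz; rewrite -{1}[Q]expn1 leq_pexp2l.
have z0 : (0 < z)%N by apply: leq_trans Qz.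
have zM1 : (z <= M)%N by apply: leq_trans zM; rewrite -{1}[z]expn1 leq_pexp2l.
have Qz2 : (Q <= z ^ 2)%N by rewrite (leq_trans Qz) // -{1}[z]expn1 leq_pexp2l.
under eq_bigr do under eq_bigr do rewrite (selberg_sqr_split _ _ Qz2).
under eq_bigr do rewrite big_split /=.
rewrite big_split !mulrDl lerD //; first exact: small_le z0 x02 Q0 (leq_trans Qkz zM1) Qx.
by apply: large_le; rewrite ?Q0.
Qed.

End SelbergForm.

(** * The prime kernel on sets *)

Section VonMangoldt.
Variable R : realType.
Local Notation Lambda := (@vonMangoldt R).

Lemma vonMangoldt_ge0 n : 0 <= Lambda n.
Proof.
rewrite /vonMangoldt; case E : (primes n) => [|p [|q s]] //.
have : p \in primes n by rewrite E mem_head.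
by rewrite mem_primes => /andP[/prime_gt0 p0 _]; rewrite ln_ge0 // ler1n.
Qed.

Lemma vonMangoldt_le_ln N n : (0 < n < N)%N -> Lambda n <= ln N%:R.
Proof.
move=> /andP[n0 nN]; have N0 : (0 < N)%N by apply: leq_trans nN.
have lN : 0 <= ln N%:R :> R by rewrite ln_ge0 // ler1n.
rewrite /vonMangoldt; case E : (primes n) => [|p [|q s]] //.
have : p \in primes n by rewrite E mem_head.
rewrite mem_primes => /and3P[/prime_gt0 p0 _ pn].
by rewrite ler_ln ?posrE ?ltr0n // ler_nat (leq_trans (dvdn_leq n0 pn)) // ltnW.
Qed.

Definition small_prime_power (z n : nat) : bool :=
  if primes n is [:: p] then (p <= z)%N else false.

Lemma vonMangoldt_le_selberg (z y N n : nat) : (0 < z)%N -> (0 < n < N)%N ->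
  Lambda n <= ln N%:R * (selberg R z y n ^+ 2 + (small_prime_power z n)%:R).
Proof.
move=> z0 nN; have lL := vonMangoldt_le_ln nN; have L0 := vonMangoldt_ge0 n.
have lN : 0 <= ln N%:R :> R by apply: le_trans lL.
case E : (primes n) => [|p [|q s]]; try by rewrite {1}/vonMangoldt E mulr_ge0 ?addr_ge0 ?sqr_ge0.
rewrite /small_prime_power E; case: leqP => pz.
  by apply: le_trans lL _; rewrite ler_peMr // lerDr sqr_ge0.
rewrite selberg_rough ?expr1n ?addr0 ?mulr1 // => r rP; apply/negP => rn.
have : (r : nat) \in primes n.
  by rewrite mem_primes rn; case/andP: nN => ->; move: rP; rewrite inE => /andP[->].
by rewrite E inE => /eqP rp; move: (ltn_ord r); rewrite rp ltnS leqNgt pz.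
Qed.

(* Such a power is determined by its prime and by its exponent, which is less
   than m * z. *)
Lemma sum_small_prime_power_le (m z N : nat) : (0 < m)%N -> (0 < z)%N -> (N <= z.+1 ^ m)%N ->
  \sum_(n < N) (small_prime_power z n)%:R <= (2 * m)%:R * z%:R ^+ 2 :> R.
Proof.
move=> m0 z0 Nz; pose P (n : nat) := head 0%N (primes n).
have PE n : small_prime_power z n ->
    [/\ (P n <= z)%N, prime (P n), (0 < n)%N & n = (P n ^ logn (P n) n)%N].
  rewrite /small_prime_power /P; case E : (primes n) => [|p [|q s]] //= pz.
  have : p \in primes n by rewrite E mem_head.
  rewrite mem_primes => /and3P[pp n0 pn]; split => //.
  by rewrite {1}(prod_prime_decomp n0) prime_decompE E /= big_cons big_nil muln1.
have exponent_lt (n : 'I_N) : small_prime_power z n -> (logn (P n) n < m * z)%N.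
  move=> /PE[_ pp n0 nE]; rewrite -(@ltn_exp2l 2) // (@leq_ltn_trans n) //.
    by rewrite [leqRHS]nE; case: (logn _ _) => // e; rewrite leq_exp2r ?prime_gt1.
  apply: leq_trans (ltn_ord n) _; apply: leq_trans Nz _.
  by rewrite mulnC expnM leq_exp2r // ltn_expl.
have mz0 : (0 < m * z)%N by rewrite muln_gt0 m0.
apply: (@le_trans _ _ (\sum_(p : 'I_z.+1 * 'I_(m * z)) 1)).
  under eq_bigr do rewrite mulrb.
  rewrite -big_mkcond /=.
  apply: (ler_sum_inj (h := fun n : 'I_N => (inord (P n) : 'I_z.+1,
     insubd (Ordinal mz0) (logn (P n) n) : 'I_(m * z)))) => //.
  move=> n n' nP nP' [/(congr1 val) eP /(congr1 val) elog].
  have [Pz _ _ nE] := PE _ nP; have [Pz' _ _ nE'] := PE _ nP'.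
  move: eP elog; rewrite /= !inordK // !val_insubd !exponent_lt // => eP elog.
  by apply/val_inj => /=; rewrite nE nE' elog eP.
rewrite sumr_const card_prod !card_ord -natrX -natrM ler_nat; nia.
Qed.

End VonMangoldt.

Section SieveParameters.
Variable R : realType.

Lemma blocks_gt0 (N y M : nat) : (0 < N)%N -> (N <= y * M)%N -> (0 < M)%N.
Proof. by case: M => // N0; rewrite muln0 leqNgt N0. Qed.

Lemma root_bracket (M k : nat) : (0 < M)%N -> (0 < k)%N ->
  exists2 z, (0 < z)%N & (z ^ k <= M < z.+1 ^ k)%N.
Proof.
move=> M0 k0.
have ex_root : exists z, (z ^ k <= M)%N by exists 0%N; rewrite exp0n.
have root_le z : (z ^ k <= M)%N -> (z <= M)%N.
  by apply: leq_trans; case: z => // z; rewrite -{1}[z.+1]expn1 leq_pexp2l.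
case: (ex_maxnP ex_root root_le) => z zM zmax; exists z; first by apply: zmax; rewrite exp1n.
by rewrite zM /= ltnNge; apply/negP => /zmax; rewrite ltnn.
Qed.

Lemma exists_sieve_level (N y M : nat) : (0 < N)%N -> (y ^ 2 <= N)%N -> (N <= y * M)%N ->
  exists z, [/\ (0 < z)%N, (z ^ 13 <= M)%N & (0 < N <= z.+1 ^ 26)%N].
Proof.
move=> N0 yN NyM; have M0 := blocks_gt0 N0 NyM.
have [z z0 /andP[zM Mz]] := @root_bracket M 13 M0 isT; exists z; split=> //.
rewrite N0 -(leq_pmul2l N0) (@leq_trans (y ^ 2 * M ^ 2)) //.
  by rewrite -expnMn mulnn leq_exp2r.
by rewrite leq_mul // [26%N](_ : _ = 13 * 2)%N // expnM leq_exp2r // ltnW.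
Qed.

Lemma ln_powR_le_root (c d : R) (m : nat) : 0 < c -> 0 < d -> (0 < m)%N -> exists N0 : R,
  forall N z : nat, N0 <= N%:R -> (0 < N)%N -> (N <= z.+1 ^ m)%N ->
  c * (ln N%:R) `^ d <= z%:R.
Proof.
move=> c0 d0 m0; pose eps : R := (2 * m)%:R^-1.
have eps0 : 0 < eps by rewrite invr_gt0 ltr0n muln_gt0.
pose c' := c * ((eps / d)^-1) `^ d.
have c'0 : 0 < c' by rewrite mulr_gt0 // powR_gt0 // invr_gt0 divr_gt0.
exists ((c' + 1) `^ (2 * m)%:R) => N z NN N0 Nz.
have Np : 0 < N%:R :> R by rewrite ltr0n.
pose t : R := N%:R `^ eps; have t0 : 0 < t by apply: powR_gt0.
have tc : c' + 1 <= t.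
  have c1 : 0 <= c' + 1 by rewrite addr_ge0 // ltW.
  rewrite -[leLHS](powRK c1 (_ : (2 * m)%:R != 0)) ?pnatr_eq0 -?lt0n ?muln_gt0 //.
  by rewrite ler_powR_base ?powR_ge0 // ltW.
have ln_le : c * (ln N%:R) `^ d <= c' * t.
  rewrite /c' -mulrA ler_wpM2l ?(ltW c0) //.
  have -> : t = (N%:R `^ (eps / d)) `^ d by rewrite -powRrM divfK // gt_eqF.
  rewrite -powRM ?invr_ge0 ?powR_ge0 ?(ltW (divr_gt0 eps0 d0)) //.
  by rewrite ler_powR_base ?(ltW d0) ?ln_ge0 ?ler1n // ln_le_powR // divr_gt0.
have t2 : t ^+ 2 <= z%:R + 1.
  have -> : z%:R + 1 = ((z.+1 ^ m)%:R) `^ m%:R^-1 :> R.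
    by rewrite natrX -powR_mulrn // powRK ?natr1 // pnatr_eq0 -lt0n.
  have -> : t ^+ 2 = N%:R `^ m%:R^-1.
    rewrite /t -powR_mulrn ?powR_ge0 // -powRrM /eps natrM; congr (_ `^ _).
    by field; rewrite pnatr_eq0 -lt0n.
  by rewrite ler_powR_base ?invr_ge0 // ler_nat.
by apply: le_trans ln_le _; nra.
Qed.

Lemma exists_modulus_cutoff (x : R) : 0 < x <= 2 ->
  exists2 Q : nat, (0 < Q)%N & (x ^+ 4)^-1 <= Q%:R <= 17 * (x ^+ 4)^-1.
Proof.
move=> /andP[x0 x2]; have v0 : 0 < (x ^+ 4)^-1 by rewrite invr_gt0 exprn_gt0.
have v16 : 1 <= 16 * (x ^+ 4)^-1.
  rewrite ler_pdivlMr ?exprn_gt0 // mul1r [16](_ : _ = 2 ^+ 4); last by ring.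
  by rewrite lerXn2r ?nnegrE ?(ltW x0).
exists (Num.truncn (x ^+ 4)^-1).+1 => //.
rewrite ltW ?truncnS_gt //= -natr1.
have : (Num.truncn (x ^+ 4)^-1)%:R <= (x ^+ 4)^-1 by rewrite truncn_le // ltW.
lra.
Qed.

Lemma exists_sieve_parameters (s : R) (k m : nat) : 0 < s -> s < 1 -> (0 < k)%N -> (0 < m)%N ->
  exists N0 : R, forall (N z : nat) (x : R), N0 <= N%:R -> (N <= z.+1 ^ m)%N ->
  0 < x <= 2 -> x `^ (s - 1) <= ln N%:R ->
  exists Q : nat, [/\ (0 < Q)%N, (Q ^ k <= z)%N,
    (x ^+ 4)^-1 <= Q%:R <= 17 * (x ^+ 4)^-1 & ln N%:R <= z%:R * x `^ s].
Proof.
move=> s0 s1 k0 m0; have os : 0 < 1 - s by rewrite subr_gt0.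
pose al := (1 - s)^-1; have al0 : 0 < al by rewrite invr_gt0.
have kR : 1 <= k%:R :> R by rewrite ler1n.
have d0 : 0 < 4 * al * k%:R by rewrite !mulr_gt0 ?ltr0n.
have [N0 root_le] := @ln_powR_le_root (17 ^+ k) _ m (exprn_gt0 _ (ltr0n _ 17)) d0 m0.
exists (Num.max (expR 1) N0) => N z x; rewrite ge_max => /andP[Ne NN0] Nz x02 xl.
have /andP[x0 x2] := x02.
have Np : 0 < N%:R :> R by apply: lt_le_trans Ne; exact: expR_gt0.
set l := ln N%:R in xl *.
have l1 : 1 <= l by rewrite -[leLHS]expRK ler_ln ?posrE ?expR_gt0.
have l0 : 0 < l by apply: lt_le_trans l1.
have lz : 17 ^+ k * l `^ (4 * al * k%:R) <= z%:R by apply: root_le; rewrite // -(ltr0n R).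
have xV : x^-1 <= l `^ al.
  have -> : x^-1 = (x `^ (s - 1)) `^ al.
    by rewrite -powRrM -powR_inv1 ?(ltW x0) // /al; congr (_ `^ _); field; lra.
  by rewrite ler_powR_base ?powR_ge0 // ltW.
have [Q Q0 xQ] := exists_modulus_cutoff x02.
exists Q; split => //.
  rewrite -(ler_nat R) natrX; apply: le_trans lz.
  rewrite powRrM powR_mulrn ?powR_ge0 // -exprMn lerXn2r ?nnegrE ?mulr_ge0 ?powR_ge0 //.
  case/andP: xQ => _ /le_trans -> //; rewrite ler_wpM2l // mulrC powRrM powR_mulrn ?powR_ge0 //.
  by rewrite -exprVn lerXn2r ?nnegrE ?invr_ge0 ?powR_ge0 ?(ltW x0).
rewrite -ler_pdivrMr ?powR_gt0 // -powRN.
have -> : x `^ (- s) = x^-1 `^ s by rewrite -powR_inv1 ?(ltW x0) // -powRrM mulN1r.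
have l_al : l * (l `^ al) `^ s = l `^ al.
  rewrite -powRrM -{1}[l]powRr1 ?(ltW l0) // -powRD ?(gt_eqF l0) ?implybT //.
  by congr (_ `^ _); rewrite /al; field; lra.
apply: (@le_trans _ _ (l `^ al)).
  by rewrite -[leRHS]l_al ler_wpM2l ?(ltW l0) // ler_powR_base ?invr_ge0 ?(ltW x0) ?(ltW s0).
apply: le_trans lz; apply: (@le_trans _ _ (l `^ (4 * al * k%:R))).
  by rewrite ler_powR // mulrAC ler_peMl ?(ltW al0) //; lra.
by rewrite ler_peMl ?powR_ge0 // exprn_ege1 // ler1n.
Qed.

End SieveParameters.

Section ProgressionWeight.
Variable R : realType.
Local Notation Lambda := (@vonMangoldt R).
Implicit Types (N y b M m z : nat).

Lemma totient_le y : (0 < y)%N -> (totient y <= y)%N.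
Proof.
move=> y0; rewrite totient_count_coprime big_mkord -[leqRHS]card_ord -sum1_card.
by apply: leq_sum => i _; case: coprime.
Qed.

Definition progression_weight N y b m : R :=
  if (b + y * m < N)%N then (totient y)%:R / N%:R * Lambda (b + y * m) else 0.

Lemma progression_weight_ge0 N y b m : 0 <= progression_weight N y b m.
Proof.
rewrite /progression_weight; case: ifP => // _.
by rewrite mulr_ge0 ?divr_ge0 // vonMangoldt_ge0.
Qed.

Definition prime_kernel N y b M (u : 'I_M) (a : 'I_(2 * M)) : R :=
  if (u <= a)%N then progression_weight N y b (a - u) else 0.

Lemma prime_kernel_ge0 N y b M (u : 'I_M) (a : 'I_(2 * M)) : 0 <= prime_kernel N y b u a.
Proof. by rewrite /prime_kernel; case: ifP => // _; exact: progression_weight_ge0. Qed.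

Section Bounds.
Variables (N y b M : nat).
Hypotheses (y0 : (0 < y)%N) (b0 : (0 < b)%N).
Hypotheses (NyM : (N <= y * M)%N) (yMN : (y * M <= 2 * N)%N).
Implicit Types (X : {set 'I_M}) (Y : {set 'I_(2 * M)}) (u : 'I_M) (a : 'I_(2 * M)).

Lemma ratio_le_blocks : y%:R / N%:R <= 2 / M%:R :> R.
Proof.
have [M0|M0] := posnP M.
  by move: NyM; rewrite M0 muln0 leqn0 => /eqP ->; rewrite !invr0 !mulr0.
have N0 : (0 < N)%N by rewrite -(ltn_pmul2l (ltn0Sn 1)) muln0 (leq_trans _ yMN) // muln_gt0 y0.
by rewrite ler_pdivrMr ?ltr0n // mulrAC ler_pdivlMr ?ltr0n // -!natrM ler_nat.
Qed.

Lemma totient_ratio_le : (totient y)%:R / N%:R <= 2 / M%:R :> R.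
Proof. by apply: le_trans ratio_le_blocks; rewrite ler_wpM2r ?invr_ge0 // ler_nat totient_le. Qed.

Lemma prime_kernel_sum_le_ln X Y : (0 < N)%N ->
  \sum_(u in X) \sum_(a in Y) prime_kernel N y b u a <= 2 * M%:R * (density R X Y * ln N%:R).
Proof.
move=> N0; have M0 := blocks_gt0 N0 NyM.
have lN : 0 <= ln N%:R :> R by rewrite ln_ge0 // ler1n.
have -> : 2 * M%:R * (density R X Y * ln N%:R) = #|X|%:R * (#|Y|%:R * (2 / M%:R * ln N%:R)).
  by rewrite /density; field; rewrite pnatr_eq0 -lt0n.
rewrite mulr_natl -sumr_const; apply: ler_sum => u _.
rewrite mulr_natl -sumr_const; apply: ler_sum => a _.
rewrite /prime_kernel /progression_weight; case: ifP => _; last by rewrite mulr_ge0 ?divr_ge0.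
case: ifP => [nN|_]; last by rewrite mulr_ge0 ?divr_ge0.
by rewrite ler_pM ?divr_ge0 ?vonMangoldt_ge0 ?totient_ratio_le // vonMangoldt_le_ln // addn_gt0 b0.
Qed.

Variable z : nat.
Hypothesis z0 : (0 < z)%N.

(* Reversing u turns the Toeplitz kernel a - u into a Hankel one; adding the
   multiple z! M of all sieving primes avoids negative arguments. *)
Definition reflected_start : nat := (b + y * (z`! * M - M.-1))%N.

Lemma selberg_reflect u a : (u <= a)%N ->
  selberg R z y (reflected_start + y * (rev_ord u + a)) = selberg R z y (b + y * (a - u)).
Proof.
move=> ua; apply: eq_selberg => p; rewrite inE => /andP[pp _].
have pz : (p %| z`!)%N by rewrite dvdn_fact // prime_gt0 //= -ltnS ltn_ord.
have uM := ltn_ord u; have PM : (M <= z`! * M)%N by rewrite leq_pmull // fact_gt0.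
have -> : (reflected_start + y * (rev_ord u + a) = b + y * (a - u) + y * (z`! * M))%N.
  by rewrite -addnA -mulnDr -addnA -mulnDr /=; congr (_ + _ * _)%N; lia.
by rewrite dvdn_addl // dvdn_mull // dvdn_mulr.
Qed.

Definition small_power_kernel u a : R :=
  [&& (u <= a)%N, (b + y * (a - u) < N)%N & small_prime_power z (b + y * (a - u))]%:R.

Lemma prime_kernel_le_selberg u a : (0 < N)%N ->
  prime_kernel N y b u a <= (totient y)%:R / N%:R * ln N%:R *
    (selberg R z y (reflected_start + y * (rev_ord u + a)) ^+ 2 + small_power_kernel u a).
Proof.
move=> N0; have lN : 0 <= ln N%:R :> R by rewrite ln_ge0 // ler1n.
have rhs0 : 0 <= (totient y)%:R / N%:R * ln N%:R *
    (selberg R z y (reflected_start + y * (rev_ord u + a)) ^+ 2 + small_power_kernel u a).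
  by rewrite !mulr_ge0 ?divr_ge0 ?invr_ge0 ?addr_ge0 ?sqr_ge0 ?ler0n.
move: rhs0; rewrite /prime_kernel /progression_weight /small_power_kernel.
case: ifP => // ua; case: ifP => //= nN _; rewrite selberg_reflect //.
by rewrite -[leRHS]mulrA ler_wpM2l ?divr_ge0 // vonMangoldt_le_selberg // addn_gt0 b0.
Qed.

Lemma sum_small_power_kernel_le m X Y : (0 < m)%N -> (N <= z.+1 ^ m)%N ->
  \sum_(u in X) \sum_(a in Y) small_power_kernel u a <= M%:R * ((2 * m)%:R * z%:R ^+ 2).
Proof.
move=> m0 Nz; apply: (@le_trans _ _ (#|X|%:R * ((2 * m)%:R * z%:R ^+ 2))); last first.
  rewrite ler_wpM2r ?mulr_ge0 ?exprn_ge0 // ler_nat.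
  by have := max_card (mem X); rewrite card_ord.
rewrite mulr_natl -sumr_const; apply: ler_sum => u _.
have [N0|N0] := posnP N.
  rewrite big1 ?mulr_ge0 ?exprn_ge0 // => a _.
  by rewrite /small_power_kernel N0 ltn0 andbF.
apply: le_trans (sum_small_prime_power_le R m0 z0 Nz).
under eq_bigr do rewrite /small_power_kernel mulrb.
rewrite -big_mkcondr /=.
apply: (ler_sum_inj (h := fun a => insubd (Ordinal N0) (b + y * (a - u))%N : 'I_N)) => //.
  move=> a a' /andP[_ /and3P[ua aN _]] /andP[_ /and3P[ua' aN' _]] /(congr1 val).
  rewrite !val_insubd aN aN' => /addnI /eqP; rewrite eqn_pmul2l // => /eqP e.
  by apply/val_inj => /=; rewrite -(subnK ua) -(subnK ua') e.
by move=> a /andP[_ /and3P[ua aN pn]]; rewrite val_insubd aN pn.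
Qed.

Lemma totient_ln_le_sieve_mass m : (0 < N <= z.+1 ^ m)%N ->
  (totient y)%:R / N%:R * ln N%:R / sieve_mass R z y <= (2 * m)%:R / M%:R.
Proof.
move=> /andP[N0 Nz]; set G := sieve_mass R z y; have G0 : 0 < G by apply: sieve_mass_gt0.
have phi0 : 0 < (totient y)%:R :> R by rewrite ltr0n totient_gt0.
have ln_le : ln N%:R <= m%:R * ln z.+1%:R :> R.
  rewrite mulr_natl -lnXn ?ltr0n // ler_ln ?posrE ?exprn_gt0 ?ltr0n //.
  by rewrite -natrX ler_nat.
have := ln_le_sieve_mass R z y0; rewrite -/G mulrAC ler_pdivlMr // => mass_ge.
rewrite ler_pdivrMr // (@le_trans _ _ (m%:R * (y%:R / N%:R) * G)) //; last first.
  rewrite ler_wpM2r ?(ltW G0) // natrM [leRHS](_ : _ = m%:R * (2 / M%:R)); last by ring.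
  by rewrite ler_wpM2l // ratio_le_blocks.
rewrite [leLHS](_ : _ = (totient y)%:R * ln N%:R / N%:R); last by ring.
rewrite [leRHS](_ : _ = m%:R * (y%:R * G) / N%:R); last by ring.
rewrite ler_wpM2r ?invr_ge0 //; apply: le_trans (ler_wpM2l (ltW phi0) ln_le) _.
by rewrite mulrCA ler_wpM2l // mulrC.
Qed.

Lemma prime_kernel_sum_le m X Y (S : R) : (0 < m)%N -> (0 < N <= z.+1 ^ m)%N ->
  \sum_(u in X) \sum_(a in Y) selberg R z y (reflected_start + y * (rev_ord u + a)) ^+ 2
    <= S / sieve_mass R z y ->
  \sum_(u in X) \sum_(a in Y) prime_kernel N y b u a
    <= (2 * m)%:R / M%:R * S + (4 * m)%:R * (ln N%:R * z%:R ^+ 2).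
Proof.
move=> m0 N0z; have /andP[N0 Nz] := N0z; set G := sieve_mass R z y => S_le.
have G0 : 0 < G by apply: sieve_mass_gt0.
have M0 := blocks_gt0 N0 NyM.
have lN : 0 <= ln N%:R :> R by rewrite ln_ge0 // ler1n.
pose c : R := (totient y)%:R / N%:R * ln N%:R; have c0 : 0 <= c by rewrite mulr_ge0 ?divr_ge0.
have S0 : 0 <= S.
  rewrite -(pmulr_lge0 _ (_ : 0 < G^-1)) ?invr_gt0 //; apply: le_trans S_le.
  by apply: sumr_ge0 => u _; apply: sumr_ge0 => a _; exact: sqr_ge0.
apply: (@le_trans _ _ (\sum_(u in X) \sum_(a in Y)
    c * (selberg R z y (reflected_start + y * (rev_ord u + a)) ^+ 2 + small_power_kernel u a))).
  by apply: ler_sum => u _; apply: ler_sum => a _; exact: prime_kernel_le_selberg.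
under eq_bigr do rewrite -mulr_sumr big_split /=.
rewrite -mulr_sumr big_split /= mulrDr lerD //.
  apply: le_trans (ler_wpM2l c0 S_le) _; rewrite mulrCA mulrC ler_wpM2r //.
  exact: totient_ln_le_sieve_mass.
apply: le_trans (ler_wpM2l c0 (sum_small_power_kernel_le X Y m0 Nz)) _.
have c_le : c <= 2 / M%:R * ln N%:R by rewrite ler_wpM2r // totient_ratio_le.
apply: le_trans (ler_wpM2r _ c_le) _; first by rewrite !mulr_ge0 ?exprn_ge0.
rewrite [leLHS](_ : _ = (4 * m)%:R * (ln N%:R * z%:R ^+ 2)) //.
by rewrite !natrM; field; rewrite pnatr_eq0 -lt0n.
Qed.

End Bounds.

Definition prime_kernel_bounded N y b M (C s : R) : Prop :=
  restricted_bound (prime_kernel N y b (M := M)) (C * M%:R) (M%:R ^+ 2) s.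

Lemma prime_kernel_bounded_le N y b M (C C' s : R) : C <= C' ->
  prime_kernel_bounded N y b M C s -> prime_kernel_bounded N y b M C' s.
Proof. by move=> CC; apply: restricted_bound_le; rewrite ler_wpM2r. Qed.

Lemma exists_prime_kernel_bound (s : R) : 0 < s -> s < 1 ->
  exists C N0 : R, 0 < C /\ forall N y b M : nat, (0 < y)%N -> (0 < b)%N -> N0 <= N%:R ->
  (y ^ 2 <= N)%N -> (N <= y * M)%N -> (y * M <= 2 * N)%N ->
  prime_kernel_bounded N y b M C s.
Proof.
move=> s0 s1; have [k [C [k0 C0 selberg_le]]] := selberg_sqr_bilinear_le s0 s1.
have [N0 parameters] := @exists_sieve_parameters R s k 26 s0 s1 k0 isT.
exists (2 + 52 * C + 104), (Num.max 1 N0); split; first by rewrite !addr_gt0 // mulr_gt0.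
move=> N y b M y0 b0; rewrite ge_max ler1n => /andP[N1 NN0] yN NyM yMN X Y.
have M0 := blocks_gt0 N1 NyM.
have MR : 0 < M%:R :> R by rewrite ltr0n.
have trivial_le := prime_kernel_sum_le_ln y0 b0 NyM yMN X Y N1.
rewrite -/(density R X Y); set x := density R X Y in trivial_le *.
have x0 : 0 <= x by exact: density_ge0.
have xs0 : 0 <= x `^ s by exact: powR_ge0.
have C2 : 2 <= 2 + 52 * C + 104 by rewrite -addrA lerDl addr_ge0 ?mulr_ge0 // ltW.
have [lx|xl] := leP (x * ln N%:R) (x `^ s).
  apply: le_trans trivial_le _; apply: le_trans (ler_wpM2l _ lx) _; first by rewrite mulr_ge0.
  by rewrite ler_wpM2r // ler_wpM2r.
have xp : 0 < x.
  by rewrite lt_def x0 andbT; apply: contraTneq xl => ->; rewrite mul0r -leNgt powR_ge0.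
have {}xl : x `^ (s - 1) <= ln N%:R.
  by rewrite -(ler_pM2l xp) mulr_powRB1 // ltW.
have x02 : 0 < x <= 2 by rewrite xp density_le2.
have [z [z0 zM N1z]] := exists_sieve_level N1 yN NyM.
have [Q [Q0 Qz xQ lzx]] := parameters N z x NN0 (proj2 (andP N1z)) x02 xl.
have := selberg_le z y (reflected_start y b M z) Q M [set rev_ord u | u in X] Y.
rewrite density_rev_ord -/x => /(_ x02 Q0 Qz zM xQ); rewrite big_imset /=; last first.
  by move=> u u' _ _; exact: rev_ord_inj.
set G := sieve_mass R z y.
rewrite [C / G * _ * _](_ : _ = C * M%:R ^+ 2 * x `^ s / G); last by ring.
move=> /(prime_kernel_sum_le y0 b0 NyM yMN z0 (m := 26) isT N1z)/le_trans -> //.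
have tail_le : ln N%:R * z%:R ^+ 2 <= M%:R * x `^ s.
  apply: le_trans (ler_wpM2r _ lzx) _; first exact: exprn_ge0.
  by rewrite mulrAC -exprS ler_wpM2r // -natrX ler_nat (leq_trans _ zM) // leq_pexp2l.
apply: (@le_trans _ _ (52 * C * (M%:R * x `^ s) + 104 * (M%:R * x `^ s))); last first.
  by rewrite -mulrDl mulrA ler_wpM2r // ler_wpM2r // -addrA lerDr.
have -> : (2 * 26)%:R / M%:R * (C * M%:R ^+ 2 * x `^ s) = 52 * C * (M%:R * x `^ s).
  by field; rewrite gt_eqF.
by rewrite lerD2l ler_wpM2l.
Qed.

End ProgressionWeight.

(** * From blocks to functions on the integers *)

Section SupportedSums.

Lemma sum_ord_support (V : nmodType) (F : nat -> V) n L : (L <= n)%N ->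
  (forall t, (L <= t)%N -> F t = 0) -> \sum_(t < n) F t = \sum_(t < L) F t.
Proof.
move=> Ln FL; rewrite -!(big_mkord xpredT) (@big_cat_nat _ _ _ L) //=.
by rewrite [X in _ + X]big_nat_cond [X in _ + X]big1 ?addr0 // => t /andP[/andP[/FL]].
Qed.

Lemma sum_ord_support_le (R : numDomainType) (F : nat -> R) n L :
  (forall t, 0 <= F t) -> (forall t, (L <= t)%N -> F t = 0) ->
  \sum_(t < n) F t <= \sum_(t < L) F t.
Proof.
move=> F0 FL; have [nL|/ltnW Ln] := leqP n L; last by rewrite (sum_ord_support Ln FL).
by rewrite -!(big_mkord xpredT) [leRHS](@big_cat_nat _ _ _ n) //= lerDl sumr_ge0.
Qed.

Lemma sum_ord_shift_le (R : numDomainType) (F : nat -> R) (L s : nat) :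
  (forall t, 0 <= F t) -> \sum_(t < L) F (t + s)%N <= \sum_(t < L + s) F t.
Proof.
move=> F0; have shift_lt (t : 'I_L) : (t + s < L + s)%N by rewrite ltn_add2r.
apply: (ler_sum_inj (h := fun t : 'I_L => Ordinal (shift_lt t))) => //.
by move=> t t' _ _ /(congr1 val) /= /addIn /val_inj.
Qed.

Definition zero_extend (V : nmodType) L (g : 'I_L -> V) (t : nat) : V := oapp g 0 (insub t).

Lemma zero_extend_ord (V : nmodType) L (g : 'I_L -> V) (t : 'I_L) : zero_extend g t = g t.
Proof. by rewrite /zero_extend valK. Qed.

Lemma zero_extend_out (V : nmodType) L (g : 'I_L -> V) t : (L <= t)%N -> zero_extend g t = 0.
Proof. by move=> Lt; rewrite /zero_extend insubN // -leqNgt. Qed.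

Lemma zero_extend_ge0 (R : numDomainType) L (g : 'I_L -> R) :
  (forall t, 0 <= g t) -> forall t, 0 <= zero_extend g t.
Proof. by move=> g0 t; rewrite /zero_extend; case: insubP => /=. Qed.

End SupportedSums.

Section Blocks.

Lemma sum_blocks (V : nmodType) (H : nat -> V) K M y :
  \sum_(z < K * M * y) H z
    = \sum_(j : 'I_K * 'I_y) \sum_(u < M) H ((j.1 * M + u) * y + j.2)%N.
Proof.
rewrite sum_ord_mul (sum_ord_mul (fun w => \sum_(c < y) H (w * y + c)%N)).
rewrite -(pair_bigA _ (fun (i : 'I_K) (c : 'I_y) => \sum_(u < M) H ((i * M + u) * y + c)%N)) /=.
by apply: eq_bigr => i _; rewrite exchange_big.
Qed.

Lemma sum_double_blocks_le (R : numDomainType) (G : nat -> R) K M y b (B : R) :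
  (forall t, 0 <= G t) -> (forall n, \sum_(t < n) G t <= B) ->
  \sum_(j : 'I_K * 'I_y) \sum_(a < 2 * M) G ((j.1 * M + a) * y + j.2 + b)%N <= 2 * B.
Proof.
move=> G0 GB.
have -> : \sum_(j : 'I_K * 'I_y) \sum_(a < 2 * M) G ((j.1 * M + a) * y + j.2 + b)%N
    = \sum_(e < 2) \sum_(z < K * M * y) G (z + (e * M * y + b))%N.
  under [RHS]eq_bigr do rewrite (sum_blocks (fun z => G (z + (_ + b))%N)).
  rewrite [RHS]exchange_big /=; apply: eq_bigr => j _.
  rewrite (sum_ord_mul (fun a => G ((j.1 * M + a) * y + j.2 + b)%N)).
  by apply: eq_bigr => e _; apply: eq_bigr => u _; congr (G _); lia.
apply: (@le_trans _ _ (\sum_(e < 2) B)); last by rewrite sumr_const card_ord mulr_natl.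
apply: ler_sum => e _; exact: le_trans (sum_ord_shift_le _ _ G0) (GB _).
Qed.

End Blocks.

Section GlobalBound.
Variable R : realType.

Lemma sum_window_le (N y b M : nat) (u : 'I_M) (G : nat -> R) :
  (forall a, 0 <= G a) ->
  \sum_(m < M) progression_weight R N y b m * G (u + m)%N
    <= \sum_(a < 2 * M) prime_kernel R N y b u a * G a.
Proof.
move=> G0; have shift_lt (m : 'I_M) : (u + m < 2 * M)%N.
  by rewrite mul2n -addnn -addSn leq_add // ltnW.
apply: (ler_sum_inj (h := fun m : 'I_M => Ordinal (shift_lt m))) => //.
- by move=> m m' _ _ /(congr1 val) /= /addnI /val_inj.
- by move=> m _; rewrite /prime_kernel /= leq_addr addKn.
by move=> a _; rewrite mulr_ge0 // prime_kernel_ge0.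
Qed.

Section Bilinear.
Variables (r eta C : R) (N y b M : nat).
Hypotheses (r0 : 0 < r) (eta0 : 0 < eta).
Hypotheses (rBeta : 2^-1 <= r^-1 - eta) (rDeta : r^-1 + eta <= 1).
Hypotheses (C0 : 0 <= C) (M0 : (0 < M)%N).
Hypothesis kernelB : prime_kernel_bounded N y b M C (r^-1 - eta).
Hypothesis kernelD : prime_kernel_bounded N y b M C (r^-1 + eta).

Definition progression_form (n : nat) (F g : nat -> R) : R :=
  \sum_(z < n) \sum_(m < M) progression_weight R N y b m * F z * g (z + y * m + b)%N.

Definition block_const : R := interp_const r eta * (C * M%:R) * (M%:R ^+ 2) `^ (- r^-1).

Lemma block_const_ge0 : 0 <= block_const.
Proof.
apply: mulr_ge0 (powR_ge0 _ _); apply: mulr_ge0 (ltW (interp_const_gt0 r0 eta0)) _.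
exact: mulr_ge0.
Qed.

Lemma progression_form_le (K : nat) (F g : nat -> R) (B : R) :
  (forall z, 0 <= F z) -> (forall z, 0 <= g z) ->
  (forall n, \sum_(t < n) g t `^ r <= B) ->
  progression_form (K * M * y) F g
    <= block_const * ((\sum_(z < K * M * y) F z `^ r) `^ r^-1 * (2 * B) `^ r^-1).
Proof.
move=> F0 g0 gB.
pose f (j : 'I_K * 'I_y) (u : 'I_M) := F ((j.1 * M + u) * y + j.2)%N.
pose h (j : 'I_K * 'I_y) (a : 'I_(2 * M)) := g ((j.1 * M + a) * y + j.2 + b)%N.
rewrite /progression_form (sum_blocks (fun z =>
  \sum_(m < M) progression_weight R N y b m * F z * g (z + y * m + b)%N)).
apply: (@le_trans _ _ (\sum_j block_const * (fin_lpnorm r (f j) * fin_lpnorm r (h j)))).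
  apply: ler_sum => j _.
  apply: (@le_trans _ _ (\sum_u \sum_a prime_kernel R N y b u a * f j u * h j a)).
    apply: ler_sum => u _; pose G a := f j u * g ((j.1 * M + a) * y + j.2 + b)%N.
    rewrite (eq_bigr (fun m : 'I_M => progression_weight R N y b m * G (u + m)%N)); last first.
      by move=> m _; rewrite /G /f mulrA; congr (_ * g _); ring.
    under [leRHS]eq_bigr do rewrite -mulrA.
    by apply: (@sum_window_le N y b M u G) => a; rewrite mulr_ge0 /f ?F0 ?g0.
  apply: interpolation; rewrite ?exprn_gt0 ?ltr0n ?mulr_ge0 //.
  - by move=> u a; exact: prime_kernel_ge0.
  - by move=> u; exact: F0.
  by move=> a; exact: g0.
rewrite -mulr_sumr ler_wpM2l ?block_const_ge0 //.
have lp_ge0 (T : finType) (q : T -> R) : 0 <= \sum_t q t `^ r.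
  by apply: sumr_ge0 => t _; exact: powR_ge0.
apply: le_trans (sum_powR_mul_le _ (fun j => lp_ge0 _ (f j)) (fun j => lp_ge0 _ (h j))) _.
  by move: rBeta eta0; lra.
rewrite (sum_blocks (fun z => F z `^ r)) ler_wpM2l ?powR_ge0 //.
rewrite ler_powR_base ?invr_ge0 ?(ltW r0) ?sumr_ge0 //.
exact: (sum_double_blocks_le _ _ _ _ (fun t => powR_ge0 (g t) r) gB).
Qed.

Definition progression_avg (F : nat -> R) (t : nat) : R :=
  \sum_(m < M) progression_weight R N y b m *
    (if (y * m + b <= t)%N then F (t - (y * m + b))%N else 0).

Lemma progression_avg_ge0 (F : nat -> R) t : (forall z, 0 <= F z) -> 0 <= progression_avg F t.
Proof.
move=> F0; apply: sumr_ge0 => m _; rewrite mulr_ge0 ?progression_weight_ge0 //.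
by case: ifP => // _; exact: F0.
Qed.

Lemma sum_progression_avg_mul_le (F g : nat -> R) (L n : nat) :
  (forall z, 0 <= F z) -> (forall z, 0 <= g z) -> (L <= n)%N ->
  \sum_(t < L) progression_avg F t * g t <= progression_form n F g.
Proof.
move=> F0 g0 Ln; rewrite /progression_form exchange_big /=.
under eq_bigr do rewrite mulr_suml.
rewrite exchange_big; apply: ler_sum => m _.
rewrite (eq_bigr (fun t : 'I_L => if (y * m + b <= t)%N then
   progression_weight R N y b m * F (t - (y * m + b))%N * g t else 0)); last first.
  by move=> t _; case: ifP => // _; rewrite mulr0 mul0r.
rewrite -big_mkcond /=.
have backshift_lt (t : 'I_L) : (t - (y * m + b) < n)%N.
  by apply: leq_trans Ln; apply: leq_ltn_trans (ltn_ord t); exact: leq_subr.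
apply: (ler_sum_inj (h := fun t : 'I_L => Ordinal (backshift_lt t))) => //.
- move=> t t' mt mt' /(congr1 val) /= e; apply/val_inj => /=.
  by rewrite -(subnK mt) -(subnK mt') e.
- by move=> t mt /=; rewrite -addnA subnK.
by move=> z _; rewrite !mulr_ge0 ?progression_weight_ge0.
Qed.

Lemma progression_avg_norm_le (r' : R) (F : nat -> R) (L n : nat) :
  1 < r -> r^-1 + r'^-1 = 1 -> (0 < y)%N ->
  (forall z, 0 <= F z) -> (forall z, (L <= z)%N -> F z = 0) ->
  fin_lpnorm r' (fun t : 'I_n => progression_avg F t)
    <= 2 * block_const * fin_lpnorm r (fun z : 'I_L => F z).
Proof.
move=> r1 conj y0 F0 FL.
apply: (fin_lpnorm_duality r1 conj) => [|t|g g0].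
- exact: mulr_ge0 (mulr_ge0 (ler0n _ 2) block_const_ge0) (fin_lpnorm_ge0 _ _).
- exact: progression_avg_ge0.
pose B := \sum_t g t `^ r; have B0 : 0 <= B by apply: sumr_ge0 => t _; exact: powR_ge0.
have gE0 := zero_extend_ge0 g0.
have gB k : \sum_(t < k) zero_extend g t `^ r <= B.
  rewrite /B -(eq_bigr _ (fun t _ => congr1 (fun x => x `^ r) (zero_extend_ord g t))).
  apply: (sum_ord_support_le (F := fun t => zero_extend g t `^ r)) => t.
    exact: powR_ge0.
  by move=> nt; rewrite zero_extend_out // powR0 // gt_eqF.
under eq_bigr do rewrite -(zero_extend_ord g).
pose K := maxn n L.
have le_blocks k : (k <= K -> k <= K * M * y)%N.
  by move=> kK; rewrite -mulnA (leq_trans kK) // leq_pmulr // muln_gt0 M0.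
apply: le_trans (sum_progression_avg_mul_le F0 gE0 (le_blocks n (leq_maxl _ _))) _.
apply: le_trans (progression_form_le K F0 gE0 gB) _.
rewrite (sum_ord_support (F := fun z => F z `^ r) (le_blocks L (leq_maxr _ _))); last first.
  by move=> z Lz; rewrite FL // powR0 // gt_eqF.
rewrite -/(fin_lpnorm r (fun z : 'I_L => F z)) powRM //.
rewrite [leRHS](_ : _ = block_const * (fin_lpnorm r (fun z : 'I_L => F z) * (2 * B `^ r^-1))).
  rewrite ler_wpM2l ?block_const_ge0 // ler_wpM2l ?fin_lpnorm_ge0 // ler_wpM2r ?powR_ge0 //.
  by rewrite ler1_powR ?ler1n // invf_le1 // ltW.
by rewrite /fin_lpnorm -/B; ring.
Qed.

End Bilinear.

End GlobalBound.

(** * Norms on the integers *)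

Section IntegerNorms.
Variable R : realType.
Local Notation normc := ComplexField.Normc.normc.
Implicit Types f : int -> R[i].

Lemma normc_ge0 (x : R[i]) : 0 <= normc x.
Proof. by case: x => a b; exact: sqrtr_ge0. Qed.

Lemma normc_sum_le (T : Type) (s : seq T) (P : pred T) (F : T -> R[i]) :
  normc (\sum_(i <- s | P i) F i) <= \sum_(i <- s | P i) normc (F i).
Proof.
elim/big_ind2: _ => [|x a y b xa yb|//]; first by rewrite ComplexField.Normc.normc0.
by apply: le_trans (le_normcD _ _) _; apply: lerD.
Qed.

Lemma normcZ (a : R) (x : R[i]) : 0 <= a -> normc (a%:C%C * x) = a * normc x.
Proof.
move=> a0; rewrite ComplexField.Normc.normcM; congr (_ * _).
by rewrite /= expr0n /= addr0 sqrtr_sqr ger0_norm.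
Qed.

Lemma esum_window (F : int -> R) (B L : nat) : (forall x, 0 <= F x) ->
  (forall x, F x != 0 -> - Posz B <= x < Posz L - Posz B) ->
  \esum_(x in [set: int]) (F x)%:E = (\sum_(t < L) F (Posz t - Posz B))%:E.
Proof.
move=> F0 FB; pose e (t : nat) : int := Posz t - Posz B.
have einj : injective e by move=> t t'; rewrite /e => /addIr [].
transitivity (\esum_(x in [set e t | t in `I_L]%classic) (F x)%:E).
  rewrite [RHS]esum_mkcond; apply: eq_esum => x _; case: ifPn => // xI.
  apply/eqP; rewrite eqe; apply: contraNT xI => /FB xB.
  by apply: classical_sets.mem_set; exists (absz (x + Posz B)); rewrite /e /=; lia.
rewrite esum_image; last by move=> t t' _ _; exact: einj.
rewrite esum_fset //; last by move=> t _; rewrite lee_fin.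
by rewrite -fsbig_ord sumEFin.
Qed.

Lemma lpnorm_window (p : R) f (B L : nat) : p != 0 ->
  (forall x, f x != 0 -> - Posz B <= x < Posz L - Posz B) ->
  lpnorm p f = fin_lpnorm p (fun t : 'I_L => normc (f (Posz t - Posz B))).
Proof.
move=> p0 fB; rewrite /lpnorm (@esum_window (fun x => normc (f x) `^ p) B L) //.
  by move=> x; exact: powR_ge0.
move=> x fx; apply: fB; apply: contra_neq fx => ->.
by rewrite ComplexField.Normc.normc0 powR0.
Qed.

Lemma finitely_supported_bound f : finitely_supported f ->
  exists B : nat, forall x, f x != 0 -> - Posz B <= x <= Posz B.
Proof.
move=> /finite_seqP[s sE]; exists (\max_(x <- s) `|x|%N)%N => x fx.
have xs : x \in s.
  by have : [set x | f x != 0]%classic x by []; rewrite sE.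
by have : (`|x|%N <= \max_(x <- s) `|x|%N)%N; [exact: leq_bigmax_seq|lia].
Qed.

End IntegerNorms.

Section ProgressionAverage.
Variable R : realType.
Local Notation normc := ComplexField.Normc.normc.
Implicit Types (N y b M B : nat) (f : int -> R[i]).

Lemma progression_index n y b : (0 < n)%N -> (0 < b <= y)%N -> (n %% y == b %% y)%N ->
  (n = b + y * ((n - b) %/ y))%N.
Proof.
move=> n0 /andP[b0 by_] nb; have bn : (b <= n)%N.
  move: by_; rewrite leq_eqVlt => /orP[/eqP bE|bly].
    by rewrite bE; apply: dvdn_leq => //; move: nb; rewrite bE modnn /dvdn.
  by rewrite -(modn_small bly) -(eqP nb) leq_mod.
by rewrite mulnC divnK ?subnKC // -eqn_mod_dvd.
Qed.

Lemma normc_Aavg_le N y b M B f (t : nat) :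
  (0 < b <= y)%N -> (N <= y * M)%N ->
  (forall x, f x != 0 -> - Posz B <= x <= Posz B) ->
  normc (Aavg N y b f (Posz t - Posz B))
   <= progression_avg N y b M (fun z => normc (f (Posz z - Posz B))) t.
Proof.
move=> byb NyM fB; have y0 : (0 < y)%N by case/andP: byb => b0; exact: leq_trans.
have c0 : 0 <= (totient y)%:R / N%:R :> R by rewrite divr_ge0.
rewrite /Aavg normcZ //; apply: le_trans (ler_wpM2l c0 (normc_sum_le _ _ _)) _.
rewrite mulr_sumr big_geq_mkord.
have index (n : 'I_N) : (n %% y == b %% y)%N && (0 < n)%N -> n = (b + y * ((n - b) %/ y))%N :> nat.
  by move=> /andP[nb n0]; exact: progression_index.
have index_lt (n : 'I_N) : ((n - b) %/ y < M)%N.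
  rewrite ltn_divLR // mulnC; apply: leq_trans NyM; apply: leq_ltn_trans (ltn_ord n).
  exact: leq_subr.
apply: (ler_sum_inj (h := fun n : 'I_N => Ordinal (index_lt n))) => //.
- move=> n n' /index ne /index ne' /(congr1 val) /= e.
  by apply/val_inj => /=; rewrite ne ne' e.
- move=> n /index ne /=; set m := ((n - b) %/ y)%N in ne *.
  rewrite /progression_weight -ne ltn_ord normcZ ?vonMangoldt_ge0 // [(y * m + b)%N]addnC -ne.
  rewrite mulrA ler_wpM2l ?mulr_ge0 ?vonMangoldt_ge0 //; case: leqP => nt.
    by rewrite (_ : Posz t - Posz B - Posz n = Posz (t - n) - Posz B) //; lia.
  rewrite [X in normc X](_ : _ = 0) ?ComplexField.Normc.normc0 //.
  by apply/eqP; apply: contraTT isT => /fB; lia.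
move=> m _; rewrite mulr_ge0 ?progression_weight_ge0 //; case: ifP => // _; exact: normc_ge0.
Qed.

Lemma Aavg_support N y b B f (x : int) :
  (forall x, f x != 0 -> - Posz B <= x <= Posz B) ->
  Aavg N y b f x != 0 -> - Posz B <= x <= Posz B + Posz N.
Proof.
move=> fB; apply: contraNT => nx.
rewrite /Aavg big_nat_cond big1 ?mulr0 // => n /andP[/andP[n1 nN] _].
rewrite [f _](_ : _ = 0) ?mulr0 //; apply/eqP; apply: contraNT nx => /fB; lia.
Qed.

Section Exponents.
Variables (r r' : R).
Hypotheses (r1 : 1 < r) (r2 : r < 2) (conj : r^-1 + r'^-1 = 1).

Lemma conjugate_gt0 : 0 < r'.
Proof.
have rV1 : r^-1 < 1 by rewrite invf_lt1 // (lt_trans ltr01 r1).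
by rewrite -invr_gt0; move: conj rV1; lra.
Qed.

Lemma lpnorm_Aavg_le_block (eta C : R) N y b M f :
  0 < eta -> 2^-1 <= r^-1 - eta -> r^-1 + eta <= 1 -> 0 <= C ->
  (0 < b <= y)%N -> (0 < M)%N -> (N <= y * M)%N ->
  prime_kernel_bounded N y b M C (r^-1 - eta) -> prime_kernel_bounded N y b M C (r^-1 + eta) ->
  finitely_supported f ->
  lpnorm r' (Aavg N y b f) <= 2 * block_const r eta C M * lpnorm r f.
Proof.
move=> eta0 rBeta rDeta C0 byb M0 NyM kB kD /finitely_supported_bound[B fB].
have r0 : 0 < r := lt_trans ltr01 r1.
have y0 : (0 < y)%N by case/andP: byb => b0; exact: leq_trans.
pose F z := normc (f (Posz z - Posz B)).
have F0 z : 0 <= F z by exact: normc_ge0.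
have FL z : ((2 * B).+1 <= z)%N -> F z = 0.
  move=> Lz; rewrite /F [f _](_ : _ = 0) ?ComplexField.Normc.normc0 //.
  by apply/eqP; apply: contraTT isT => /fB; lia.
rewrite (@lpnorm_window _ r f B (2 * B).+1) ?gt_eqF //; last by move=> x /fB; lia.
rewrite (@lpnorm_window _ r' _ B ((2 * B).+1 + N)) ?gt_eqF ?conjugate_gt0 //; last first.
  by move=> x /(Aavg_support fB); lia.
apply: le_trans (progression_avg_norm_le r0 eta0 rBeta rDeta C0 M0 kB kD _ r1 conj y0 F0 FL).
have r'0 := conjugate_gt0.
apply: ler_powR_base; first by rewrite invr_ge0 ltW.
  by apply: sumr_ge0 => t _; exact: powR_ge0.
apply: ler_sum => t _; rewrite ler_powR_base ?(ltW r'0) ?normc_ge0 //.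
exact: normc_Aavg_le.
Qed.

Lemma block_constE (eta C : R) M : (0 < M)%N ->
  block_const r eta C M = interp_const r eta * C * M%:R^-1 `^ (r^-1 - r'^-1).
Proof.
move=> M0; have MR : 0 < M%:R :> R by rewrite ltr0n.
rewrite /block_const [_ * (C * _)]mulrA -mulrA; congr (_ * _).
rewrite -[M%:R^-1]powR_inv1 // -powRrM -[M%:R ^+ 2]powR_mulrn // -powRrM.
rewrite -{1}[M%:R]powRr1 // -powRD ?(gt_eqF MR) ?implybT //.
by congr (_ `^ _); move: conj; lra.
Qed.

Lemma exists_interpolation_radius : exists eta : R,
  [/\ 0 < eta, 0 < r^-1 - eta, 2^-1 <= r^-1 - eta & r^-1 + eta < 1].
Proof.
have r0 : 0 < r := lt_trans ltr01 r1.
have rV2 : 2^-1 < r^-1 by rewrite ltf_pV2 ?posrE.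
have rV1 : r^-1 < 1 by rewrite invf_lt1.
have [left_le|right_lt] := leP (r^-1 - 2^-1) (1 - r^-1).
  by exists ((r^-1 - 2^-1) / 2); split; lra.
by exists ((1 - r^-1) / 2); split; lra.
Qed.

Lemma lpnorm_Aavg_le : exists C N0 : R, 0 < C /\
  forall N y b f, (0 < b <= y)%N -> N0 <= N%:R -> (y ^ 2 <= N)%N -> finitely_supported f ->
  lpnorm r' (Aavg N y b f) <= C * (y%:R / N%:R) `^ (r^-1 - r'^-1) * lpnorm r f.
Proof.
have r0 : 0 < r := lt_trans ltr01 r1.
have [eta [eta0 rB0 rBeta rDeta]] := exists_interpolation_radius.
have [CB [NB [CB0 kernelB]]] := @exists_prime_kernel_bound R (r^-1 - eta) rB0 ltac:(lra).
have [CD [ND [CD0 kernelD]]] := @exists_prime_kernel_bound R (r^-1 + eta) ltac:(lra) rDeta.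
have C0 := addr_gt0 CB0 CD0; have I0 := interp_const_gt0 r0 eta0.
exists (2 * (interp_const r eta * (CB + CD))), (Num.max NB ND).
split => [|N y b f byb]; first by rewrite mulr_gt0 // mulr_gt0.
rewrite ge_max => /andP[NB_le ND_le] yN fs; have /andP[b0 b_le] := byb.
have y0 : (0 < y)%N by exact: leq_trans b_le.
have N0 : (0 < N)%N by apply: leq_trans yN; rewrite expn_gt0 y0.
pose M := (N %/ y).+1.
have NyM : (N <= y * M)%N by rewrite mulnC ltnW // ltn_ceil.
have yMN : (y * M <= 2 * N)%N.
  rewrite /M mulnS mul2n -addnn leq_add //; last by rewrite mulnC leq_divM.
  by apply: leq_trans yN; rewrite -{1}[y]expn1 leq_pexp2l.
have kB : prime_kernel_bounded N y b M (CB + CD) (r^-1 - eta).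
  by apply: prime_kernel_bounded_le (kernelB _ _ _ _ y0 b0 NB_le yN NyM yMN); rewrite lerDl ltW.
have kD : prime_kernel_bounded N y b M (CB + CD) (r^-1 + eta).
  by apply: prime_kernel_bounded_le (kernelD _ _ _ _ y0 b0 ND_le yN NyM yMN); rewrite lerDr ltW.
apply: le_trans (lpnorm_Aavg_le_block eta0 rBeta (ltW rDeta) (ltW C0) byb (ltn0Sn _) NyM
  kB kD fs) _.
rewrite block_constE // ler_wpM2r ?powR_ge0 // mulrA ler_wpM2l //.
  exact: mulr_ge0 (ler0n _ 2) (mulr_ge0 (ltW I0) (ltW C0)).
rewrite ler_powR_base ?invr_ge0 //; first by move: conj; lra.
by rewrite ler_pdivlMr ?ltr0n // mulrC ler_pdivrMr // -natrM ler_nat.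
Qed.

End Exponents.

Lemma expR_threshold (N0 delta : R) : 0 < delta -> exists2 c : R, 0 < c &
  forall y N : nat, (0 < y)%N -> expR (c * y%:R `^ delta) < N%:R ->
  N0 <= N%:R /\ (y ^ 2 <= N)%N.
Proof.
move=> delta0; have d0 : 0 < 2 / delta by rewrite divr_gt0.
exists (`|N0| + 2 / delta) => [|y N y0 yN]; first by rewrite ltr_wpDl.
have ln_y0 : 0 <= ln (y%:R : R) by rewrite ln_ge0 // ler1n.
have yd1 : 1 <= (y%:R : R) `^ delta by rewrite powR_ge1 ?ler1n // ltW.
have ln_y_le : 2 * ln (y%:R : R) <= 2 / delta * y%:R `^ delta.
  by rewrite -mulrA ler_wpM2l // ln_le_powR // ltr0n.
have N0_le : `|N0| <= `|N0| * y%:R `^ delta by rewrite ler_peMr.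
have expR_le x : x <= `|N0| + 2 * ln (y%:R : R) -> expR x <= N%:R.
  by move=> xle; apply: le_trans (ltW yN); rewrite ler_expR mulrDl (le_trans xle) // lerD.
have N0_norm := ler_norm N0; have N0_ge0 := normr_ge0 N0; split.
  by apply: le_trans (expR_le N0 _); [have := expR_ge1Dx N0; lra|lra].
rewrite -(ler_nat R) natrX; apply: le_trans (expR_le (2 * ln y%:R) _); last by lra.
by rewrite expRM_natl lnK // posrE ltr0n.
Qed.

End ProgressionAverage.

Theorem theorem1p1 (R : realType) (r : R) (hr1 : 1 < r) (hr2 : r < 2) :
  let r' := r / (r - 1) in
  exists Cr : R, 0 < Cr /\
  forall delta : R, 0 < delta ->
  exists Crd : R, 0 < Crd /\
  forall y : nat, (1 <= y)%N ->
  forall N : nat, (y <= N)%N -> expR (Crd * (y%:R `^ delta)) < N%:R ->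
  forall f : int -> R[i], finitely_supported f ->
  forall b : nat, (1 <= b <= y)%N -> coprime b y ->
    lpnorm r' (Aavg N y b f)
      <= Cr * ((y%:R / N%:R) `^ (r^-1 - r'^-1)) * lpnorm r f.
Proof.
move=> r'; have conj : r^-1 + r'^-1 = 1.
  by rewrite /r'; field; apply/andP; split; lra.
have [Cr [N0 [Cr0 avg_le]]] := lpnorm_Aavg_le hr1 hr2 conj.
exists Cr; split=> // delta delta0.
have [Crd Crd0 threshold] := expR_threshold N0 delta0.
exists Crd; split=> // y y1 N _ yN f fs b byb _.
have [N0N y2N] := threshold y N y1 yN.
exact: avg_le.
Qed.
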